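(* Let $H\neq\{0\}$ be a countable discrete abelian group, $\mu$ a normalized scalar $2$-cocycle of $H$, $\chi$ a character of $H$, and let $\beta(H,\mu,\chi)$ be the associated twisted Bernoulli shift action of $\mathbb{Z}^2\rtimes\mathrm{SL}(2,\mathbb{Z})$ on $N(H,\mu)$. For every $\pi\in\mathrm{Aut}(N(H,\mu),\beta(H,\mu,\chi))$ there exists a unique element $\phi=\phi_\pi\in\mathrm{Aut}(H,\mu^*\mu,\chi^2)$ satisfying $\pi(u(\lambda))=u(\phi\circ\lambda)$ modulo $\mathbb{T}$ (i.e. up to a scalar in $\mathbb{T}$) for all $\lambda\in\Lambda(H)$. The map $\pi\mapsto\phi_\pi$ gives an isomorphism of topological groups $$\mathrm{Aut}(N(H,\mu),\beta(H,\mu,\chi))\cong\mathrm{Aut}(H,\mu^*\mu,\chi^2).$$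
   Context: Notation. $\mathbb{T}=\{z\in\mathbb{C}: |z|=1\}$. Let $H\neq\{0\}$ be a countable discrete abelian group (written additively), $\mu\colon H\times H\to\mathbb{T}$ a scalar $2$-cocycle which is normalized ($\mu(g,0)=\mu(0,g)=1$), and $\chi\colon H\to\mathbb{T}$ a character. For a discrete group $\Lambda$ with scalar $2$-cocycle $\nu$, the twisted group von Neumann algebra $L_\nu(\Lambda)$ is generated by unitaries $u(\lambda)$, $\lambda\in\Lambda$, on $\ell^2\Lambda$ with $u(\lambda)\delta_g=\nu(\lambda,g)\delta_{\lambda g}$, and carries the faithful normal trace $\langle\,\cdot\,\delta_e,\delta_e\rangle$. $\Lambda(H)$ is the abelian group (pointwise addition) of finitely supported functions $\lambda\colon\mathbb{Z}^2\to H$ with $\sum_{k\in\mathbb{Z}^2}\lambda(k)=0$. Put $\widetilde\mu(\lambda_1,\lambda_2)=\prod_{k\in\mathbb{Z}^2}\mu(\lambda_1(k),\lambda_2(k))$ and $N(H,\mu)=L_{\widetilde\mu}(\Lambda(H))$, with canonical unitaries $u(\lambda)$, $\lambda\in\Lambda(H)$. For $k=(q,r)^T$, $k_0=(q_0,r_0)^T\in\mathbb{Z}^2$ put $\det(k,k_0)=qr_0-rq_0$. The group $\mathbb{Z}^2\rtimes\mathrm{SL}(2,\mathbb{Z})$ acts on $\mathbb{Z}^2$ by $(k,\gamma)\cdot l=k+\gamma l$, and on functions by $((k,\gamma)\cdot\lambda)(l)=\lambda((k,\gamma)^{-1}\cdot l)$. The twisted Bernoulli shift action $\beta=\beta(H,\mu,\chi)$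 is the trace preserving action of $\mathbb{Z}^2\rtimes\mathrm{SL}(2,\mathbb{Z})$ on $N(H,\mu)$ determined by $\beta(k,\gamma)=\beta(k)\circ\beta(\gamma)$, where for $k\in\mathbb{Z}^2$, $\gamma\in\mathrm{SL}(2,\mathbb{Z})$, $\lambda\in\Lambda(H)$, $$\beta(\gamma)(u(\lambda))=u(\gamma\cdot\lambda),\qquad \beta(k)(u(\lambda))=\Big(\prod_{m\in\mathbb{Z}^2}\chi(\lambda(m))^{\det(k,m)}\Big)u(k\cdot\lambda).$$ $\mathrm{Aut}(N,\beta)$ is the group of all $*$-automorphisms $\alpha$ of $N$ (not assumed trace preserving) with $\beta(\gamma)\circ\alpha=\alpha\circ\beta(\gamma)$ for all $\gamma$, with the pointwise-strong topology; for twisted Bernoulli shift actions such $\alpha$ are automatically trace preserving, and the topology is the pointwise $2$-norm topology. $\mu^*\mu(g,h)=\overline{\mu(h,g)}\,\mu(g,h)$, a bicharacter of $H$. $\mathrm{Aut}(H,\mu^*\mu,\chi^2)$ is the group of all $\phi\in\mathrm{Aut}(H)$ with $\mu^*\mu(\phi(g),\phi(h))=\mu^*\mu(g,h)$ and $\chi(\phi(g))^2=\chi(g)^2$ for all $g,h\in H$, with the topology of pointwise convergence ($H$ discrete). *)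

(* Defs.v *)
From HB Require Import structures.
From mathcomp Require Import all_boot all_order all_algebra finmap.
From mathcomp Require Import all_classical all_reals all_analysis.
From mathcomp Require Import complex.
From mathcomp Require Import ring lra.

Set Implicit Arguments.
Unset Strict Implicit.
Unset Printing Implicit Defensive.

Import Order.TTheory GRing.Theory Num.Theory.
Import numFieldNormedType.Exports.
Import Normc.

Local Open Scope classical_set_scope.
Local Open Scope ring_scope.

(* A group and a topology, with no compatibility required: that the group
   operations are continuous is not part of the structure. *)
HB.structure Definition PreTopologicalGroup := {G of Topological G & Group G}.

Section ell2.
Context {R : realType} {I : choiceType}.
Implicit Types f g : I -> R[i].

Definition sqnorm f : \bar R := (\esum_(i in [set: I]) ((normc (f i)) ^+ 2)%:E)%E.

Definition square_summable : {pred I -> R[i]} :=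
  fun f => `[< (sqnorm f < +oo)%E >].

Lemma sqnorm_ge0 f : (0 <= sqnorm f)%E.
Proof. by apply: esum_ge0 => i _; rewrite lee_fin sqr_ge0. Qed.

Lemma sqnorm_fsum_le f (s : {fset I}) : f \in square_summable ->
  \sum_(i <- s) (normc (f i)) ^+ 2 <= fine (sqnorm f).
Proof.
move=> /asboolP fo; rewrite -lee_fin fineK; last first.
  by rewrite ge0_fin_numE// sqnorm_ge0.
rewrite /sqnorm; apply: esum_ge; exists [set` s] => //.
by rewrite -fsbig_seq ?fset_uniq// -sumEFin; apply: lexx.
Qed.

Lemma sqnorm_le f (M : R) :
  (forall s : {fset I}, \sum_(i <- s) (normc (f i)) ^+ 2 <= M) ->
  (sqnorm f <= M%:E)%E.
Proof.
move=> fM; apply: ge_ereal_sup => _ [A [finA _] <-].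
by rewrite fsbig_finite//= sumEFin lee_fin.
Qed.

Lemma sqnorm_le_mem f (M : R) :
  (forall s : {fset I}, \sum_(i <- s) (normc (f i)) ^+ 2 <= M) ->
  f \in square_summable /\ fine (sqnorm f) <= M.
Proof.
move=> /sqnorm_le fM; have fo : (sqnorm f < +oo)%E by apply: le_lt_trans fM (ltry _).
split; first exact/asboolP.
by rewrite -lee_fin fineK// ge0_fin_numE// sqnorm_ge0.
Qed.

Lemma normc_ge0 (a : R[i]) : 0 <= normc a.
Proof. by case: a => a b; rewrite /= sqrtr_ge0. Qed.

Lemma normcD_sqr (a b : R[i]) (t : R) : 0 < t ->
  (normc (a + b)) ^+ 2 <= (1 + t) * (normc a) ^+ 2 + (1 + t^-1) * (normc b) ^+ 2.
Proof.
move=> t0; have := le_normcD a b.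
move: (normc_ge0 a) (normc_ge0 b) (normc_ge0 (a + b)).
move: (normc a) (normc b) (normc (a + b)) => x y z x0 y0 z0 zxy.
apply: (@le_trans _ _ ((x + y) ^+ 2)); first by rewrite lerXn2r// nnegrE addr_ge0.
rewrite -subr_ge0.
have -> : (1 + t) * x ^+ 2 + (1 + t^-1) * y ^+ 2 - (x + y) ^+ 2 =
   t * (x - t^-1 * y) ^+ 2.
  by field; rewrite gt_eqF.
by rewrite mulr_ge0 ?sqr_ge0// ltW.
Qed.

Definition l2norm f : R := Num.sqrt (fine (sqnorm f)).

Lemma l2norm_ge0 f : 0 <= l2norm f.
Proof. exact: sqrtr_ge0. Qed.

Lemma l2norm_sqr f : l2norm f ^+ 2 = fine (sqnorm f).
Proof. by rewrite sqr_sqrtr// fine_ge0// sqnorm_ge0. Qed.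

Lemma l2norm_fsum_le f (s : {fset I}) : f \in square_summable ->
  \sum_(i <- s) (normc (f i)) ^+ 2 <= l2norm f ^+ 2.
Proof. by rewrite l2norm_sqr; exact: sqnorm_fsum_le. Qed.

Lemma l2norm_le f (M : R) : 0 <= M ->
  (forall s : {fset I}, \sum_(i <- s) (normc (f i)) ^+ 2 <= M ^+ 2) ->
  f \in square_summable /\ l2norm f <= M.
Proof.
move=> M0 /sqnorm_le_mem[fo fM]; split=> //.
by rewrite -(ler_pXn2r (ltn0Sn 1)) ?nnegrE ?l2norm_ge0// l2norm_sqr.
Qed.

Lemma l2normD_fsum f g (t : R) (s : {fset I}) : 0 < t ->
  f \in square_summable -> g \in square_summable ->
  \sum_(i <- s) (normc ((f + g) i)) ^+ 2 <=
    (1 + t) * l2norm f ^+ 2 + (1 + t^-1) * l2norm g ^+ 2.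
Proof.
move=> t0 fo go.
have t1 : 0 < t^-1 by rewrite invr_gt0.
apply: (@le_trans _ _ (\sum_(i <- s) ((1 + t) * (normc (f i)) ^+ 2 +
   (1 + t^-1) * (normc (g i)) ^+ 2))).
  by apply: ler_sum => i _; exact: normcD_sqr.
rewrite big_split -!mulr_sumr; apply: lerD.
- by apply: ler_wpM2l; [lra | exact: l2norm_fsum_le].
- by apply: ler_wpM2l; [lra | exact: l2norm_fsum_le].
Qed.

Lemma l2norm0_eq0 f : f \in square_summable -> l2norm f = 0 -> f = 0.
Proof.
move=> fo f0; apply/funext => i; apply: eq0_normc.
have := l2norm_fsum_le [fset i]%fset fo.
rewrite big_seq_fset1 f0 expr0n /=; have := normc_ge0 (f i); nra.
Qed.

Lemma l2norm0 : 0 \in square_summable /\ l2norm 0 = 0.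
Proof.
have [//|s|oo n0] := @l2norm_le 0 0; last first.
  by split=> //; apply/eqP; rewrite eq_le n0 l2norm_ge0.
by rewrite big1 ?expr0n// => i _; rewrite [normc _]normc0 expr0n.
Qed.

Lemma l2normD f g : f \in square_summable -> g \in square_summable ->
  f + g \in square_summable /\ l2norm (f + g) <= l2norm f + l2norm g.
Proof.
move=> fo go.
have [/(l2norm0_eq0 fo)->|f0] := eqVneq (l2norm f) 0.
  by rewrite add0r l2norm0.2 add0r.
have [/(l2norm0_eq0 go)->|g0] := eqVneq (l2norm g) 0.
  by rewrite addr0 l2norm0.2 addr0.
have f1 : 0 < l2norm f by rewrite lt0r f0 l2norm_ge0.
have g1 : 0 < l2norm g by rewrite lt0r g0 l2norm_ge0.
apply: l2norm_le => [|s]; first by rewrite addr_ge0// ltW.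
have := l2normD_fsum s (divr_gt0 g1 f1) fo go.
move=> /le_trans; apply; rewrite le_eqVlt; apply/orP; left; apply/eqP.
by field; rewrite f0 g0.
Qed.

Lemma l2normZ_le f (c : R[i]) : f \in square_summable ->
  c *: f \in square_summable /\ l2norm (c *: f) <= normc c * l2norm f.
Proof.
move=> fo; apply: l2norm_le => [|s].
  by rewrite mulr_ge0 ?normc_ge0 ?l2norm_ge0.
rewrite exprMn (eq_bigr (fun i => normc c ^+ 2 * normc (f i) ^+ 2)); last first.
  by move=> i _; rewrite -exprMn -normcM.
by rewrite -mulr_sumr ler_wpM2l ?sqr_ge0// l2norm_fsum_le.
Qed.

Lemma l2normZ f (c : R[i]) : f \in square_summable ->
  l2norm (c *: f) = normc c * l2norm f.
Proof.
move=> fo; have [cfo cf] := l2normZ_le c fo.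
have [->|c0] := eqVneq c 0; first by rewrite scale0r normc0 mul0r l2norm0.2.
apply/eqP; rewrite eq_le cf/=.
have [_] := l2normZ_le c^-1 cfo; rewrite scalerA mulVf// scale1r normcV => h.
have nc : 0 < normc c.
  by rewrite lt0r normc_ge0 andbT; apply: contra_neq c0; exact: eq0_normc.
by rewrite -ler_pdivlMl.
Qed.

Lemma square_summable_submod_closed : submod_closed square_summable.
Proof.
split=> [|c f g fo go]; first exact: l2norm0.1.
exact: (l2normD (l2normZ_le c fo).1 go).1.
Qed.

HB.instance Definition _ := GRing.isSubmodClosed.Build R[i] (I -> R[i])
  square_summable square_summable_submod_closed.
End ell2.

(* The norm takes values in R[i], as everywhere for a normedModType R[i]. *)
Definition ell2 (R : realType) (I : choiceType) : Type :=
  {f : I -> R[i] | f \in @square_summable R I}.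

Definition Ell2 (R : realType) (I : choiceType) (f : I -> R[i])
    (fP : f \in square_summable) : ell2 R I :=
  exist (fun f => f \in square_summable) f fP.

Section ell2_type.
Context (R : realType) (I : choiceType).
Local Notation E := (ell2 R I).

HB.instance Definition _ := [isSub of E for @sval _ _].
HB.instance Definition _ := [Choice of E by <:].
HB.instance Definition _ := [SubChoice_isSubLmodule of E by <:].

Definition ell2_norm (x : E) : R[i] := (l2norm (\val x))%:C%C.

Lemma ell2_normD (x y : E) : ell2_norm (x + y) <= ell2_norm x + ell2_norm y.
Proof.
rewrite /ell2_norm -rmorphD lecR.
exact: (l2normD (valP x) (valP y)).2.
Qed.

Lemma ell2_normZ (c : R[i]) (x : E) : ell2_norm (c *: x) = `|c| * ell2_norm x.
Proof.
by rewrite /ell2_norm [\val _]/(c *: \val x) l2normZ ?(valP x)// rmorphM.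
Qed.

Lemma ell2_norm0_eq0 (x : E) : ell2_norm x = 0 -> x = 0.
Proof.
by move=> [] x0; apply: val_inj; apply: l2norm0_eq0 => //; exact: valP.
Qed.

HB.instance Definition _ := Lmodule_isNormed.Build R[i] E
  ell2_normD ell2_normZ ell2_norm0_eq0.
End ell2_type.


Definition ell2_fun (R : realType) (I : choiceType) (x : ell2 R I) : I -> R[i] :=
  \val x.
Coercion ell2_fun : ell2 >-> Funclass.

(* Sum of an absolutely summable family, as the difference of the sums of its
   positive and negative parts; the value is meaningless for other families. *)
Definition rsum (R : realType) (I : choiceType) (f : I -> R) : R :=
  fine (\esum_(i in [set: I]) (Num.max (f i) 0)%:E)%E -
  fine (\esum_(i in [set: I]) (Num.max (- f i) 0)%:E)%E.

Definition csum (R : realType) (I : choiceType) (f : I -> R[i]) : R[i] :=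
  (rsum (fun i => complex.Re (f i)) +i* rsum (fun i => complex.Im (f i)))%C.

Section operators.
Context {R : realType} {I : choiceType}.
Local Notation E := (ell2 R I).
Implicit Types (S T : E -> E) (A B : set (E -> E)).

(* Linear in the first variable. *)
Definition inner (x y : E) : R[i] := csum (fun i => x i * (y i)^*).

(* For linear operators, continuous and bounded are the same
   (linear_bounded_continuous). *)
Definition bounded_op T : Prop := linear T /\ continuous T.

(* S is the adjoint of T. A relation rather than an operation, which avoids
   proving the existence of adjoints. *)
Definition is_adjoint T S : Prop :=
  forall x y : E, inner (T x) y = inner x (S y).

Definition adjoints A : set (E -> E) :=
  [set S | bounded_op S /\ exists2 T, A T & is_adjoint T S].

Definition commutant A : set (E -> E) :=
  [set T | bounded_op T /\ forall S, A S -> T \o S = S \o T].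

(* The von Neumann algebra generated by A is the bicommutant of the
   self-adjoint set consisting of A and the adjoints of its elements. *)
Definition vN_generated A : set (E -> E) :=
  commutant (commutant (A `|` adjoints A)).

Lemma bounded_op_comp S T : bounded_op S -> bounded_op T -> bounded_op (S \o T).
Proof.
move=> [Sl Sc] [Tl Tc]; split=> [a x y|x] /=; first by rewrite Tl Sl.
by apply: continuous_comp; [exact: Tc | exact: Sc].
Qed.

Lemma bounded_op_id : bounded_op idfun.
Proof. by split=> // x; exact: cvg_id. Qed.

Lemma commutant_comp A S T :
  commutant A S -> commutant A T -> commutant A (S \o T).
Proof.
move=> [Sb SA] [Tb TA]; split=> [|U AU]; first exact: bounded_op_comp.
by rewrite -compA TA// compA SA.
Qed.

Lemma commutant_id A : commutant A idfun.
Proof. by split=> //; exact: bounded_op_id. Qed.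

Lemma commutant_lin A (c : R[i]) S T : A `<=` bounded_op ->
  commutant A S -> commutant A T -> commutant A (c *: S + T).
Proof.
move=> Ab [[Sl Sc] SA] [[Tl Tc] TA]; split=> [|U AU].
  split=> [a x y|x]; last first.
    exact: (cvgD (cvgZl_tmp (k := c) (Sc x)) (Tc x)).
  rewrite -[LHS]/(c *: S (a *: x + y) + T (a *: x + y)).
  rewrite -[RHS]/(a *: (c *: S x + T x) + (c *: S y + T y)).
  by rewrite Sl Tl !scalerDr !scalerA (mulrC c) addrACA.
have [Ul _] := Ab _ AU; apply/funext => x.
rewrite -[LHS]/(c *: S (U x) + T (U x)) -[RHS]/(U (c *: S x + T x)).
by rewrite Ul -[S (U x)]/((S \o U) x) SA// -[T (U x)]/((T \o U) x) TA.
Qed.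

Lemma commutant0 A : A `<=` bounded_op -> commutant A 0.
Proof.
move=> Ab; have := commutant_lin (-1) Ab (commutant_id A) (commutant_id A).
by rewrite scaleN1r addNr.
Qed.
End operators.

Section vN_type.
Context {R : realType} {I : choiceType} (A : set (ell2 R I -> ell2 R I)).
Local Notation E := (ell2 R I).

Definition vN_pred : {pred E -> E} := fun T => `[< vN_generated A T >].

(* Below, vN is equipped with its linear structure and with composition as
   multiplication. *)
Definition vN : Type := {T : E -> E | T \in vN_pred}.
HB.instance Definition _ := [isSub of vN for @sval _ _].
HB.instance Definition _ := [Choice of vN by <:].

Let comm_bounded B : @commutant R I B `<=` bounded_op.
Proof. by move=> T []. Qed.

Fact vN_submod_closed : submod_closed vN_pred.
Proof.
split=> [|c S T].
  by apply/asboolP; apply: commutant0; exact: comm_bounded.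
move=> /asboolP Sv /asboolP Tv; apply/asboolP.
by apply: commutant_lin => //; exact: comm_bounded.
Qed.

HB.instance Definition _ := GRing.isSubmodClosed.Build R[i] (E -> E)
  vN_pred vN_submod_closed.
HB.instance Definition _ := [SubChoice_isSubLmodule of vN by <:].

Definition vN_op (x : vN) : E -> E := \val x.

Fact vN_mul_subproof (x y : vN) : vN_op x \o vN_op y \in vN_pred.
Proof.
have /asboolP xv := valP x; have /asboolP yv := valP y.
by apply/asboolP; exact: commutant_comp.
Qed.
Definition vN_mul (x y : vN) : vN := Sub (vN_op x \o vN_op y) (vN_mul_subproof x y).

Fact vN_one_subproof : idfun \in vN_pred.
Proof. by apply/asboolP; exact: commutant_id. Qed.
Definition vN_one : vN := Sub idfun vN_one_subproof.

Lemma vN_linear (x : vN) : linear (vN_op x).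
Proof. by have /asboolP[[]] := valP x. Qed.

Fact vN_mulA : associative vN_mul.
Proof. by move=> x y z; apply: val_inj. Qed.
Fact vN_mul1x : left_id vN_one vN_mul.
Proof. by move=> x; apply: val_inj. Qed.
Fact vN_mulx1 : right_id vN_one vN_mul.
Proof. by move=> x; apply: val_inj. Qed.
Fact vN_mulDl : left_distributive vN_mul +%R.
Proof. by move=> x y z; apply: val_inj. Qed.
Fact vN_mulDr : right_distributive vN_mul +%R.
Proof.
move=> x y z; apply: val_inj; apply/funext => v.
rewrite -[LHS]/(vN_op x (vN_op y v + vN_op z v)).
rewrite -[RHS]/(vN_op x (vN_op y v) + vN_op x (vN_op z v)).
by have := vN_linear x 1 (vN_op y v) (vN_op z v); rewrite !scale1r.
Qed.

HB.instance Definition _ := GRing.Zmodule_isPzRing.Build vN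
  vN_mulA vN_mul1x vN_mulx1 vN_mulDl vN_mulDr.

Definition is_star (x y : vN) : Prop := is_adjoint (vN_op x) (vN_op y).

(* As is_star is a relation, a(x* ) = a(x)^* reads as an equivalence. *)
Definition is_star_automorphism : {pred vN -> vN} := fun a =>
  `[< [/\ bijective a, linear a, monoid_morphism a &
       forall x y, is_star x y <-> is_star (a x) (a y)] >].

Definition star_aut : Type := {a : vN -> vN | a \in is_star_automorphism}.
HB.instance Definition _ := [isSub of star_aut for @sval _ _].
HB.instance Definition _ := [Choice of star_aut by <:].

Definition star_aut_fun (a : star_aut) : vN -> vN := \val a.

Fact star_aut_mul_subproof (a b : star_aut) :
  star_aut_fun a \o star_aut_fun b \in is_star_automorphism.
Proof.
have /asboolP[abij alin [a1 aM] astar] := valP a.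
have /asboolP[bbij blin [b1 bM] bstar] := valP b.
apply/asboolP; split=> [|c x y||x y] /=.
- exact: bij_comp.
- by rewrite [star_aut_fun b _]blin [LHS]alin.
- by split=> [|x y] /=; [rewrite [star_aut_fun b 1]b1 [LHS]a1|
    rewrite [star_aut_fun b _]bM [LHS]aM].
- exact: iff_trans (bstar x y) (astar _ _).
Qed.
Definition star_aut_mul (a b : star_aut) : star_aut :=
  Sub (star_aut_fun a \o star_aut_fun b) (star_aut_mul_subproof a b).

Fact star_aut_one_subproof : idfun \in is_star_automorphism.
Proof. by apply/asboolP; split=> //; exists idfun. Qed.
Definition star_aut_one : star_aut := Sub idfun star_aut_one_subproof.

Fact star_aut_inv_subproof (a : star_aut) :
  {b : vN -> vN | b \in is_star_automorphism &
     cancel (star_aut_fun a) b /\ cancel b (star_aut_fun a)}.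
Proof.
have /asboolP[abij alin [a1 aM] astar] := valP a.
have /cid[b [ab ba]] : exists b, cancel (star_aut_fun a) b /\ cancel b (star_aut_fun a).
  by case: abij => b; exists b.
exists b => //; apply/asboolP; split=> [|c x y||x y] /=.
- by exists (star_aut_fun a).
- by apply: (can_inj ab); rewrite [RHS]alin -!/(star_aut_fun _ _) !ba.
- split=> [|x y]; apply: (can_inj ab); first by rewrite ba [RHS]a1.
  by rewrite [RHS]aM -!/(star_aut_fun _ _) !ba.
- by rewrite -{1}[x]ba -{1}[y]ba; exact: iff_sym (astar _ _).
Qed.
Definition star_aut_inv (a : star_aut) : star_aut :=
  Sub (s2val (star_aut_inv_subproof a)) (s2valP (star_aut_inv_subproof a)).

Fact star_aut_mulA : associative star_aut_mul.
Proof. by move=> a b c; apply: val_inj. Qed.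
Fact star_aut_mul1a : left_id star_aut_one star_aut_mul.
Proof. by move=> a; apply: val_inj. Qed.
Fact star_aut_mula1 : right_id star_aut_one star_aut_mul.
Proof. by move=> a; apply: val_inj. Qed.
Fact star_aut_mulVa : left_inverse star_aut_one star_aut_inv star_aut_mul.
Proof.
move=> a; apply: val_inj; apply/funext => x /=.
by have [ab _] := s2valP' (star_aut_inv_subproof a); exact: ab.
Qed.
Fact star_aut_mulaV : right_inverse star_aut_one star_aut_inv star_aut_mul.
Proof.
move=> a; apply: val_inj; apply/funext => x /=.
by have [_ ba] := s2valP' (star_aut_inv_subproof a); exact: ba.
Qed.
HB.instance Definition _ := isGroup.Build star_aut star_aut_mulA
  star_aut_mul1a star_aut_mula1 star_aut_mulVa star_aut_mulaV.

(* Pointwise strong topology: the coarsest one such that a |-> (a x) v is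
   continuous for the norm of ell^2, for all x in the algebra and v in ell^2. *)
Definition star_aut_eval (a : star_aut) : {ptws vN * E -> E} :=
  fun p => vN_op (star_aut_fun a p.1) p.2.
HB.instance Definition _ :=
  Topological.copy star_aut (initial_topology star_aut_eval).
End vN_type.
Coercion vN_op : vN >-> Funclass.
Coercion star_aut_fun : star_aut >-> Funclass.

Section twisted_vN.
Context {R : realType} {G : zmodType}.
Local Notation E := (ell2 R G).

Lemma weighted_perm_l2 (c : G -> R[i]) (s : G -> G) (x : E) :
  (forall g, `|c g| = 1) -> bijective s ->
  (fun g => c g * x (s g)) \in square_summable /\
  l2norm (fun g => c g * x (s g)) = l2norm x.
Proof.
move=> c1 sbij.
have eqn : sqnorm (fun g => c g * x (s g)) = sqnorm x.
  rewrite /sqnorm [RHS](@reindex_esum _ _ _ setT setT s); last first.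
    by rewrite setTT_bijective.
  by apply: eq_esum => g _; have [cg] := c1 g; rewrite normcM [normc (c g)]cg mul1r.
by split; [apply/asboolP; rewrite eqn; exact/asboolP/(valP x) | rewrite /l2norm eqn].
Qed.

Lemma isometry_bounded_op (T : E -> E) :
  linear T -> (forall x, `|T x| = `|x|) -> bounded_op T.
Proof.
move=> Tl Ti; split=> // x; apply/(@cvgrPdist_lt _ _ _ (nbhs x)) => e e0; near=> z.
have -> : T x - T z = T (x - z).
  by rewrite -scaleN1r -[LHS]addrC -Tl scaleN1r addrC.
rewrite Ti; near: z; exact: cvgr_dist_lt.
Unshelve. all: by end_near. Qed.

(* Normalized scalar 2-cocycles. *)
Structure cocycle := Cocycle {
  cocycle_fun :> G -> G -> R[i];
  cocycle_norm : forall g h, `|cocycle_fun g h| = 1;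
  cocycleP : forall g h k, cocycle_fun g h * cocycle_fun (g + h) k =
                           cocycle_fun h k * cocycle_fun g (h + k);
  cocycleg0 : forall g, cocycle_fun g 0 = 1;
  cocycle0g : forall g, cocycle_fun 0 g = 1 }.

Structure character := Character {
  character_fun :> G -> R[i];
  character_norm : forall g, `|character_fun g| = 1;
  characterD : forall g h, character_fun (g + h) = character_fun g * character_fun h }.

Lemma character0 (chi : character) : chi 0 = 1.
Proof.
have chi0 : chi 0 != 0 by rewrite -normr_eq0 character_norm oner_eq0.
by apply: (mulfI chi0); rewrite mulr1 -characterD addr0.
Qed.

Fact delta_subproof (g : G) :
  (fun h => (h == g)%:R : R[i]) \in square_summable.
Proof.
apply: (@l2norm_le _ _ _ 1 _ _).1 => // s; rewrite expr1n.
have n01 (b : bool) : normc (b%:R : R[i]) ^+ 2 = b%:R.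
  by case: b; [rewrite [normc _]normc1 expr1n | rewrite [normc _]normc0 expr0n].
rewrite (eq_bigr _ (fun h _ => n01 (h == g))) -natr_sum lern1.
rewrite (eq_bigr (fun h => if pred1 g h then 1%N else 0%N)); last first.
  by move=> h _ /=; case: (h == g).
by rewrite -big_mkcond sum1_count count_uniq_mem ?fset_uniq// leq_b1.
Qed.

Definition delta (g : G) : E := Ell2 (delta_subproof g).

Context (nu : cocycle).

Fact twisted_shift_subproof (l : G) (x : E) :
  (fun g => nu l (g - l) * x (g - l)) \in square_summable.
Proof.
apply: (weighted_perm_l2 x (fun g => cocycle_norm nu l (g - l)) _).1.
by exists (+%R^~ l) => g; rewrite (addrK, subrK).
Qed.

(* The unitary mapping delta g to nu l g *: delta (l + g), see
   twisted_shift_delta. *)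
Definition twisted_shift (l : G) (x : E) : E := Ell2 (twisted_shift_subproof l x).

Lemma twisted_shift_delta (l g : G) :
  twisted_shift l (delta g) = nu l g *: delta (l + g).
Proof.
apply: val_inj; apply/funext => h.
rewrite /= -[LHS]/(nu l (h - l) * (h - l == g)%:R).
rewrite -[RHS]/(nu l g * (h == l + g)%:R) subr_eq [g + l]addrC.
by have [->|_] := eqVneq h (l + g); rewrite ?mulr0// addrAC subrr add0r.
Qed.

Lemma twisted_shift_bounded (l : G) : bounded_op (twisted_shift l).
Proof.
apply: isometry_bounded_op => [a x y|x].
  by apply: val_inj; apply/funext => g; rewrite /= [LHS]mulrDr mulrCA.
congr (_%:C%C).
apply: (weighted_perm_l2 x (fun g => cocycle_norm nu l (g - l)) _).2.
by exists (+%R^~ l) => g; rewrite (addrK, subrK).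
Qed.

Local Notation L := (vN (range twisted_shift)).

Fact can_unitary_subproof (l : G) :
  twisted_shift l \in vN_pred (range twisted_shift).
Proof.
apply/asboolP; split=> [|T [_ TA]]; first exact: twisted_shift_bounded.
by rewrite TA//; left; exists l.
Qed.

Definition can_unitary (l : G) : L := Sub (twisted_shift l) (can_unitary_subproof l).

Definition vN_trace (x : L) : R[i] := inner (x (delta 0)) (delta 0).
End twisted_vN.
Arguments cocycle R G : clear implicits.
Arguments character R G : clear implicits.
Notation twisted_vN nu := (vN (range (twisted_shift nu))).

Notation Z2 := 'cV[int]_2.

Definition SL2 : Type := {g : 'M[int]_2 | \det g == 1}.
HB.instance Definition _ := [isSub of SL2 for @sval _ _].
HB.instance Definition _ := [Choice of SL2 by <:].

Section SL2_group.
Implicit Types g h : SL2.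

Fact SL2_mul_subproof g h : \det (\val g *m \val h) == 1.
Proof. by rewrite det_mulmx (eqP (valP g)) (eqP (valP h)) mulr1. Qed.
Definition SL2_mul g h : SL2 := Sub (\val g *m \val h) (SL2_mul_subproof g h).

Fact SL2_one_subproof : \det (1%:M : 'M[int]_2) == 1.
Proof. by rewrite det1. Qed.
Definition SL2_one : SL2 := Sub 1%:M SL2_one_subproof.

Fact SL2_inv_subproof g : \det (\adj (\val g)) == 1.
Proof.
have := congr1 (@determinant _ _) (mul_mx_adj (\val g)).
by rewrite det_mulmx (eqP (valP g)) mul1r => ->; rewrite det1.
Qed.
Definition SL2_inv g : SL2 := Sub (\adj (\val g)) (SL2_inv_subproof g).

Fact SL2_mulA : associative SL2_mul.
Proof. by move=> a b c; apply: val_inj; exact: mulmxA. Qed.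
Fact SL2_mul1g : left_id SL2_one SL2_mul.
Proof. by move=> a; apply: val_inj; exact: mul1mx. Qed.
Fact SL2_mulg1 : right_id SL2_one SL2_mul.
Proof. by move=> a; apply: val_inj; exact: mulmx1. Qed.
Fact SL2_mulVg : left_inverse SL2_one SL2_inv SL2_mul.
Proof. by move=> a; apply: val_inj; rewrite /= mul_adj_mx (eqP (valP a)). Qed.
Fact SL2_mulgV : right_inverse SL2_one SL2_inv SL2_mul.
Proof. by move=> a; apply: val_inj; rewrite /= mul_mx_adj (eqP (valP a)). Qed.
HB.instance Definition _ := isGroup.Build SL2
  SL2_mulA SL2_mul1g SL2_mulg1 SL2_mulVg SL2_mulgV.
End SL2_group.

(* The semidirect product, (k, a)(k', a') = (k + a k', a a'). *)
Definition Z2SL2 : Type := (Z2 * SL2)%type.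
HB.instance Definition _ := Choice.copy Z2SL2 (Z2 * SL2)%type.

Section Z2SL2_group.
Implicit Types g h : Z2SL2.

Definition Z2SL2_act g (l : Z2) : Z2 := g.1 + \val g.2 *m l.

Definition Z2SL2_mul g h : Z2SL2 := (Z2SL2_act g h.1, (g.2 * h.2)%g).
Definition Z2SL2_one : Z2SL2 := (0, 1%g).
Definition Z2SL2_inv g : Z2SL2 := (- (\val (g.2^-1)%g *m g.1), (g.2^-1)%g).

Fact Z2SL2_mulA : associative Z2SL2_mul.
Proof.
move=> a b c; congr (_, _); last exact: mulgA.
by rewrite /Z2SL2_act /= mulmxDr addrA mulmxA.
Qed.
Fact Z2SL2_mul1g : left_id Z2SL2_one Z2SL2_mul.
Proof.
by case=> k a; congr (_, _); [rewrite /Z2SL2_act add0r mul1mx | exact: mul1g].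
Qed.
Fact Z2SL2_mulg1 : right_id Z2SL2_one Z2SL2_mul.
Proof.
by case=> k a; congr (_, _); [rewrite /Z2SL2_act mulmx0 addr0 | exact: mulg1].
Qed.
Fact Z2SL2_mulVg : left_inverse Z2SL2_one Z2SL2_inv Z2SL2_mul.
Proof.
by case=> k a; congr (_, _); [rewrite /Z2SL2_act addNr | exact: mulVg].
Qed.
Fact Z2SL2_mulgV : right_inverse Z2SL2_one Z2SL2_inv Z2SL2_mul.
Proof.
case=> k a; congr (_, _); last exact: mulgV.
rewrite /Z2SL2_act /= mulmxN mulmxA -[X in _ - X *m _]/(\val (a * a^-1)%g).
by rewrite mulgV mul1mx subrr.
Qed.
HB.instance Definition _ := isGroup.Build Z2SL2
  Z2SL2_mulA Z2SL2_mul1g Z2SL2_mulg1 Z2SL2_mulVg Z2SL2_mulgV.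

Lemma Z2SL2_actM g h l : Z2SL2_act (g * h)%g l = Z2SL2_act g (Z2SL2_act h l).
Proof. by rewrite /Z2SL2_act /= mulmxDr addrA mulmxA. Qed.

Lemma Z2SL2_act_bij g : bijective (Z2SL2_act g).
Proof.
have act1 l : Z2SL2_act 1%g l = l by rewrite /Z2SL2_act add0r mul1mx.
by exists (Z2SL2_act g^-1%g) => l; rewrite -Z2SL2_actM (mulVg, mulgV) act1.
Qed.
End Z2SL2_group.

Definition det2 (k m : Z2) : int := k 0 0 * m 1 0 - k 1 0 * m 0 0.

Section Lambda.
Context {H : zmodType}.

Definition zero_sum_finsupp : {pred Z2 -> H} := fun l =>
  `[< finite_set [set k | l k != 0] /\ \sum_(k \in [set: Z2]) l k = 0 >].

Lemma finsupp_fset (l : Z2 -> H) : finite_set [set k | l k != 0] ->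
  exists s : {fset Z2}, forall k, k \notin s -> l k = 0.
Proof.
move=> /finite_fsetP[s sE]; exists s => k; apply: contraNeq => lk.
by have : [set k | l k != 0] k by []; rewrite sE.
Qed.

Lemma fset_finsupp (l : Z2 -> H) (s : {fset Z2}) :
  (forall k, k \notin s -> l k = 0) -> finite_set [set k | l k != 0].
Proof.
move=> sl; apply: (@sub_finite_set _ _ [set` s]) => // k /=.
by apply: contraNT => /sl ->.
Qed.

Lemma zero_sumP (l : Z2 -> H) : l \in zero_sum_finsupp <->
  exists2 s : {fset Z2}, forall k, k \notin s -> l k = 0 & \sum_(k <- s) l k = 0.
Proof.
split=> [/asboolP[/finsupp_fset[s sl] l0]|[s sl l0]].
  by exists s => //; rewrite -(fsbigTE s).
by apply/asboolP; split; [exact: fset_finsupp sl | rewrite (fsbigTE s)].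
Qed.

Fact zero_sum_zmod_closed : zmod_closed zero_sum_finsupp.
Proof.
split=> [|l m /asboolP[/finsupp_fset[s sl] l0] /asboolP[/finsupp_fset[t tm] m0]].
  by apply/zero_sumP; exists fset0; rewrite ?big_seq_fset0.
apply/zero_sumP; exists (s `|` t)%fset => [k|].
  by rewrite inE negb_or => /andP[/sl lk /tm mk]; rewrite -[LHS]/(l k - m k) lk mk subrr.
rewrite -[LHS]/(\sum_(k <- (s `|` t)%fset) (l k - m k)) sumrB.
rewrite -fsbigTE ?l0 -?fsbigTE ?m0 ?subrr// => k; rewrite inE negb_or.
  by move=> /andP[_ /tm].
by move=> /andP[/sl].
Qed.

HB.instance Definition _ := GRing.isZmodClosed.Build (Z2 -> H)
  zero_sum_finsupp zero_sum_zmod_closed.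
End Lambda.

(* Pointwise addition, inherited from the functions Z2 -> H. *)
Definition Lambda (H : zmodType) : Type := {l : Z2 -> H | l \in zero_sum_finsupp}.
HB.instance Definition _ (H : zmodType) := [isSub of Lambda H for @sval _ _].
HB.instance Definition _ (H : zmodType) := [Choice of Lambda H by <:].
HB.instance Definition _ (H : zmodType) := [SubChoice_isSubZmodule of Lambda H by <:].
Definition Lambda_fun (H : zmodType) (l : Lambda H) : Z2 -> H := \val l.
Coercion Lambda_fun : Lambda >-> Funclass.

Section Lambda_theory.
Context {H : zmodType}.
Implicit Types l m n : Lambda H.

Lemma Lambda_fset l : exists s : {fset Z2}, forall k, k \notin s -> l k = 0.
Proof. by have /asboolP[/finsupp_fset] := valP l. Qed.

Lemma Lambda_sum0 l : \sum_(k \in [set: Z2]) l k = 0.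
Proof. by have /asboolP[] := valP l. Qed.

Fact Lambda_act_subproof (g : Z2SL2) l :
  (fun k => l (Z2SL2_act g^-1%g k)) \in zero_sum_finsupp.
Proof.
have gbij := Z2SL2_act_bij g^-1%g.
have /asboolP[lfin l0] := valP l; apply/asboolP; split.
  apply: (@finite_preimage _ _ _ (Z2SL2_act g^-1%g)) lfin => x y _ _.
  exact: bij_inj.
by rewrite -[RHS]l0 [RHS](reindex_fsbigT (Z2SL2_act g^-1%g)).
Qed.
Definition Lambda_act (g : Z2SL2) l : Lambda H :=
  Sub (fun k => l (Z2SL2_act g^-1%g k)) (Lambda_act_subproof g l).

Fact Lambda_comp_subproof (f : H -> H) (fD : zmod_morphism f) l :
  f \o l \in zero_sum_finsupp.
Proof.
have f0 : f 0 = 0 by rewrite -[0 in LHS](subr0 0) fD subrr.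
have fA x y : f (x + y) = f x + f y.
  by rewrite -[y in LHS]opprK fD -[- y]sub0r fD f0 sub0r opprK.
have /zero_sumP[s sl l0] := valP l; apply/zero_sumP.
exists s => [k /sl|] /=; first by rewrite -/(Lambda_fun _) => ->.
by rewrite -(big_morph f fA f0) l0.
Qed.

Context {R : realType}.

Definition cocycle_prod (mu : H -> H -> R[i]) l m : R[i] :=
  \big[*%R/1]_(k \in [set: Z2]) mu (l k) (m k).

Lemma cocycle_prodE (mu : cocycle R H) l m (s : {fset Z2}) :
  (forall k, k \notin s -> l k = 0 \/ m k = 0) ->
  cocycle_prod mu l m = \prod_(k <- s) mu (l k) (m k).
Proof.
move=> slm; rewrite /cocycle_prod (fsbigTE s)// => k /slm[] ->.
  exact: cocycle0g.
exact: cocycleg0.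
Qed.

Fact cocycle_prod_norm (mu : cocycle R H) l m : `|cocycle_prod mu l m| = 1.
Proof.
have [s sl] := Lambda_fset l; rewrite (@cocycle_prodE _ _ _ s); last first.
  by move=> k /sl ->; left.
by rewrite normr_prod big1// => k _; rewrite cocycle_norm.
Qed.

Fact cocycle_prodP (mu : cocycle R H) l m n :
  cocycle_prod mu l m * cocycle_prod mu (l + m) n =
  cocycle_prod mu m n * cocycle_prod mu l (m + n).
Proof.
have [s sl] := Lambda_fset l; have [t tm] := Lambda_fset m.
pose u := (s `|` t)%fset.
have lu k : k \notin u -> l k = 0 by rewrite inE negb_or => /andP[/sl].
have mu0 k : k \notin u -> m k = 0 by rewrite inE negb_or => /andP[_ /tm].
have lmu k : k \notin u -> Lambda_fun (l + m) k = 0.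
  by move=> ku; rewrite -[LHS]/(l k + m k) lu// mu0// addr0.
rewrite (@cocycle_prodE mu l m u); last by move=> k /lu; left.
rewrite (@cocycle_prodE mu (l + m) n u); last by move=> k /lmu; left.
rewrite (@cocycle_prodE mu m n u); last by move=> k /mu0; left.
rewrite (@cocycle_prodE mu l (m + n) u); last by move=> k /lu; left.
by rewrite -!big_split; apply: eq_bigr => k _; exact: cocycleP.
Qed.

Fact cocycle_prodl0 (mu : cocycle R H) l : cocycle_prod mu l 0 = 1.
Proof.
by rewrite (@cocycle_prodE _ _ _ fset0) ?big_seq_fset0// => k _; right.
Qed.

Fact cocycle_prod0l (mu : cocycle R H) l : cocycle_prod mu 0 l = 1.
Proof.
by rewrite (@cocycle_prodE _ _ _ fset0) ?big_seq_fset0// => k _; left.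
Qed.

Definition tilde (mu : cocycle R H) : cocycle R (Lambda H) :=
  @Cocycle R (Lambda H) (cocycle_prod mu) (cocycle_prod_norm mu)
    (cocycle_prodP mu) (cocycle_prodl0 mu) (cocycle_prod0l mu).
End Lambda_theory.

Definition mustarmu (R : realType) (H : zmodType) (mu : cocycle R H)
  (g h : H) : R[i] := (mu h g)^* * mu g h.

Section automorphism_groups.
Context {R : realType} {H : zmodType} (mu : cocycle R H) (chi : character R H).

Definition is_aut_mustarmu_chi2 : {pred H -> H} := fun f =>
  `[< [/\ bijective f, zmod_morphism f,
      forall g h, mustarmu mu (f g) (f h) = mustarmu mu g h
    & forall g, chi (f g) ^+ 2 = chi g ^+ 2] >].

Definition autH : Type := {f : H -> H | f \in is_aut_mustarmu_chi2}.
HB.instance Definition _ := [isSub of autH for @sval _ _].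
HB.instance Definition _ := [Choice of autH by <:].

Definition autH_fun (f : autH) : H -> H := \val f.

Fact autH_mul_subproof (a b : autH) :
  autH_fun a \o autH_fun b \in is_aut_mustarmu_chi2.
Proof.
have /asboolP[abij aD amu achi] := valP a.
have /asboolP[bbij bD bmu bchi] := valP b.
apply/asboolP; split=> [|x y|g h|g] /=.
- exact: bij_comp.
- by rewrite [autH_fun b _]bD [LHS]aD.
- by rewrite [LHS]amu [LHS]bmu.
- by rewrite [LHS]achi [LHS]bchi.
Qed.
Definition autH_mul (a b : autH) : autH :=
  Sub (autH_fun a \o autH_fun b) (autH_mul_subproof a b).

Fact autH_one_subproof : idfun \in is_aut_mustarmu_chi2.
Proof. by apply/asboolP; split=> //; exists idfun. Qed.
Definition autH_one : autH := Sub idfun autH_one_subproof.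

Fact autH_inv_subproof (a : autH) :
  {b : H -> H | b \in is_aut_mustarmu_chi2 &
     cancel (autH_fun a) b /\ cancel b (autH_fun a)}.
Proof.
have /asboolP[abij aD amu achi] := valP a.
have /cid[b [ab ba]] : exists b, cancel (autH_fun a) b /\ cancel b (autH_fun a).
  by case: abij => b; exists b.
exists b => //; apply/asboolP; split=> [|x y|g h|g] /=.
- by exists (autH_fun a).
- by apply: (can_inj ab); rewrite [RHS]aD -!/(autH_fun _ _) !ba.
- by rewrite -[LHS]amu -!/(autH_fun _ _) !ba.
- by rewrite -[LHS]achi -!/(autH_fun _ _) !ba.
Qed.
Definition autH_inv (a : autH) : autH :=
  Sub (s2val (autH_inv_subproof a)) (s2valP (autH_inv_subproof a)).

Fact autH_mulA : associative autH_mul.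
Proof. by move=> a b c; apply: val_inj. Qed.
Fact autH_mul1a : left_id autH_one autH_mul.
Proof. by move=> a; apply: val_inj. Qed.
Fact autH_mula1 : right_id autH_one autH_mul.
Proof. by move=> a; apply: val_inj. Qed.
Fact autH_mulVa : left_inverse autH_one autH_inv autH_mul.
Proof.
move=> a; apply: val_inj; apply/funext => x /=.
by have [ab _] := s2valP' (autH_inv_subproof a); exact: ab.
Qed.
Fact autH_mulaV : right_inverse autH_one autH_inv autH_mul.
Proof.
move=> a; apply: val_inj; apply/funext => x /=.
by have [_ ba] := s2valP' (autH_inv_subproof a); exact: ba.
Qed.
HB.instance Definition _ := isGroup.Build autH
  autH_mulA autH_mul1a autH_mula1 autH_mulVa autH_mulaV.

(* Pointwise convergence, with H discrete. *)
Definition autH_ptws (f : autH) : {ptws H -> discrete_topology H} := autH_fun f.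
HB.instance Definition _ :=
  Topological.copy autH (initial_topology autH_ptws).

Fact autH_zmod_morphism (f : autH) : zmod_morphism (autH_fun f).
Proof. by have /asboolP[] := valP f. Qed.

Definition autH_comp (f : autH) (l : Lambda H) : Lambda H :=
  Sub (autH_fun f \o l) (Lambda_comp_subproof (autH_zmod_morphism f) l).
End automorphism_groups.
Coercion autH_fun : autH >-> Funclass.

Section equivariant.
Context {R : realType} {I : choiceType} {A : set (ell2 R I -> ell2 R I)}.
Context {K : groupType} (beta : K -> star_aut A).

Definition equivariant : {pred star_aut A} := fun a =>
  `[< forall g, (beta g * a = a * beta g)%g >].

Definition autN : Type := {a : star_aut A | a \in equivariant}.
HB.instance Definition _ := [isSub of autN for @sval _ _].
HB.instance Definition _ := [Choice of autN by <:].

Fact equivariant_group_closed : group_closed equivariant.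
Proof.
split=> [|a b /asboolP ab /asboolP bb]; apply/asboolP => g.
  by rewrite mul1g mulg1.
exact: (commuteM (ab g) (commuteV (bb g))).
Qed.
HB.instance Definition _ := SubChoice_isSubGroup.Build (star_aut A) equivariant autN
  equivariant_group_closed.
HB.instance Definition _ := Topological.copy autN
  (initial_topology (\val : autN -> star_aut A)).
Definition autN_fun (a : autN) : vN A -> vN A := \val a.
End equivariant.
Coercion autN_fun : autN >-> Funclass.
Section topological_group_iso.
Context {G K : PreTopologicalGroup.type}.

Definition topological_group_iso (f : G -> K) : Prop :=
  [/\ {morph f : x y / (x * y)%g}, continuous f &
      exists h : K -> G, [/\ cancel f h, cancel h f & continuous h]].
End topological_group_iso.

Section twisted_bernoulli.
Context {R : realType} {H : zmodType} (mu : cocycle R H) (chi : character R H).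
Local Notation N := (twisted_vN (tilde mu)).
Local Notation u := (can_unitary (tilde mu)).

Definition bernoulli_coef (k : Z2) (l : Lambda H) : R[i] :=
  \big[*%R/1]_(m \in [set: Z2]) chi (l m) ^ det2 k m.

(* The action determines its values on all of Z2SL2 by tb_morph, as
   (k, g) = (k, 1)(0, g). An action with these properties exists, see bernoulliP;
   it is unique, because a trace preserving automorphism is determined by its
   values on the canonical unitaries. *)
Record is_twisted_bernoulli
    (beta : Z2SL2 -> star_aut (range (twisted_shift (tilde mu)))) : Prop := {
  tb_morph : {morph beta : g h / (g * h)%g};
  tb_trace : forall g (x : N), vN_trace (beta g x) = vN_trace x;
  tb_SL2 : forall (g : SL2) l,
    beta (0, g) (u l) = u (Lambda_act (0, g) l);
  tb_Z2 : forall (k : Z2) l,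
    beta (k, 1%g) (u l) = bernoulli_coef k l *: u (Lambda_act (k, 1%g) l) }.

Definition implements (beta : Z2SL2 -> star_aut (range (twisted_shift (tilde mu))))
    (pi : autN beta) (phi : autH mu chi) : Prop :=
  forall l, exists2 z : R[i], `|z| = 1 & pi (u l) = z *: u (autH_comp phi l).
End twisted_bernoulli.

Section inner_theory.
Context {R : realType} {I : choiceType}.
Local Notation E := (ell2 R I).

Lemma rsum_reindex (s : I -> I) (f : I -> R) : bijective s ->
  rsum (f \o s) = rsum f.
Proof.
rewrite -setTT_bijective => sb.
by rewrite /rsum; congr (fine _ - fine _); rewrite [RHS](reindex_esum _ _ _ _ sb).
Qed.

Lemma csum_reindex (s : I -> I) (f : I -> R[i]) : bijective s ->
  csum (f \o s) = csum f.
Proof.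
move=> sb; congr (_ +i* _)%C.
  exact: (@rsum_reindex s (fun i => complex.Re (f i)) sb).
exact: (@rsum_reindex s (fun i => complex.Im (f i)) sb).
Qed.

Lemma rsum_single (f : I -> R) i : (forall j, j != i -> f j = 0) ->
  rsum f = f i.
Proof.
move=> fi.
have esum1i (a : I -> R) : (forall j, j != i -> a j = 0) -> 0 <= a i ->
    (\esum_(j in [set: I]) (a j)%:E = (a i)%:E)%E.
  move=> ai a0; rewrite -[RHS](@esum_set1 _ _ i (EFin \o a))//= ?lee_fin//.
  rewrite [RHS]esum_mkcond; apply: eq_esum => j _.
  have [->|ji] := eqVneq j i; first by rewrite ifT// inE.
  by rewrite ifF ?ai//; apply/negbTE; rewrite notin_setE; exact/eqP.
rewrite /rsum !esum1i ?le_max ?lexx ?orbT//=.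
- by have [f0|f0] := leP 0 (f i); [rewrite max_r ?subr0//| rewrite max_l]; lra.
- by move=> j /fi ->; rewrite oppr0 maxxx.
- by move=> j /fi ->; rewrite maxxx.
Qed.

Lemma csum_single (f : I -> R[i]) i : (forall j, j != i -> f j = 0) ->
  csum f = f i.
Proof.
move=> fi; rewrite /csum !(@rsum_single _ i) => [|j /fi ->|j /fi ->] //.
by case: (f i).
Qed.

Lemma inner_reindex (s : I -> I) (c : I -> R[i]) (x y x' y' : E) :
  bijective s -> (forall i, `|c i| = 1) ->
  (forall i, x' i = c i * x (s i)) -> (forall i, y' i = c i * y (s i)) ->
  inner x' y' = inner x y.
Proof.
move=> sb c1 xE yE; rewrite /inner -[RHS](csum_reindex _ sb).
congr csum; apply/funext => i /=; rewrite xE yE rmorphM mulrACA.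
by rewrite -normCK c1 expr1n mul1r.
Qed.
End inner_theory.

Section bernoulli_existence.
Context {R : realType} {H : zmodType} (mu : cocycle R H) (chi : character R H).
Local Notation L := (Lambda H).
Local Notation E := (ell2 R L).
Local Notation nu := (tilde mu).
Local Notation u := (can_unitary nu).
Local Notation c := (bernoulli_coef chi).
Implicit Types (g h : Z2SL2) (k : Z2) (l : L).

Let chi_neq0 x : chi x != 0.
Proof. by rewrite -normr_eq0 character_norm oner_eq0. Qed.

Lemma bernoulli_coefE k l (s : {fset Z2}) : (forall m, m \notin s -> l m = 0) ->
  c k l = \prod_(m <- s) chi (l m) ^ det2 k m.
Proof.
move=> sl; rewrite /bernoulli_coef (fsbigTE s)// => m /sl ->.
by rewrite character0 exp1rz.
Qed.

Lemma bernoulli_coef_norm k l : `|c k l| = 1.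
Proof.
have [s sl] := Lambda_fset l; rewrite (bernoulli_coefE k sl) normr_prod.
rewrite big1// => m _; case: (det2 k m) => n.
  by rewrite -exprnP normrX character_norm expr1n.
by rewrite NegzE -exprnN normfV normrX character_norm expr1n invr1.
Qed.

Lemma bernoulli_coefD k l l' : c k (l + l') = c k l * c k l'.
Proof.
have [s sl] := Lambda_fset l; have [t tl] := Lambda_fset l'.
pose v := (s `|` t)%fset.
have lv m : m \notin v -> l m = 0 by rewrite inE negb_or => /andP[/sl].
have lv' m : m \notin v -> l' m = 0 by rewrite inE negb_or => /andP[_ /tl].
have lvD m : m \notin v -> Lambda_fun (l + l') m = 0.
  by move=> mv; rewrite -[LHS]/(l m + l' m) lv// lv'// addr0.
rewrite (bernoulli_coefE k lv) (bernoulli_coefE k lv') (bernoulli_coefE k lvD).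
rewrite -big_split; apply: eq_bigr => m _ /=.
by rewrite -expfzMl -characterD.
Qed.

Lemma bernoulli_coef0 k : c k 0 = 1.
Proof. by rewrite (@bernoulli_coefE _ _ fset0) ?big_seq_fset0. Qed.

Lemma bernoulli_coefB k l l' : c k (l - l') * c k l' = c k l.
Proof. by rewrite -bernoulli_coefD subrK. Qed.

Lemma character_sum (r : seq Z2) (f : Z2 -> H) :
  chi (\sum_(m <- r) f m) = \prod_(m <- r) chi (f m).
Proof. exact: (big_morph _ (characterD chi) (character0 chi)). Qed.

Lemma prod_char_const l (s : {fset Z2}) (n : int) :
  (forall m, m \notin s -> l m = 0) -> \prod_(m <- s) chi (l m) ^ n = 1.
Proof.
move=> sl; have l0 := Lambda_sum0 l; rewrite (fsbigTE s) in l0 => //.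
have expM : {morph (fun x : R[i] => x ^ n) : x y / x * y >-> x * y}.
  by move=> x y; exact: expfzMl.
rewrite -(big_morph _ expM (exp1rz _ n)) -character_sum l0.
by rewrite character0 exp1rz.
Qed.

Lemma det2D k m n : det2 k (m + n) = det2 k m + det2 k n.
Proof. by rewrite /det2 !mxE; ring. Qed.

Lemma det2_SL2 (g : SL2) k m : det2 (\val g *m k) (\val g *m m) = det2 k m.
Proof.
case: g => M /= /eqP; rewrite (expand_det_row _ 0) !big_ord_recl big_ord0.
rewrite /cofactor !det_mx11 !mxE /= => dg.
rewrite /det2 !mxE !big_ord_recl !big_ord0 !addr0.
have e1 : lift ord0 ord0 = 1 :> 'I_2 by apply: val_inj.
rewrite -[RHS]mul1r -dg ?e1.
have e0 : lift 1 0 = 0 :> 'I_2 by apply: val_inj.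
rewrite e0 /bump /= !add0n expr0 expr1 !mul1r addr0.
ring.
Qed.

Lemma bernoulli_coef_act k g l :
  c k (Lambda_act g l) = c (\val (g.2^-1)%g *m k) l.
Proof.
have gb := Z2SL2_act_bij g.
rewrite /bernoulli_coef (reindex_fsbigT _ _ gb).
have [s sl] := Lambda_fset l.
have actK m : Lambda_act g l (Z2SL2_act g m) = l m.
  rewrite -[LHS]/(l (Z2SL2_act g^-1%g (Z2SL2_act g m))) -Z2SL2_actM mulVg.
  by rewrite /Z2SL2_act add0r mul1mx.
rewrite (fsbigTE s); last by move=> m /sl lm; rewrite actK lm character0 exp1rz.
rewrite (fsbigTE s); last by move=> m /sl ->; rewrite character0 exp1rz.
suff -> : \prod_(i <- s) chi (Lambda_act g l (Z2SL2_act g i)) ^ det2 k (Z2SL2_act g i)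
    = \prod_(i <- s) chi (l i) ^ det2 (\val g.2^-1%g *m k) i *
      \prod_(i <- s) chi (l i) ^ det2 k g.1.
  by rewrite prod_char_const// mulr1.
rewrite -big_split; apply: eq_bigr => m _ /=; rewrite actK -expfzDr//.
congr (_ ^ _); rewrite addrC /Z2SL2_act det2D; congr (_ + _).
by rewrite -(det2_SL2 (g.2^-1)%g) mulmxA -[X in det2 _ (X *m _)]/(\val (g.2^-1 * g.2)%g) mulVg mul1mx.
Qed.

Lemma Lambda_actM g h l : Lambda_act (g * h)%g l = Lambda_act g (Lambda_act h l).
Proof.
apply: val_inj; apply/funext => m; rewrite /= invgM.
by rewrite -[RHS]/(l (Z2SL2_act h^-1%g (Z2SL2_act g^-1%g m))) -Z2SL2_actM.
Qed.

Lemma Lambda_act1 l : Lambda_act 1%g l = l.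
Proof.
apply: val_inj; apply/funext => m; rewrite /= invg1.
by rewrite /Z2SL2_act add0r mul1mx.
Qed.

Lemma Lambda_actK g : cancel (Lambda_act g) (Lambda_act g^-1%g : L -> L).
Proof. by move=> l; rewrite -Lambda_actM mulVg Lambda_act1. Qed.

Lemma Lambda_actVK g : cancel (Lambda_act g^-1%g) (Lambda_act g : L -> L).
Proof. by move=> l; rewrite -Lambda_actM mulgV Lambda_act1. Qed.

Lemma Lambda_act_bij g : bijective (Lambda_act g : L -> L).
Proof. by exists (Lambda_act g^-1%g); [exact: Lambda_actK | exact: Lambda_actVK]. Qed.

Lemma Lambda_actB g l l' : Lambda_act g (l - l') = Lambda_act g l - Lambda_act g l'.
Proof. exact: val_inj. Qed.

Lemma tilde_act g l l' : nu (Lambda_act g l) (Lambda_act g l') = nu l l'.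
Proof.
by rewrite /= /cocycle_prod [RHS](reindex_fsbigT _ _ (Z2SL2_act_bij g^-1%g)).
Qed.

Fact bernoulli_unitary_subproof g (x : E) :
  (fun l => c g.1 l * x (Lambda_act g^-1%g l)) \in square_summable.
Proof.
exact: (weighted_perm_l2 x (bernoulli_coef_norm g.1) (Lambda_act_bij _)).1.
Qed.
(* The twisted Bernoulli shift action is implemented by these unitaries. *)
Definition bernoulli_unitary g (x : E) : E := Ell2 (bernoulli_unitary_subproof g x).
Local Notation V := bernoulli_unitary.

Lemma bernoulli_unitaryE g x l : V g x l = c g.1 l * x (Lambda_act g^-1%g l).
Proof. by []. Qed.

Lemma ell2P (x y : E) : (forall l, x l = y l) -> x = y.
Proof. by move=> xy; apply: val_inj; exact/funext. Qed.

Lemma bernoulli_unitary_linear g : linear (V g).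
Proof.
move=> a x y; apply: ell2P => l; rewrite bernoulli_unitaryE.
by rewrite -[LHS]/(_ * (a * _ + _)) mulrDr mulrCA.
Qed.

Lemma bernoulli_unitary_bounded g : bounded_op (V g).
Proof.
apply: isometry_bounded_op => [|x]; first exact: bernoulli_unitary_linear.
congr (_%:C%C).
exact: (weighted_perm_l2 x (bernoulli_coef_norm g.1) (Lambda_act_bij _)).2.
Qed.

Lemma bernoulli_unitary_inner g x y : inner (V g x) (V g y) = inner x y.
Proof.
exact: (inner_reindex (Lambda_act_bij g^-1%g) (bernoulli_coef_norm g.1)).
Qed.

Lemma det2Dl k k' m : det2 (k + k') m = det2 k m + det2 k' m.
Proof. by rewrite /det2 !mxE; ring. Qed.

Lemma bernoulli_coefDk k k' l : c (k + k') l = c k l * c k' l.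
Proof.
have [s sl] := Lambda_fset l; rewrite !(bernoulli_coefE _ sl) -big_split.
by apply: eq_bigr => m _ /=; rewrite det2Dl expfzDr.
Qed.

Lemma bernoulli_unitaryM g h : V (g * h)%g = V g \o V h.
Proof.
apply/funext => x; apply: ell2P => l; rewrite !bernoulli_unitaryE.
rewrite invgM Lambda_actM mulrA; congr (_ * _).
by rewrite bernoulli_coef_act invgK -bernoulli_coefDk.
Qed.

Lemma bernoulli_unitary1 : V 1%g = idfun.
Proof.
apply/funext => x; apply: ell2P => l; rewrite bernoulli_unitaryE invg1 Lambda_act1.
have [s sl] := Lambda_fset l; rewrite (bernoulli_coefE _ sl) big1 ?mul1r// => m _.
by rewrite /det2 !mxE !mul0r subrr.
Qed.

Lemma bernoulli_unitaryK g : V g \o V g^-1%g = idfun.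
Proof. by rewrite -bernoulli_unitaryM mulgV bernoulli_unitary1. Qed.

Lemma bernoulli_unitaryVK g : V g^-1%g \o V g = idfun.
Proof. by rewrite -bernoulli_unitaryM mulVg bernoulli_unitary1. Qed.

Lemma bernoulli_unitary_shift g l :
  V g \o twisted_shift nu l =
  c g.1 (Lambda_act g l) \*: twisted_shift nu (Lambda_act g l) \o V g.
Proof.
apply/funext => x; apply: ell2P => m.
rewrite bernoulli_unitaryE.
rewrite -[RHS]/(c g.1 (Lambda_act g l) * (nu (Lambda_act g l) (m - Lambda_act g l) *
  V g x (m - Lambda_act g l))).
rewrite bernoulli_unitaryE -[twisted_shift _ _ _ _]/(nu l (_ - l) * x (_ - l)).
have -> : nu (Lambda_act g l) (m - Lambda_act g l) =
    nu l (Lambda_act g^-1%g m - l).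
  by rewrite -(tilde_act g l) Lambda_actB Lambda_actVK.
rewrite -(bernoulli_coefB g.1 m (Lambda_act g l)) Lambda_actB Lambda_actK.
ring.
Qed.

Lemma inner_delta (x y : E) l : (forall l', l' != l -> x l' = 0) ->
  inner x y = x l * (y l)^*.
Proof.
by move=> xl; rewrite /inner (@csum_single _ _ _ l)// => l' /xl ->; rewrite mul0r.
Qed.

Lemma deltaE l l' : (delta l : E) l' = (l' == l)%:R.
Proof. by []. Qed.

Fact twisted_shift_adj_subproof l (x : E) :
  (fun m => (nu l m)^* * x (l + m)) \in square_summable.
Proof.
apply: (@weighted_perm_l2 _ _ (fun m => (nu l m)^*) (+%R l) x _ _).1.
  by move=> m; rewrite norm_conjC cocycle_norm.
by exists (+%R (- l)) => m; rewrite (addKr, addNKr).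
Qed.
Definition twisted_shift_adj l (x : E) : E := Ell2 (twisted_shift_adj_subproof l x).

Lemma twisted_shift_adjP l :
  is_adjoint (twisted_shift nu l) (twisted_shift_adj l).
Proof.
move=> x y; rewrite /inner.
have sb : bijective (+%R l : L -> L).
  by exists (+%R (- l)) => m; rewrite (addKr, addNKr).
rewrite -[LHS](csum_reindex _ sb); congr csum; apply/funext => m /=.
rewrite -[twisted_shift _ _ _ _]/(nu l (l + m - l) * x (l + m - l)).
rewrite -[twisted_shift_adj _ _ _]/((nu l m)^* * y (l + m)).
by rewrite rmorphM /= conjCK addrAC subrr add0r; ring.
Qed.

Lemma twisted_shift_adj_uniq l T :
  is_adjoint (twisted_shift nu l) T -> T = twisted_shift_adj l.
Proof.
move=> Tl; apply/funext => y; apply: ell2P => m; apply: (can_inj conjCK).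
have := Tl (delta m) y.
rewrite [RHS](@inner_delta _ _ m); last first.
  by move=> l' /negPf l'm; rewrite deltaE l'm.
rewrite deltaE eqxx mul1r => <-; rewrite twisted_shift_delta.
rewrite (@inner_delta _ _ (l + m)); last first.
  by move=> l' /negPf l'm; rewrite -[LHS]/(_ * (_ == _)%:R) l'm mulr0.
rewrite -[(_ *: _ : E) _]/(_ * (_ == _)%:R) eqxx mulr1.
by rewrite -[twisted_shift_adj _ _ _]/((nu l m)^* * y (l + m)) rmorphM /= conjCK.
Qed.

Lemma twisted_shift_adj_bounded l : bounded_op (twisted_shift_adj l).
Proof.
apply: isometry_bounded_op => [a x y|x].
  by apply: ell2P => m; rewrite -[LHS]/(_ * (a * _ + _)) mulrDr mulrCA.
congr (_%:C%C).
apply: (@weighted_perm_l2 _ _ (fun m => (nu l m)^*) (+%R l) x _ _).2.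
  by move=> m; rewrite norm_conjC cocycle_norm.
by exists (+%R (- l)) => m; rewrite (addKr, addNKr).
Qed.

Lemma bernoulli_unitary_shift_adj g l :
  V g \o twisted_shift_adj l =
  (c g.1 (Lambda_act g l))^* \*: twisted_shift_adj (Lambda_act g l) \o V g.
Proof.
apply/funext => x; apply: ell2P => m; rewrite bernoulli_unitaryE.
rewrite -[RHS]/((c g.1 (Lambda_act g l))^* * ((nu (Lambda_act g l) m)^* *
  V g x (Lambda_act g l + m))).
rewrite bernoulli_unitaryE -[twisted_shift_adj _ _ _]/((nu l _)^* * x (l + _)).
have -> : nu (Lambda_act g l) m = nu l (Lambda_act g^-1%g m).
  by rewrite -(tilde_act g l) Lambda_actVK.
have -> : Lambda_act g^-1%g (Lambda_act g l + m) = l + Lambda_act g^-1%g m.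
  by rewrite -{2}(Lambda_actK g l); exact: val_inj.
rewrite bernoulli_coefD.
have : c g.1 (Lambda_act g l) * (c g.1 (Lambda_act g l))^* = 1.
  by rewrite -normCK bernoulli_coef_norm expr1n.
set a := c _ (Lambda_act _ _); set b := a^* => ab.
transitivity (a * b * (c g.1 m * ((nu l (Lambda_act g^-1%g m))^* *
  x (l + Lambda_act g^-1%g m)))); first by rewrite ab mul1r.
ring.
Qed.

Definition bernoulli_conj g (T : E -> E) : E -> E := V g \o T \o V g^-1%g.

Lemma bernoulli_conjM g h T :
  bernoulli_conj (g * h)%g T = bernoulli_conj g (bernoulli_conj h T).
Proof. by rewrite /bernoulli_conj invgM !bernoulli_unitaryM. Qed.

Lemma bernoulli_conj1 T : bernoulli_conj 1%g T = T.
Proof. by rewrite /bernoulli_conj invg1 bernoulli_unitary1. Qed.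

Lemma bernoulli_conj_comp g S T :
  bernoulli_conj g (S \o T) = bernoulli_conj g S \o bernoulli_conj g T.
Proof.
apply/funext => x; rewrite /bernoulli_conj /=.
by rewrite -[V g^-1%g (V g _)]/((V g^-1%g \o V g) _) bernoulli_unitaryVK.
Qed.

Lemma bernoulli_conj_bounded g T : bounded_op T -> bounded_op (bernoulli_conj g T).
Proof.
move=> Tb; apply: bounded_op_comp; last exact: bernoulli_unitary_bounded.
by apply: bounded_op_comp => //; exact: bernoulli_unitary_bounded.
Qed.

Lemma bernoulli_conj_adjoint g S T : is_adjoint S T ->
  is_adjoint (bernoulli_conj g S) (bernoulli_conj g T).
Proof.
move=> ST x y; rewrite /bernoulli_conj /=.
have e : forall z, z = V g (V g^-1%g z).
  by move=> z; rewrite -[RHS]/((V g \o V g^-1%g) z) bernoulli_unitaryK.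
by rewrite [X in inner _ X = _]e [X in _ = inner X _]e !bernoulli_unitary_inner.
Qed.

Local Notation A := (range (twisted_shift nu) `|` adjoints (range (twisted_shift nu))).

Lemma bernoulli_conj_gen g S : A S ->
  exists2 z : R[i], exists2 S', A S' & bernoulli_conj g S = z \*: S' & True.
Proof.
have VVK (T : E -> E) : T \o V g \o V g^-1%g = T.
  by rewrite -compA bernoulli_unitaryK.
case=> [[l _ <-]|[Sb [_ [l _ <-] /twisted_shift_adj_uniq ->]]].
  exists (c g.1 (Lambda_act g l)) => //.
  exists (twisted_shift nu (Lambda_act g l)); first by left; exists (Lambda_act g l).
  by rewrite /bernoulli_conj bernoulli_unitary_shift VVK.
exists (c g.1 (Lambda_act g l))^* => //.
exists (twisted_shift_adj (Lambda_act g l)).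
  right; split; first exact: twisted_shift_adj_bounded.
  by exists (twisted_shift nu (Lambda_act g l)) => //; exact: twisted_shift_adjP.
by rewrite /bernoulli_conj bernoulli_unitary_shift_adj VVK.
Qed.

Lemma bernoulli_conj_commutant g T : commutant A T -> commutant A (bernoulli_conj g T).
Proof.
move=> [Tb TA]; split=> [|S AS]; first exact: bernoulli_conj_bounded.
have [z [S' AS' Sz] _] := bernoulli_conj_gen g^-1%g AS.
have SE : S = bernoulli_conj g (z \*: S').
  by rewrite -Sz -bernoulli_conjM mulgV bernoulli_conj1.
rewrite SE -!bernoulli_conj_comp; congr bernoulli_conj.
have [Tl _] := Tb; apply/funext => x /=.
rewrite -[S' (T x)]/((S' \o T) x) -(TA _ AS') /=.
have T0 : T 0 = 0 by have := Tl (-1) 0 0; rewrite scaler0 addr0 scaleN1r addNr.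
by have := Tl z (S' x) 0; rewrite T0 !addr0.
Qed.

Lemma bernoulli_conj_vN g T : vN_generated (range (twisted_shift nu)) T ->
  vN_generated (range (twisted_shift nu)) (bernoulli_conj g T).
Proof.
move=> [Tb TA]; split=> [|S AS]; first exact: bernoulli_conj_bounded.
have SE : S = bernoulli_conj g (bernoulli_conj g^-1%g S).
  by rewrite -bernoulli_conjM mulgV bernoulli_conj1.
rewrite SE -!bernoulli_conj_comp; congr bernoulli_conj.
by apply: TA; exact: bernoulli_conj_commutant.
Qed.

Local Notation N := (twisted_vN nu).

Fact bernoulli_fun_subproof g (x : N) :
  bernoulli_conj g x \in vN_pred (range (twisted_shift nu)).
Proof. by have /asboolP xN := valP x; apply/asboolP; exact: bernoulli_conj_vN. Qed.
Definition bernoulli_fun g (x : N) : N :=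
  Sub (bernoulli_conj g x) (bernoulli_fun_subproof g x).

Lemma bernoulli_funM g h x :
  bernoulli_fun (g * h)%g x = bernoulli_fun g (bernoulli_fun h x).
Proof. by apply: val_inj; exact: bernoulli_conjM. Qed.

Lemma bernoulli_fun1 x : bernoulli_fun 1%g x = x.
Proof. by apply: val_inj; exact: bernoulli_conj1. Qed.

Fact bernoulli_star_aut_subproof g :
  bernoulli_fun g \in @is_star_automorphism R L (range (twisted_shift nu)).
Proof.
apply/asboolP; split=> [|a x y||x y].
- by exists (bernoulli_fun g^-1%g) => x;
    rewrite -bernoulli_funM (mulVg, mulgV) bernoulli_fun1.
- apply: val_inj; apply/funext => v.
  by rewrite -[RHS]/(a *: V g _ + V g _) -bernoulli_unitary_linear.
- split=> [|x y]; apply: val_inj; last exact: bernoulli_conj_comp.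
  exact: bernoulli_unitaryK.
- split=> [|xy]; first exact: bernoulli_conj_adjoint.
  rewrite -[x]bernoulli_fun1 -[y]bernoulli_fun1 -(mulVg g) !bernoulli_funM.
  exact: bernoulli_conj_adjoint.
Qed.
Definition bernoulli g : star_aut (range (twisted_shift nu)) :=
  Sub (bernoulli_fun g) (bernoulli_star_aut_subproof g).

Lemma bernoulli_unitary_delta0 g : V g (delta 0) = delta 0.
Proof.
apply: ell2P => l; rewrite bernoulli_unitaryE !deltaE.
have act0 h : Lambda_act h (0 : L) = 0 by exact: val_inj.
have [->|l0] := eqVneq l 0; first by rewrite bernoulli_coef0 mul1r act0 eqxx.
by have [l'0|] := eqVneq (Lambda_act g^-1%g l) 0; rewrite ?mulr0//;
   case/eqP: l0; rewrite -(Lambda_actVK g l) l'0 act0.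
Qed.

(* Existence of the twisted Bernoulli shift action. *)
Lemma bernoulliP : is_twisted_bernoulli chi bernoulli.
Proof.
have VK g x : V g (V g^-1%g x) = x.
  by rewrite -[LHS]/((V g \o V g^-1%g) x) bernoulli_unitaryK.
have VVK g (T : E -> E) : T \o V g \o V g^-1%g = T.
  by rewrite -compA bernoulli_unitaryK.
have coef g l : bernoulli g (u l) = c g.1 (Lambda_act g l) *: u (Lambda_act g l).
  have fE : bernoulli_conj g (twisted_shift nu l) =
      c g.1 (Lambda_act g l) \*: twisted_shift nu (Lambda_act g l).
    by rewrite /bernoulli_conj bernoulli_unitary_shift VVK.
  by apply: val_inj; exact: fE.
split=> [g h|g x|g l|k l].
- by apply: val_inj; apply/funext => x; exact: bernoulli_funM.
- rewrite /vN_trace -[X in inner _ X = _](bernoulli_unitary_delta0 g).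
  rewrite [LHS]bernoulli_unitary_inner.
  by rewrite -[X in V g^-1%g X](bernoulli_unitary_delta0 g) -{2}(invgK g) VK.
- rewrite coef (_ : c _ _ = 1) ?scale1r//.
  have [s sl] := Lambda_fset (Lambda_act (0, g) l).
  by rewrite (bernoulli_coefE _ sl) big1// => m _; rewrite /det2 !mxE !mul0r subrr.
- rewrite coef bernoulli_coef_act; congr (c _ _ *: _).
  by rewrite -[(_ ^-1)%g]/((1 : SL2)^-1)%g invg1 mul1mx.
Qed.

End bernoulli_existence.

(* Main.v *)
(* An automorphism pi need not be normal, but a noncommutative Egorov argument
   shows that a star automorphism of a twisted group von Neumann algebra fixing
   every u(l) is the identity; so star automorphisms are determined by their
   values on the u(l).

   Let d(h; m, n) be the function with value h at n, -h at m and 0 elsewhere;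
   these generate Lambda(H). Since d(h; 0, e1) is fixed by the unipotents
   fixing e1, pi(u(d(h; 0, e1))) is supported on functions living on Z e1, and
   the paths 0 -> e1 -> e1 + e2 and 0 -> e1 + e2 carry u(d(h; 0, e1)) around a
   triangle. The three supporting lines are so independent that there is no
   cancellation, which forces pi(u(d(h; 0, e1))) = f(h) u(d(phi(h); 0, e1)).
   Commutators of such unitaries give the invariance of mu^*mu. Comparing the
   path through e1 with the path through e2 computes f(h) twice, with chi and
   with its inverse, which gives the invariance of chi^2.

   Conversely, given phi, the scalars f(l) such that u(l) |-> f(l) u(phi o l)
   is multiplicative and equivariant are sums over k in Z^2 of the elements
   (l(k), rho(l(k))^Q(k)) of H x C, twisted by the symmetric cocycle
   mu / (mu o (phi x phi)); here rho = (chi o phi) / chi is a character with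
   values in {1, -1} and Q(q, r) = q^2 + q r + r^2, which modulo 2 is invariant
   under SL(2,Z) and has the polarization det. *)

Require Import Defs.
From HB Require Import structures.
From mathcomp Require Import all_boot all_order all_algebra finmap.
From mathcomp Require Import all_classical all_reals all_analysis.
From mathcomp Require Import complex.
From mathcomp Require Import ring lra zify.

Import Order.TTheory GRing.Theory Num.Theory.
Import numFieldNormedType.Exports.
Import Normc.

Local Open Scope classical_set_scope.
Local Open Scope ring_scope.

Set Implicit Arguments.
Unset Strict Implicit.
Unset Printing Implicit Defensive.

(** * Hilbert space *)

(** An automorphism is not known in advance to be continuous for the 2-norm, so agreement on the
    span of the unitaries does not pass to the algebra by density. Two facts replace continuity: a
    star automorphism contracts operator norms, and right multiplication by a suitable [b], with
    [b (delta 0)] near [delta 0], turns 2-norm approximation into operator norm approximation.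
    Contractivity comes from Neumann series instead of spectral theory, and [b] from an orthogonal
    projection; hence the completeness of ell2 and closed subspaces. Membership in the algebra is
    always tested by commutation with twisted right shifts, and elements are handled through their
    coefficients at [delta 0]. In the converse direction the scalar is already forced on
    [dipole h 0 e1]. Under a translation k it has to change by powers rho^det(k, .), so its exponent
    must be a function on the plane whose polarization is det modulo 2, and it must be odd at e1 to
    give the forced value. The topologies match because unimodular multiples of distinct basis
    vectors stay at distance at least 1, while each scalar depends on finitely many values of
    phi. *)

Section absolutely_summable.
Context {R : realType} {I : choiceType}.
Implicit Types (f g p q : I -> R).

Definition abs_summable f : Prop :=
  (\esum_(i in [set: I]) (`|f i|)%:E < +oo)%E.

Lemma abs_summable_le f g :
  (forall i, `|f i| <= `|g i|) -> abs_summable g -> abs_summable f.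
Proof. by move=> fg; apply: le_lt_trans; apply: le_esum => i _; rewrite lee_fin. Qed.

Lemma abs_summableD f g :
  abs_summable f -> abs_summable g -> abs_summable (fun i => f i + g i).
Proof.
move=> fs gs; apply: (@le_lt_trans _ _
  (\esum_(i in [set: I]) ((`|f i|)%:E + (`|g i|)%:E))%E).
  by apply: le_esum => i _; rewrite -EFinD lee_fin ler_normD.
rewrite esumD; [exact: lte_add_pinfty| |] => i _; by rewrite lee_fin.
Qed.

Lemma esumZ_le (c : R) p : 0 <= c -> (forall i, 0 <= p i) -> abs_summable p ->
  (\esum_(i in [set: I]) (c * p i)%:E <= c%:E * \esum_(i in [set: I]) (p i)%:E)%E.
Proof.
move=> c0 p0 ps; apply: ge_ereal_sup => _ [A [finA AT] <-].
rewrite fsbig_finite//= sumEFin -mulr_sumr EFinM lee_wpmul2l ?lee_fin//.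
rewrite -sumEFin; apply: esum_ge; exists A => //.
by rewrite fsbig_finite.
Qed.

Lemma abs_summable_ge0E p : (forall i, 0 <= p i) -> abs_summable p ->
  (\esum_(i in [set: I]) (p i)%:E = (fine (\esum_(i in [set: I]) (p i)%:E))%:E)%E.
Proof.
move=> p0 ps; rewrite fineK// ge0_fin_numE; last first.
  by apply: esum_ge0 => i _; rewrite lee_fin.
by apply: le_lt_trans ps; apply: le_esum => i _; rewrite lee_fin ler_norm.
Qed.

Lemma abs_summableZ (c : R) f : abs_summable f -> abs_summable (fun i => c * f i).
Proof.
move=> fs; have fs' : abs_summable (fun i => `|f i|).
  by apply: abs_summable_le fs => i; rewrite normr_id.
apply: (@le_lt_trans _ _ (\esum_(i in [set: I]) (`|c| * `|f i|)%:E)%E).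
  by apply: le_esum => i _; rewrite lee_fin normrM.
apply: le_lt_trans (esumZ_le _ _ _) _ => //.
by rewrite abs_summable_ge0E// -EFinM ltry.
Qed.

Lemma fine_esumZ (c : R) p : 0 <= c -> (forall i, 0 <= p i) -> abs_summable p ->
  fine (\esum_(i in [set: I]) (c * p i)%:E)%E =
  c * fine (\esum_(i in [set: I]) (p i)%:E)%E.
Proof.
move=> c0 p0 ps; have [->|cn0] := eqVneq c 0.
  by rewrite mul0r esum1 // => i _; rewrite mul0r.
have cp0 i : 0 <= c * p i by rewrite mulr_ge0.
have cps := abs_summableZ c ps.
apply/eqP; rewrite eq_le -lee_fin -(@lee_fin _ (_ * _)) EFinM -!abs_summable_ge0E//.
rewrite esumZ_le//=.
(* The reverse inequality is [esumZ_le] for the factor c^-1 and the family c p. *)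
have cV0 : 0 <= c^-1 by rewrite invr_ge0.
have := esumZ_le cV0 cp0 cps.
under eq_esum do rewrite mulKf//.
rewrite (abs_summable_ge0E cp0 cps) (abs_summable_ge0E p0 ps).
by rewrite -!EFinM !lee_fin ler_pdivlMl// lt0r cn0.
Qed.

(** Positive and negative parts are not additive in f, so [rsum] is first computed by any difference
    of nonnegative summable families; additivity and homogeneity then follow by choosing the
    decomposition. *)
Lemma rsum_split f p q : (forall i, 0 <= p i) -> (forall i, 0 <= q i) ->
  abs_summable p -> abs_summable q -> (forall i, f i = p i - q i) ->
  rsum f = fine (\esum_(i in [set: I]) (p i)%:E)%E -
           fine (\esum_(i in [set: I]) (q i)%:E)%E.
Proof.
move=> p0 q0 ps qs fE.
have fs : abs_summable f.
  apply: (abs_summable_le _ (abs_summableD ps qs)) => i.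
  rewrite (ger0_norm (addr_ge0 (p0 i) (q0 i))) fE ler_norml.
  by have := p0 i; have := q0 i; lra.
have := @esumB R I setT (EFin \o p) (EFin \o q) ps qs.
rewrite [X in (_ -> _ -> X - _ = _)%E -> _](_ : _ =
   \esum_(i in [set: I]) (Num.max (f i) 0)%:E)%E; last first.
  by apply: eq_esum => i _; rewrite funeposE /= -EFinB -fE EFin_max.
rewrite [X in (_ -> _ -> _ - X = _)%E -> _](_ : _ =
   \esum_(i in [set: I]) (Num.max (- f i) 0)%:E)%E; last first.
  by apply: eq_esum => i _; rewrite funenegE EFin_max fE.
rewrite /rsum /comp (abs_summable_ge0E p0 ps) (abs_summable_ge0E q0 qs) -EFinB.
have mp0 (h : I -> R) i : 0 <= Num.max (h i) 0 by rewrite le_max lexx orbT.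
have mps (h : I -> R) : abs_summable h -> abs_summable (fun i => Num.max (h i) 0).
  apply: abs_summable_le => i; rewrite ger0_norm ?mp0//.
  by rewrite ge_max normr_ge0 andbT ler_norm.
rewrite (abs_summable_ge0E (mp0 f) (mps _ fs)).
have mnf : abs_summable (fun i => - f i).
  by apply: abs_summable_le fs => i; rewrite normrN.
rewrite (abs_summable_ge0E (mp0 _) (mps _ mnf)) -EFinB.
by move=> H; apply: EFin_inj; rewrite H => [|i _|i _]; rewrite ?lee_fin.
Qed.

Let pos0 (f : I -> R) i : 0 <= Num.max (f i) 0.
Proof. by rewrite le_max lexx orbT. Qed.

Lemma abs_summable_pos f : abs_summable f -> abs_summable (fun i => Num.max (f i) 0).
Proof.
by apply: abs_summable_le => i; rewrite ger0_norm ?pos0// ge_max normr_ge0 andbT ler_norm.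
Qed.

Lemma abs_summableN f : abs_summable f -> abs_summable (fun i => - f i).
Proof. by apply: abs_summable_le => i; rewrite normrN. Qed.

Lemma pos_negE (a : R) : a = Num.max a 0 - Num.max (- a) 0.
Proof. by case: (leP 0 a) => h; [rewrite max_r|rewrite max_l]; lra. Qed.

Lemma rsumD f g : abs_summable f -> abs_summable g ->
  rsum (fun i => f i + g i) = rsum f + rsum g.
Proof.
move=> fs gs.
have fps := abs_summable_pos fs; have gps := abs_summable_pos gs.
have fns := abs_summable_pos (abs_summableN fs).
have gns := abs_summable_pos (abs_summableN gs).
rewrite (@rsum_split _ (fun i => Num.max (f i) 0 + Num.max (g i) 0)
  (fun i => Num.max (- f i) 0 + Num.max (- g i) 0)); first last.
- by move=> i; rewrite {1}(pos_negE (f i)) {1}(pos_negE (g i)); ring.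
- exact: abs_summableD.
- exact: abs_summableD.
- by move=> i; rewrite addr_ge0// (pos0 (fun i => - _ i)).
- by move=> i; rewrite addr_ge0// pos0.
rewrite /rsum.
under eq_esum do rewrite EFinD.
rewrite esumD; try by move=> i _; rewrite lee_fin pos0.
under [X in _ - fine X]eq_esum do rewrite EFinD.
rewrite esumD; try by move=> i _; rewrite lee_fin (pos0 (fun i => - _ i)).
rewrite (abs_summable_ge0E (pos0 f) fps) (abs_summable_ge0E (pos0 g) gps).
rewrite (abs_summable_ge0E (pos0 (fun i => - f i)) fns).
rewrite (abs_summable_ge0E (pos0 (fun i => - g i)) gns) /=.
lra.
Qed.

Lemma rsumN f : rsum (fun i => - f i) = - rsum f.
Proof. by rewrite /rsum opprB; congr (_ - _); under eq_esum do rewrite opprK. Qed.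

Lemma rsumZ (c : R) f : abs_summable f -> rsum (fun i => c * f i) = c * rsum f.
Proof.
wlog c0 : c / 0 <= c => [wl fs|fs].
  have [/wl->//|/ltW cn] := leP 0 c.
  have /(wl (- c)) := fs; rewrite oppr_ge0 => /(_ cn).
  by under eq_fun do rewrite mulNr; rewrite rsumN mulNr => /oppr_inj.
have fps := abs_summable_pos fs; have fns := abs_summable_pos (abs_summableN fs).
rewrite (@rsum_split _ (fun i => c * Num.max (f i) 0) (fun i => c * Num.max (- f i) 0)).
- rewrite (fine_esumZ c0 (pos0 f) fps).
  by rewrite (fine_esumZ c0 (pos0 (fun i => - f i)) fns) -mulrBr.
- by move=> i; apply: mulr_ge0 => //; exact: pos0.
- by move=> i; apply: mulr_ge0 => //; exact: (pos0 (fun i => - f i)).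
- exact: (abs_summableZ c fps).
- exact: (abs_summableZ c fns).
- by move=> i; rewrite -mulrBr -pos_negE.
Qed.

End absolutely_summable.

(** * Inner product and norm of ell2 *)

Section ell2_basics.
Context {R : realType} {I : choiceType}.
Local Notation E := (ell2 R I).
Implicit Types (x y z : E) (c : R[i]).

Lemma ell2_ext x y : (forall i, x i = y i) -> x = y.
Proof. by move=> xy; apply: val_inj; exact/funext. Qed.

Lemma ell2DE x y i : (x + y : E) i = x i + y i. Proof. by []. Qed.
Lemma ell2NE x i : (- x : E) i = - x i. Proof. by []. Qed.
Lemma ell2ZE c x i : (c *: x : E) i = c * x i. Proof. by []. Qed.
Lemma ell2_sumE (J : Type) (s : seq J) (F : J -> E) i :
  (\sum_(j <- s) F j : E) i = \sum_(j <- s) F j i.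
Proof. by elim: s => [|j s IH]; rewrite ?big_nil// !big_cons ell2DE IH. Qed.

Definition nrm x : R := l2norm (\val x).

Lemma normE x : `|x| = (nrm x)%:C%C. Proof. by []. Qed.
Lemma nrmE x : nrm x = l2norm (\val x). Proof. by []. Qed.
Lemma nrm_ge0 x : 0 <= nrm x. Proof. exact: l2norm_ge0. Qed.
Lemma nrm0 : nrm 0 = 0. Proof. exact: l2norm0.2. Qed.
Lemma nrmD x y : nrm (x + y) <= nrm x + nrm y.
Proof. exact: (l2normD (valP x) (valP y)).2. Qed.
Lemma nrmZ c x : nrm (c *: x) = normc c * nrm x.
Proof. exact: (l2normZ c (valP x)). Qed.
Lemma nrmN x : nrm (- x) = nrm x.
Proof. by rewrite -scaleN1r nrmZ normcN [normc _]normc1 mul1r. Qed.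
Lemma nrmB x y : nrm (x - y) <= nrm x + nrm y.
Proof. by rewrite -(nrmN y) nrmD. Qed.
Lemma nrm_distC x y : nrm (x - y) = nrm (y - x).
Proof. by rewrite -nrmN opprB. Qed.
Lemma nrm0_eq0 x : nrm x = 0 -> x = 0.
Proof. by move=> x0; apply: val_inj; exact: (l2norm0_eq0 (valP x) x0). Qed.

Lemma sum_sqr_le_nrm x (s : {fset I}) :
  \sum_(i <- s) normc (x i) ^+ 2 <= nrm x ^+ 2.
Proof. exact: (l2norm_fsum_le s (valP x)). Qed.

Lemma normc_le_nrm x i : normc (x i) <= nrm x.
Proof.
rewrite -(ler_pXn2r (ltn0Sn 1)) ?nnegrE ?nrm_ge0 ?normc_ge0//.
by have := sum_sqr_le_nrm x [fset i]%fset; rewrite big_seq_fset1.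
Qed.

Lemma nrm_le x (M : R) : 0 <= M ->
  (forall s : {fset I}, \sum_(i <- s) normc (x i) ^+ 2 <= M ^+ 2) -> nrm x <= M.
Proof. by move=> M0 xM; exact: (l2norm_le M0 xM).2. Qed.

Lemma normcB_le (a b : R[i]) : normc (a - b) <= normc a + normc b.
Proof. by rewrite -(normcN b) le_normcD. Qed.

Lemma normc_normE (a : R[i]) : `|a| = (normc a)%:C%C. Proof. by []. Qed.

Lemma normc_sqrE (a : R[i]) : normc a ^+ 2 = complex.Re a ^+ 2 + complex.Im a ^+ 2.
Proof. by case: a => a b /=; rewrite sqr_sqrtr// addr_ge0// sqr_ge0. Qed.

Lemma normc_Re (a : R[i]) : `|complex.Re a| <= normc a.
Proof.
rewrite -(ler_pXn2r (ltn0Sn 1)) ?nnegrE ?normc_ge0//.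
by rewrite normc_sqrE real_normK ?num_real// lerDl sqr_ge0.
Qed.

Lemma normc_Im (a : R[i]) : `|complex.Im a| <= normc a.
Proof.
rewrite -(ler_pXn2r (ltn0Sn 1)) ?nnegrE ?normc_ge0//.
by rewrite normc_sqrE real_normK ?num_real// lerDr sqr_ge0.
Qed.

Lemma normc_conj (a : R[i]) : normc a^* = normc a.
Proof. by case: a => a b /=; rewrite sqrrN. Qed.

Definition abs_summablec (f : I -> R[i]) := abs_summable (fun i => normc (f i)).

Lemma abs_summable_Re f : abs_summablec f -> abs_summable (fun i => complex.Re (f i)).
Proof. by apply: abs_summable_le => i; rewrite (ger0_norm (normc_ge0 _)) normc_Re. Qed.
Lemma abs_summable_Im f : abs_summablec f -> abs_summable (fun i => complex.Im (f i)).
Proof. by apply: abs_summable_le => i; rewrite (ger0_norm (normc_ge0 _)) normc_Im. Qed.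

Lemma csumD f g : abs_summablec f -> abs_summablec g ->
  csum (fun i => f i + g i) = csum f + csum g.
Proof.
move=> fs gs; rewrite /csum -[RHS]/(_ +i* _)%C.
rewrite -(rsumD (abs_summable_Re fs) (abs_summable_Re gs)).
rewrite -(rsumD (abs_summable_Im fs) (abs_summable_Im gs)).
by congr (_ +i* _)%C; congr rsum; apply/funext => i; case: (f i) (g i) => [a b] [a' b'].
Qed.

Lemma csumZ c f : abs_summablec f -> csum (fun i => c * f i) = c * csum f.
Proof.
move=> fs; have fr := abs_summable_Re fs; have fi := abs_summable_Im fs.
case: c => a b; rewrite /csum -[RHS]/(_ +i* _)%C.
rewrite -(rsumZ a fr) -(rsumZ b fi) -(rsumZ a fi) -(rsumZ b fr) -rsumN.
rewrite -(rsumD (abs_summableZ a fr) (abs_summableN (abs_summableZ b fi))).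
rewrite -(rsumD (abs_summableZ a fi) (abs_summableZ b fr)).
by congr (_ +i* _)%C; congr rsum; apply/funext => i; case: (f i).
Qed.

Lemma csum_conj (f : I -> R[i]) : csum (fun i => (f i)^*) = (csum f)^*.
Proof.
rewrite /csum -[RHS]/(_ +i* _)%C -rsumN.
by congr (_ +i* _)%C; congr rsum; apply/funext => i; case: (f i).
Qed.

Lemma abs_summable_inner x y : abs_summablec (fun i => x i * (y i)^*).
Proof.
have sq z : abs_summable (fun i => normc (z i) ^+ 2).
  have /asboolP := valP z; rewrite /sqnorm; apply: le_lt_trans.
  by apply: le_esum => i _; rewrite lee_fin ger0_norm ?sqr_ge0.
apply: (abs_summable_le _ (abs_summableD (sq x) (sq y))) => i.
rewrite normcM normc_conj !ger0_norm ?mulr_ge0 ?addr_ge0 ?sqr_ge0 ?normc_ge0//.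
by have := normc_ge0 (x i); have := normc_ge0 (y i); nra.
Qed.

Lemma inner_csumE x y : inner x y = csum (fun i => x i * (y i)^*). Proof. by []. Qed.

Lemma innerDl x x' y : inner (x + x') y = inner x y + inner x' y.
Proof.
rewrite /inner -csumD; try exact: abs_summable_inner.
by congr csum; apply/funext => i; rewrite ell2DE mulrDl.
Qed.

Lemma innerZl c x y : inner (c *: x) y = c * inner x y.
Proof.
rewrite /inner -csumZ; last exact: abs_summable_inner.
by congr csum; apply/funext => i; rewrite ell2ZE mulrA.
Qed.

Lemma innerC x y : inner y x = (inner x y)^*.
Proof.
rewrite /inner -csum_conj; congr csum; apply/funext => i.
by rewrite rmorphM /= conjCK mulrC.
Qed.

Lemma innerDr x y y' : inner x (y + y') = inner x y + inner x y'.
Proof. by rewrite innerC innerDl rmorphD /= -!innerC. Qed.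

Lemma innerZr c x y : inner x (c *: y) = c^* * inner x y.
Proof. by rewrite innerC innerZl rmorphM /= -innerC. Qed.

Lemma innerNl x y : inner (- x) y = - inner x y.
Proof. by rewrite -scaleN1r innerZl mulN1r. Qed.
Lemma innerNr x y : inner x (- y) = - inner x y.
Proof. by rewrite -scaleN1r innerZr rmorphN1 mulN1r. Qed.
Lemma innerBl x x' y : inner (x - x') y = inner x y - inner x' y.
Proof. by rewrite innerDl innerNl. Qed.
Lemma inner0l y : inner 0 y = 0.
Proof. by rewrite -(scale0r 0) innerZl mul0r. Qed.
Lemma inner0r x : inner x 0 = 0.
Proof. by rewrite innerC inner0l conjC0. Qed.

Lemma rsum_ge0E (f : I -> R) : (forall i, 0 <= f i) ->
  rsum f = fine (\esum_(i in [set: I]) (f i)%:E)%E.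
Proof.
move=> f0; rewrite /rsum [X in _ - fine X]esum1 ?subr0; last first.
  by move=> i _; rewrite max_r// oppr_le0.
by congr fine; apply: eq_esum => i _; rewrite max_l.
Qed.

Lemma inner_nrm x : inner x x = (nrm x ^+ 2)%:C%C.
Proof.
rewrite /nrm l2norm_sqr /inner /csum /sqnorm.
have -> : (fun i => complex.Im (x i * (x i)^*)) = (fun=> 0 : R).
  by apply/funext => i; case: (x i) => a b /=; ring.
have -> : (fun i => complex.Re (x i * (x i)^*)) = (fun i => normc (x i) ^+ 2).
  by apply/funext => i; rewrite normc_sqrE; case: (x i) => a b /=; ring.
rewrite (rsum_ge0E (f := fun=> 0))// esum1// rsum_ge0E// => i.
exact: sqr_ge0.
Qed.

Lemma nrm_sqrD x y :
  nrm (x + y) ^+ 2 = nrm x ^+ 2 + nrm y ^+ 2 + 2 * complex.Re (inner x y).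
Proof.
have := inner_nrm (x + y); rewrite innerDl !innerDr !inner_nrm (innerC x y).
by case: (inner x y) => a b [<- _] /=; ring.
Qed.

Lemma nrm_sqrB x y :
  nrm (x - y) ^+ 2 = nrm x ^+ 2 + nrm y ^+ 2 - 2 * complex.Re (inner x y).
Proof. by rewrite nrm_sqrD nrmN innerNr; case: (inner x y) => a b /=; ring. Qed.

Lemma cauchy_schwarz x y : normc (inner x y) <= nrm x * nrm y.
Proof.
have [y0|y0] := eqVneq (nrm y) 0.
  by rewrite (nrm0_eq0 y0) inner0r nrm0 mulr0 [normc _]normc0.
(* t y is the orthogonal projection of x on the line of y; the claim is |x - t y|^2 >= 0 cleared of
   denominators. *)
set t := inner x y * ((nrm y ^+ 2)^-1)%:C%C.
have := sqr_ge0 (nrm (x - t *: y)).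
rewrite nrm_sqrB nrmZ innerZr /t.
have n0 : 0 < nrm y by rewrite lt0r y0 nrm_ge0.
have -> : complex.Re ((inner x y * ((nrm y ^+ 2)^-1)%:C%C)^* * inner x y) =
    normc (inner x y) ^+ 2 * (nrm y ^+ 2)^-1.
  by rewrite normc_sqrE; case: (inner x y) => a b /=; ring.
rewrite normcM [normc (_)%:C%C](_ : _ = (nrm y ^+ 2)^-1); last first.
  rewrite /= expr0n addr0 sqrtr_sqr ger0_norm// invr_ge0; exact: sqr_ge0.
move: (normc_ge0 (inner x y)); set N := normc _ => N0 H.
rewrite -(ler_pXn2r (ltn0Sn 1)) ?nnegrE ?mulr_ge0 ?nrm_ge0// -subr_ge0.
have -> : (nrm x * nrm y) ^+ 2 - N ^+ 2 =
    nrm y ^+ 2 * (nrm x ^+ 2 + (N * (nrm y ^+ 2)^-1 * nrm y) ^+ 2 -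
     2 * (N ^+ 2 * (nrm y ^+ 2)^-1)) by field.
by rewrite mulr_ge0// sqr_ge0.
Qed.

Lemma parallelogram x y :
  nrm (x + y) ^+ 2 + nrm (x - y) ^+ 2 = 2 * nrm x ^+ 2 + 2 * nrm y ^+ 2.
Proof. by rewrite nrm_sqrD nrm_sqrB; ring. Qed.

End ell2_basics.

#[global] Opaque nrm inner.

Ltac ell2_ring := apply: ell2_ext => ?; rewrite !(ell2DE, ell2NE, ell2ZE); ring.

(** * Linear maps and operator bounds *)

Section linear_maps.
Context {R : realType} {I J : choiceType}.
Implicit Types (x : ell2 R I).

Lemma linear_lim0 (T : ell2 R I -> ell2 R J) : linear T -> T 0 = 0.
Proof. by move=> Tl; have := Tl (-1) 0 0; rewrite scaler0 addr0 scaleN1r addNr. Qed.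
Lemma linear_limD (T : ell2 R I -> ell2 R J) x y : linear T -> T (x + y) = T x + T y.
Proof. by move=> Tl; have := Tl 1 x y; rewrite !scale1r. Qed.
Lemma linear_limZ (T : ell2 R I -> ell2 R J) c x : linear T -> T (c *: x) = c *: T x.
Proof. by move=> Tl; have := Tl c x 0; rewrite (linear_lim0 Tl) !addr0. Qed.
Lemma linear_limN (T : ell2 R I -> ell2 R J) x : linear T -> T (- x) = - T x.
Proof. by move=> Tl; rewrite -scaleN1r linear_limZ// scaleN1r. Qed.
Lemma linear_limB (T : ell2 R I -> ell2 R J) x y : linear T -> T (x - y) = T x - T y.
Proof. by move=> Tl; rewrite linear_limD// linear_limN. Qed.
Lemma linear_lim_sum (T : ell2 R I -> ell2 R J) (K : Type) (s : seq K) F : linear T ->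
  T (\sum_(k <- s) F k) = \sum_(k <- s) T (F k).
Proof.
move=> Tl; elim: s => [|k s IH]; first by rewrite !big_nil linear_lim0.
by rewrite !big_cons linear_limD// IH.
Qed.

End linear_maps.

Section bounded_operators.
Context {R : realType} {I : choiceType}.

Lemma lecR_realE (a : R[i]) : a \is Num.real -> a = (complex.Re a)%:C%C.
Proof. by move=> ar; rewrite RRe_real. Qed.

(** Trades continuity for a real operator bound, the form in which all estimates are made; a
    positive bound in R[i] is real. *)
Lemma bounded_opP (T : ell2 R I -> ell2 R I) :
  bounded_op T <-> linear T /\ exists2 M : R, 0 < M & forall x, nrm (T x) <= M * nrm x.
Proof.
split=> [[Tl Tc]|[Tl [M M0 TM]]].
  split=> //.
  pose f : {linear ell2 R I -> ell2 R I} := HB.pack T (GRing.isLinear.Build _ _ _ _ T Tl).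
  have /linear_bounded_continuous/linear_boundedP : continuous f by [].
  move=> /pinfty_ex_gt0 [r r0 fr]; exists (complex.Re r).
    by move: r0; rewrite ltcE /= => /andP[].
  move=> x; have := fr x; rewrite !normE.
  rewrite {1}(lecR_realE (gtr0_real r0)) -rmorphM /= lecR.
  exact.
split=> // x; apply/(@cvgrPdist_lt _ _ _ (nbhs x)) => e e0; near=> z.
have -> : T x - T z = T (x - z) by rewrite [RHS]linear_limB.
rewrite normE.
have Mc0 : (0 : R[i]) < M%:C%C by rewrite ltcR.
apply: (@le_lt_trans _ _ (M%:C%C * `|x - z|)).
  by rewrite normE -rmorphM lecR.
rewrite -ltr_pdivlMl//; near: z; apply: cvgr_dist_lt => //.
apply: mulr_gt0; last exact: e0. by rewrite invr_gt0 ltcR.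
Unshelve. all: by end_near. Qed.

End bounded_operators.

(** * Finite truncations and completeness *)

Section completeness.
Context {R : realType} {I : choiceType}.
Local Notation E := (ell2 R I).

Lemma sum_fset_mkcond (F : I -> R) (s t : {fset I}) :
  \sum_(i <- s) F i = \sum_(i <- (s `|` t)%fset) (if i \in s then F i else 0).
Proof.
rewrite big_seq (eq_bigr (fun i => if i \in s then F i else 0)).
  rewrite -big_seq; apply: big_fset_incl; first exact: fsubsetUl.
  by move=> i _ /negPf ->.
by move=> i ->.
Qed.

Lemma ler_sum_fsetUr (F : I -> R) (s t : {fset I}) : (forall i, 0 <= F i) ->
  \sum_(i <- t) F i <= \sum_(i <- (s `|` t)%fset) F i.
Proof.
move=> F0; rewrite (sum_fset_mkcond _ t s) fsetUC.
by apply: ler_sum => i _; case: ifP.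
Qed.

Lemma sum_cutoff_le (s t : {fset I}) (f : I -> R[i]) :
  \sum_(i <- t) normc (if i \in s then f i else 0) ^+ 2 <=
  \sum_(i <- s) normc (f i) ^+ 2.
Proof.
rewrite (sum_fset_mkcond _ s t).
apply: le_trans (ler_sum_fsetUr s t (fun i => sqr_ge0 _)) _.
by apply: ler_sum => i _; case: ifP => // _; rewrite [normc 0]normc0 expr0n.
Qed.

Fact cutoff_subproof (s : {fset I}) (f : I -> R[i]) :
  (fun i => if i \in s then f i else 0) \in square_summable.
Proof.
apply: (@l2norm_le _ _ _ (Num.sqrt (\sum_(i <- s) normc (f i) ^+ 2)) _ _).1.
  exact: sqrtr_ge0.
move=> t; rewrite sqr_sqrtr; last by apply: sumr_ge0 => i _; exact: sqr_ge0.
exact: sum_cutoff_le.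
Qed.
Definition cutoff (s : {fset I}) (f : I -> R[i]) : E := Ell2 (cutoff_subproof s f).

Lemma cutoffE s f i : cutoff s f i = if i \in s then f i else 0.
Proof. by []. Qed.

Lemma nrm_cutoff_sqr s f : nrm (cutoff s f) ^+ 2 = \sum_(i <- s) normc (f i) ^+ 2.
Proof.
have S0 : 0 <= \sum_(i <- s) normc (f i) ^+ 2.
  by apply: sumr_ge0 => i _; exact: sqr_ge0.
apply/eqP; rewrite eq_le; apply/andP; split; last first.
  have := sum_sqr_le_nrm (cutoff s f) s; congr (_ <= _).
  by rewrite big_seq [RHS]big_seq; apply: eq_bigr => i si; rewrite cutoffE si.
rewrite -[leRHS]sqr_sqrtr// ler_pXn2r ?nnegrE ?nrm_ge0 ?sqrtr_ge0//.
apply: nrm_le => [|t]; first exact: sqrtr_ge0.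
rewrite sqr_sqrtr//; exact: sum_cutoff_le.
Qed.

Lemma nrm_cutoff_le s (x : E) : nrm (cutoff s x) <= nrm x.
Proof.
rewrite -(ler_pXn2r (ltn0Sn 1)) ?nnegrE ?nrm_ge0// nrm_cutoff_sqr.
exact: sum_sqr_le_nrm.
Qed.

Lemma nrm_cutoff_sum s f : nrm (cutoff s f) <= \sum_(i <- s) normc (f i).
Proof.
have S0 (t : seq I) : 0 <= \sum_(i <- t) normc (f i).
  by apply: sumr_ge0 => i _; exact: normc_ge0.
rewrite -(ler_pXn2r (ltn0Sn 1)) ?nnegrE ?nrm_ge0// nrm_cutoff_sqr.
elim: (s : seq I) => [|i t IH]; first by rewrite !big_nil expr0n.
rewrite !big_cons; move: IH (S0 t) (normc_ge0 (f i)).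
by set a := \sum_(_ <- _) _; set b := \sum_(_ <- _) _; nra.
Qed.

Lemma cutoff_approx (x : E) (e : R) : 0 < e -> exists s, nrm (x - cutoff s x) < e.
Proof.
(* [nrm_le] yields a weak inequality, so the tail is made at most e / 2. *)
move=> e0; have e20 : 0 < e / 2 by lra.
have [s xs] : exists s : {fset I}, nrm x ^+ 2 - (e / 2) ^+ 2 < \sum_(i <- s) normc (x i) ^+ 2.
  apply: contrapT => /forallNP xs.
  have : (sqnorm (\val x) <= (nrm x ^+ 2 - (e / 2) ^+ 2)%:E)%E.
    by apply: sqnorm_le => s; rewrite leNgt; exact/negP/xs.
  have /asboolP xo := valP x.
  rewrite -[sqnorm _]fineK ?ge0_fin_numE ?sqnorm_ge0// -l2norm_sqr lee_fin.
  have e22 : 0 < (e / 2) ^+ 2 by rewrite exprn_gt0.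
  by rewrite -nrmE => ?; lra.
exists s; apply: (@le_lt_trans _ _ (e / 2)); last by lra.
apply: nrm_le => [|t]; first exact: ltW.
have := sum_sqr_le_nrm x (s `|` t)%fset.
suff -> : \sum_(i <- (s `|` t)%fset) normc (x i) ^+ 2 =
    \sum_(i <- s) normc (x i) ^+ 2 +
    \sum_(i <- (s `|` t)%fset) normc ((x - cutoff s x : E) i) ^+ 2.
  suff : \sum_(i <- t) normc ((x - cutoff s x : E) i) ^+ 2 <=
    \sum_(i <- (s `|` t)%fset) normc ((x - cutoff s x : E) i) ^+ 2 by lra.
  by apply: ler_sum_fsetUr => i; exact: sqr_ge0.
rewrite (sum_fset_mkcond _ s t).
rewrite -big_split; apply: eq_bigr => i _ /=.
rewrite ell2DE ell2NE cutoffE; case: ifP => _; last by rewrite subr0 add0r.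
by rewrite subrr [normc 0]normc0 expr0n addr0.
Qed.

Definition seq_cauchy (x : nat -> E) : Prop :=
  forall e : R, 0 < e -> exists N, forall m n, (N <= m)%N -> (N <= n)%N ->
    nrm (x m - x n) < e.

Definition seq_lim (x : nat -> E) (l : E) : Prop :=
  forall e : R, 0 < e -> exists N, forall n, (N <= n)%N -> nrm (x n - l) < e.

Lemma real_cauchy_lim (a : nat -> R) :
  (forall e : R, 0 < e -> exists N, forall m n, (N <= m)%N -> (N <= n)%N ->
    `|a m - a n| < e) ->
  exists l : R, forall e : R, 0 < e -> exists N, forall n, (N <= n)%N -> `|a n - l| < e.
Proof.
move=> ac; have ca : cvgn a.
  apply/cauchy_cvgP; apply/cauchy_ballP => e e0.
  have [N aN] := ac e e0.
  exists (a @` [set n | (N <= n)%N], a @` [set n | (N <= n)%N]).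
    by split; exists N => // n Nn; exists n.
  by move=> [_ _] [[m Nm <-] [n Nn <-]]; exact: aN.
exists (limn a) => e e0.
have := @cvgr_dist_lt _ _ _ _ _ a (limn a) ca e e0.
by move=> [N _ aN]; exists N => n Nn; rewrite distrC; exact: aN.
Unshelve. all: by end_near. Qed.

Lemma complex_cauchy_lim (a : nat -> R[i]) :
  (forall e : R, 0 < e -> exists N, forall m n, (N <= m)%N -> (N <= n)%N ->
    normc (a m - a n) < e) ->
  exists l : R[i], forall e : R, 0 < e -> exists N, forall n, (N <= n)%N ->
    normc (a n - l) < e.
Proof.
move=> ac.
have ReB (u v : R[i]) : complex.Re u - complex.Re v = complex.Re (u - v) by case: u; case: v.
have ImB (u v : R[i]) : complex.Im u - complex.Im v = complex.Im (u - v) by case: u; case: v.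
have [|p pl] := @real_cauchy_lim (fun n => complex.Re (a n)).
  move=> e /ac[N aN]; exists N => m n Nm Nn.
  by rewrite ReB (le_lt_trans (normc_Re _))// aN.
have [|q ql] := @real_cauchy_lim (fun n => complex.Im (a n)).
  move=> e /ac[N aN]; exists N => m n Nm Nn.
  by rewrite ImB (le_lt_trans (normc_Im _))// aN.
exists (p +i* q)%C => e e0.
have e20 : 0 < e / 2 by lra.
have [N pN] := pl _ e20; have [M qM] := ql _ e20.
exists (maxn N M) => n; rewrite geq_max => /andP[/pN {}pN /qM {}qM].
rewrite -(ltr_pXn2r (ltn0Sn 1)) ?nnegrE ?normc_ge0 ?ltW// normc_sqrE -ReB -ImB /=.
rewrite -(real_normK (num_real (_ - p))) -(real_normK (num_real (_ - q))).
by move: pN qM (normr_ge0 (complex.Re (a n) - p)) (normr_ge0 (complex.Im (a n) - q)); nra.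
Qed.

Lemma seq_cauchy_cvg (x : nat -> E) : seq_cauchy x -> exists l, seq_lim x l.
Proof.
move=> xc.
have /choice[l lx] : forall i, exists l : R[i], forall e : R, 0 < e -> exists N,
    forall n, (N <= n)%N -> normc (x n i - l) < e.
  move=> i; apply: complex_cauchy_lim => e /xc[N xN]; exists N => m n Nm Nn.
  exact: le_lt_trans (normc_le_nrm (x m - x n) i) (xN _ _ Nm Nn).
(* On a finite set s the pointwise limit is uniform, so the Cauchy estimate passes to the limit with
   a bound independent of s. This gives both square summability of l and convergence. *)
have tail (e : R) N n : 0 < e -> (forall m, (N <= m)%N -> nrm (x n - x m) < e) ->
    forall s : {fset I}, \sum_(i <- s) normc (x n i - l i) ^+ 2 <= e ^+ 2.
  move=> e0 xN s; rewrite -nrm_cutoff_sqr.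
  rewrite (@ler_pXn2r _ 2) ?nnegrE ?nrm_ge0 ?(ltW e0)//; apply/ler_addgt0Pr => d d0.
  have [M] : exists M, forall i m, i \in s -> (M <= m)%N ->
      normc (x m i - l i) < d / (size s).+1%:R.
    (* Each coordinate of s gets an equal share of d; the successor avoids dividing by zero when s
       is empty. *)
    have d1 : 0 < d / (size s).+1%:R by rewrite divr_gt0.
    have /choice[M xM] i := lx i _ d1.
    exists (\max_(i <- s) M i)%N => i m si mM; apply: xM.
    by apply: leq_trans mM; apply: (leq_bigmax_seq _ si).
  set m := maxn N M => /(_ _ m _ (leq_maxr _ _)) xM.
  have -> : cutoff s (fun i => x n i - l i) =
      cutoff s (x n - x m : E) + cutoff s (fun i => x m i - l i).
    by apply: ell2_ext => i; rewrite ell2DE !cutoffE; case: ifP;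
      rewrite ?addr0// ell2DE ell2NE subrKA.
  apply: (le_trans (nrmD _ _)); apply: lerD.
    by apply: (le_trans (nrm_cutoff_le _ _)); rewrite ltW// xN// leq_maxl.
  apply: (le_trans (nrm_cutoff_sum _ _)).
  apply: (@le_trans _ _ (\sum_(i <- s) (d / (size s).+1%:R))).
    rewrite big_seq [leRHS]big_seq; apply: ler_sum => i si.
    by rewrite ltW// xM.
  rewrite big_const_seq count_predT iter_addr_0 -[leLHS]mulr_natr mulrAC ler_pdivrMr//.
  by rewrite ler_wpM2l ?(ltW d0)// ler_nat.
have [N0 xN0] := xc 1 ltr01.
have lin : l \in square_summable.
  have dif : (fun i => x N0 i - l i) \in square_summable.
    apply: (l2norm_le ler01 _).1; apply: (tail _ N0) => // m Nm; exact: xN0.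
  have -> : l = \val (x N0) - (fun i => x N0 i - l i).
    by apply/funext => i; rewrite -[RHS]/(x N0 i - (x N0 i - l i)) subKr.
  by apply: rpredB => //; exact: valP.
exists (Ell2 lin) => e e0; have e20 : 0 < e / 2 by lra.
have [N xN] := xc _ e20; exists N => n Nn.
apply: (@le_lt_trans _ _ (e / 2)); last by lra.
apply: nrm_le; first exact: ltW.
by apply: (tail _ N) => // m Nm; exact: xN.
Qed.

End completeness.

(** * Orthogonal projection onto a closed subspace *)

Section projection.
Context {R : realType} {I : choiceType}.
Local Notation E := (ell2 R I).
Variable G : E -> Prop.
Hypothesis G0 : G 0.
Hypothesis GL : forall (c : R[i]) x y, G x -> G y -> G (c *: x + y).
Hypothesis Gc : forall (x : nat -> E) l, (forall n, G (x n)) -> seq_lim x l -> G l.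

Let GD x y : G x -> G y -> G (x + y).
Proof. by move=> Gx Gy; rewrite -[x]scale1r; exact: GL. Qed.
Let GZ c x : G x -> G (c *: x).
Proof. by move=> Gx; rewrite -[_ *: _]addr0; exact: GL. Qed.
Let GB x y : G x -> G y -> G (x - y).
Proof. by move=> Gx Gy; rewrite -scaleN1r; apply: GD => //; exact: GZ. Qed.

Lemma distance_minimizer x : exists2 p, G p & forall g, G g -> nrm (x - p) <= nrm (x - g).
Proof.
pose D := [set r : R | exists2 g, G g & r = nrm (x - g)].
have D0 : D (nrm x) by exists 0 => //; rewrite subr0.
have Dinf : has_inf D by split; [exists (nrm x) | exists 0 => _ [g _ ->]; exact: nrm_ge0].
set d := inf D.
have d0 : 0 <= d by apply: lb_le_inf => [|_ [g _ ->]]; [exists (nrm x) | exact: nrm_ge0].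
have dle g : G g -> d <= nrm (x - g).
  by move=> Gg; apply: ge_inf; [exact: Dinf.2 | exists g].
have /choice[g gP] : forall n : nat, exists g, G g /\ nrm (x - g) < d + n.+1%:R^-1.
  move=> n; have n0 : 0 < n.+1%:R^-1 :> R by rewrite invr_gt0.
  by have [_ [g Gg ->] gd] := inf_adherent n0 Dinf; exists g.
(* Parallelogram identity: the midpoint of g m and g n is in G, hence at distance at least d from x,
   and the bound is 4 (d + e)^2 - 4 d^2. *)
have gle m n (e : R) : m.+1%:R^-1 <= e -> n.+1%:R^-1 <= e -> 0 <= e ->
    nrm (g m - g n) ^+ 2 <= 8 * d * e + 4 * e ^+ 2.
  move=> me ne e0; have [Gm gm] := gP m; have [Gn gn] := gP n.
  have := parallelogram (x - g m) (x - g n).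
  have -> : x - g m - (x - g n) = - (g m - g n) by ell2_ring.
  have -> : x - g m + (x - g n) = 2 *: (x - 2^-1 *: (g m + g n)).
    by apply: ell2_ext => i; rewrite !(ell2DE, ell2NE, ell2ZE); field.
  rewrite nrmN nrmZ [normc 2](_ : _ = 2); last first.
    by rewrite [LHS](normcMn 1 2) [normc 1]normc1.
  have := dle _ (GZ 2^-1 (GD Gm Gn)).
  have := nrm_ge0 (x - g m); have := nrm_ge0 (x - g n).
  set a := nrm (x - g m) in gm *; set b := nrm (x - g n) in gn *.
  set c := nrm (x - _); set z := nrm (g m - g n) => a0 b0 dc H.
  have a1 : a <= d + e by apply: le_trans (ltW gm) _; rewrite lerD2l.
  have b1 : b <= d + e by apply: le_trans (ltW gn) _; rewrite lerD2l.
  move: gm gn me ne => _ _ _ _.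
  have a2 : a ^+ 2 <= (d + e) ^+ 2 by rewrite ler_pXn2r// nnegrE; lra.
  have b2 : b ^+ 2 <= (d + e) ^+ 2 by rewrite ler_pXn2r// nnegrE; lra.
  have c2 : d ^+ 2 <= c ^+ 2 by rewrite ler_pXn2r// nnegrE; lra.
  by move: H; rewrite exprMn; nra.
have [p pl] : exists p, seq_lim g p.
  apply: seq_cauchy_cvg => e e0.
  (* As q <= 1, 8 d q + 4 q^2 <= (8 d + 4) q; the 5 in place of 4 makes the final inequality
     strict. *)
  pose q : R := Num.min 1 (e ^+ 2 / (8 * d + 5)).
  have q0 : 0 < q by rewrite lt_min ltr01/= divr_gt0 ?exprn_gt0//; lra.
  exists (Num.bound q^-1) => m n Nm Nn.
  have qN k : (Num.bound q^-1 <= k)%N -> k.+1%:R^-1 <= q.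
    move=> Nk; rewrite -[leRHS]invrK lef_pV2 ?posrE ?invr_gt0//.
    apply: ltW; apply: lt_le_trans (archi_boundP _) _; first by rewrite invr_ge0 ltW.
    by rewrite ler_nat leqW.
  have H := gle m n q (qN _ Nm) (qN _ Nn) (ltW q0).
  have q1 : q <= 1 by rewrite ge_min lexx.
  have qe : q * (8 * d + 5) <= e ^+ 2.
    by rewrite -ler_pdivlMr; [rewrite ge_min lexx orbT | lra].
  rewrite -(@ltr_pXn2r _ 2) ?nnegrE ?nrm_ge0 ?(ltW e0)//; apply: le_lt_trans H _.
  have q2 : q ^+ 2 <= q by rewrite expr2 ger_pMr.
  by clear -q1 qe q0 d0 q2; nra.
exists p; first by apply: Gc pl => n; have [] := gP n.
suff pd : nrm (x - p) <= d by move=> h /dle; exact: le_trans.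
apply/ler_addgt0Pr => e e0; have e20 : 0 < e / 2 by lra.
have [N gN] := pl _ e20.
pose n := maxn N (Num.bound (e / 2)^-1).
have ne : n.+1%:R^-1 <= e / 2.
  rewrite -[leRHS]invrK lef_pV2 ?posrE ?invr_gt0//.
  apply: ltW; apply: lt_le_trans (archi_boundP _) _; first by rewrite invr_ge0 ltW.
  by rewrite ler_nat leqW// leq_maxr.
have -> : x - p = (x - g n) + (g n - p) by rewrite addrA subrK.
apply: le_trans (nrmD _ _) _.
have [_ gd] := gP n; rewrite [e in leRHS]splitr addrA; apply/ltW/ltrD.
  by apply: lt_le_trans gd _; rewrite lerD2l.
exact: gN (leq_maxl _ _).
Qed.

Lemma minimizer_orth x p g : G p -> (forall h, G h -> nrm (x - p) <= nrm (x - h)) ->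
  G g -> inner (x - p) g = 0.
Proof.
move=> Gp pm Gg; have [g0|g0] := eqVneq (nrm g) 0.
  by rewrite (nrm0_eq0 g0) inner0r.
(* Moving p by t g lowers the squared distance by |inner (x - p) g|^2 / |g|^2, which minimality
   forces to be zero. *)
set t := inner (x - p) g * ((nrm g ^+ 2)^-1)%:C%C.
have := pm _ (GD Gp (GZ t Gg)).
rewrite -(@ler_pXn2r _ 2) ?nnegrE ?nrm_ge0// opprD addrA [in leRHS]nrm_sqrB nrmZ innerZr /t.
set w := inner (x - p) g.
have n0 : 0 < nrm g by rewrite lt0r g0 nrm_ge0.
have -> : complex.Re ((w * ((nrm g ^+ 2)^-1)%:C%C)^* * w) =
    normc w ^+ 2 * (nrm g ^+ 2)^-1.
  by rewrite normc_sqrE; case: w => a b /=; ring.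
rewrite normcM [normc (_)%:C%C](_ : _ = (nrm g ^+ 2)^-1); last first.
  rewrite /= expr0n addr0 sqrtr_sqr ger0_norm// invr_ge0; exact: sqr_ge0.
move=> H; apply: eq0_normc; apply/eqP; rewrite -sqrf_eq0 eq_le sqr_ge0 andbT.
have n2 : 0 < nrm g ^+ 2 by rewrite exprn_gt0.
have e : (normc w * (nrm g ^+ 2)^-1 * nrm g) ^+ 2 = normc w ^+ 2 * (nrm g ^+ 2)^-1.
  by field.
rewrite e in H; have {}H : normc w ^+ 2 * (nrm g ^+ 2)^-1 <= 0 by lra.
by move: H; rewrite -ler_pdivlMr ?invr_gt0// mul0r.
Qed.

(** The uniqueness clause gives the linearity of P here, and later its commutation with unitaries
    that preserve G in both directions. *)
Lemma closed_projection : exists P : E -> E,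
  [/\ forall x, G (P x), forall x g, G g -> inner (x - P x) g = 0 & linear P] /\
  (forall x g, G g -> nrm (x - P x) <= nrm (x - g)) /\
  (forall x p, G p -> (forall g, G g -> inner (x - p) g = 0) -> p = P x).
Proof.
have /choice[P PP] : forall x, exists p, G p /\ forall g, G g -> nrm (x - p) <= nrm (x - g).
  by move=> x; have [p] := distance_minimizer x; exists p.
have PG x : G (P x) by have [] := PP x.
have Pm x g : G g -> nrm (x - P x) <= nrm (x - g) by have [_] := PP x; exact.
have Po x g : G g -> inner (x - P x) g = 0.
  exact: (minimizer_orth (PG x) (Pm x)).
have Pu x p : G p -> (forall g, G g -> inner (x - p) g = 0) -> p = P x.
  move=> Gp po; apply/eqP; rewrite -subr_eq0; apply/eqP/nrm0_eq0/eqP.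
  have GpP := GB Gp (PG x).
  rewrite -sqrf_eq0; have := inner_nrm (p - P x).
  have -> : inner (p - P x) (p - P x) = inner ((x - P x) - (x - p)) (p - P x).
    by congr (inner _ (p - P x)); ell2_ring.
  by rewrite innerBl Po// po// subr0 => -[<-].
exists P; split; [split=> // c x y | by []].
symmetry; apply: Pu; first exact: GL.
move=> g Gg; rewrite opprD addrACA -scalerBr innerDl innerZl !Po//.
by rewrite mulr0 addr0.
Qed.

End projection.

(** * The twisted group von Neumann algebra *)

Section density.
Context {R : realType} {G : zmodType}.
Local Notation E := (ell2 R G).
Implicit Types (x y z : E) (S T : E -> E).

Lemma delta_coefE g h : (delta g : E) h = (h == g)%:R. Proof. by []. Qed.

Lemma cutoff_delta (s : {fset G}) (f : G -> R[i]) :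
  cutoff s f = \sum_(g <- s) f g *: delta g :> E.
Proof.
apply: ell2_ext => h; rewrite cutoffE ell2_sumE.
under eq_bigr do rewrite ell2ZE delta_coefE.
case: ifP => hs.
  rewrite (big_fsetD1 h)//= eqxx mulr1 big_seq big1 ?addr0// => g.
  by rewrite !inE => /andP[/negPf gh _]; rewrite eq_sym gh mulr0.
rewrite big_seq big1// => g gs; case: eqP => [hg|_]; rewrite ?mulr0//.
by move: gs; rewrite -hg hs.
Qed.

Lemma inner_deltar x g : inner x (delta g) = x g.
Proof.
rewrite inner_csumE (@csum_single _ _ _ g) => [|h /negPf hg].
  by rewrite delta_coefE eqxx conjC1 mulr1.
by rewrite delta_coefE hg conjC0 mulr0.
Qed.

Lemma inner_deltal x g : inner (delta g) x = (x g)^*.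
Proof. by rewrite innerC inner_deltar. Qed.

(** Finite truncations of x only involve basis vectors in its support, so only these need testing.
    This localisation allows a coefficient to be computed when few terms contribute. *)
Lemma functional_eq0 (f : E -> R[i]) (C : R) x : 0 <= C ->
  (forall a y z, f (a *: y + z) = a * f y + f z) ->
  (forall y, normc (f y) <= C * nrm y) ->
  (forall g, x g != 0 -> f (delta g) = 0) -> f x = 0.
Proof.
move=> C0 fl fC fx; apply: eq0_normc; apply/eqP.
rewrite eq_le normc_ge0 andbT; apply/ler_addgt0Pr => e e0; rewrite add0r.
have eC : 0 < e / (C + 1) by rewrite divr_gt0//; lra.
have [s xs] := cutoff_approx x eC.
have f0 : f 0 = 0.
  by have := fl (-1) 0 0; rewrite scaler0 addr0 mulN1r addNr.
have fcut : f (cutoff s x) = 0.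
  rewrite cutoff_delta; elim: (s : seq G) => [|g t IH]; first by rewrite big_nil f0.
  rewrite big_cons fl IH addr0; have [->|/fx ->] := eqVneq (x g) 0.
    by rewrite mul0r.
  by rewrite mulr0.
have -> : f x = f (x - cutoff s x).
  by rewrite -{1}[x](subrK (cutoff s x)) -[x - _]scale1r fl fcut addr0 mul1r scale1r.
apply: le_trans (fC _) _; move: xs; rewrite ltr_pdivlMr; last by lra.
by move: (nrm_ge0 (x - cutoff s x)) C0; set w := nrm _; nra.
Qed.

Lemma op_coef_eq0 T x h : bounded_op T ->
  (forall g, x g != 0 -> T (delta g) h = 0) -> T x h = 0.
Proof.
move=> /bounded_opP[Tl [M M0 TM]].
apply: (@functional_eq0 (fun y => T y h) M) => [|a y z|y]; first exact: ltW.
  by rewrite Tl.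
exact: le_trans (normc_le_nrm _ _) (TM y).
Qed.

(** Absence of cancellation in usable form: if a single basis vector in the support of x reaches h,
    the coefficient is one product and vanishes only with a factor. *)
Lemma op_coef_single T x h g : bounded_op T ->
  (forall k, k != g -> x k != 0 -> T (delta k) h = 0) ->
  T x h = x g * T (delta g) h.
Proof.
move=> Tb Tx; have [Tl _] := Tb.
have -> : x = x g *: delta g + (x - x g *: delta g) by rewrite addrC subrK.
rewrite [T _](linear_limD _ _ Tl) (linear_limZ _ _ Tl) ell2DE ell2ZE.
rewrite [X in _ + X = _]op_coef_eq0// ?addr0.
  rewrite !(ell2DE, ell2NE, ell2ZE) delta_coefE eqxx mulr1.
  by rewrite subrr addr0.
move=> k; rewrite !(ell2DE, ell2NE, ell2ZE) delta_coefE.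
by have [->|kg] := eqVneq k g; rewrite ?mulr1 ?subrr ?eqxx// mulr0 subr0 => /Tx; exact.
Qed.

Lemma bounded_op_ext S T : bounded_op S -> bounded_op T ->
  (forall g, S (delta g) = T (delta g)) -> S = T.
Proof.
move=> Sb Tb ST; apply/funext => x; apply: ell2_ext => h.
have [Sl _] := Sb; have [Tl _] := Tb.
have Db : bounded_op (fun x => S x - T x).
  apply/bounded_opP; split=> [a y z|].
    by rewrite Sl Tl scalerBr opprD addrACA.
  have /bounded_opP[_ [M M0 SM]] := Sb; have /bounded_opP[_ [N N0 TN]] := Tb.
  exists (M + N) => [|y]; first exact: addr_gt0.
  by apply: le_trans (nrmB _ _) _; rewrite mulrDl; exact: (lerD (SM y) (TN y)).
apply/eqP; rewrite -subr_eq0; apply/eqP.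
apply: (@op_coef_eq0 (fun x => S x - T x)) => // g _.
by rewrite ST subrr.
Qed.

(** Testing against basis vectors forces the coefficients of S y; the bound on T makes them square
    summable. *)
Lemma adjoint_exists T (M : R) : linear T -> 0 < M ->
  (forall x, nrm (T x) <= M * nrm x) ->
  exists S, [/\ bounded_op S, is_adjoint T S & forall x, nrm (S x) <= M * nrm x].
Proof.
move=> Tl M0 TM.
pose t y g := (inner (T (delta g)) y)^*.
have tb y (s : {fset G}) : \sum_(g <- s) normc (t y g) ^+ 2 <= (M * nrm y) ^+ 2.
  (* Duality: the truncation w of the candidate satisfies |w|^2 = inner (T w) y <= M |w| |y|, and
     |w| is cancelled. *)
  rewrite -nrm_cutoff_sqr; set w := cutoff s (t y).
  have [w0|w0] := eqVneq (nrm w) 0.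
    by rewrite w0 expr0n sqr_ge0.
  have wp : 0 < nrm w by rewrite lt0r w0 nrm_ge0.
  rewrite (@ler_pXn2r _ 2) ?nnegrE ?mulr_ge0 ?nrm_ge0 ?(ltW M0)//.
  have tw : inner (T w) y = inner w w.
    rewrite {1}/w {1}/w cutoff_delta linear_lim_sum//.
    have : forall u : seq G, uniq u -> {subset u <= s} ->
       inner (\sum_(g <- u) T (t y g *: delta g)) y =
       inner (\sum_(g <- u) t y g *: delta g) w.
      elim=> [|g u IH] => [_ _|/= /andP[_ uu] us].
        by rewrite !big_nil !inner0l.
      rewrite !big_cons !innerDl IH//; last by move=> k ku; apply: us; rewrite inE ku orbT.
      rewrite linear_limZ// !innerZl inner_deltal cutoffE us ?mem_head//.
      by rewrite /t conjCK.
    by apply=> //; exact: fset_uniq.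
  have := cauchy_schwarz (T w) y; rewrite tw inner_nrm.
  rewrite [normc _](_ : _ = nrm w ^+ 2); last first.
    by rewrite /= expr0n addr0 sqrtr_sqr ger0_norm ?sqr_ge0.
  rewrite expr2 => H; have {}H : nrm w * nrm w <= M * nrm w * nrm y.
    by apply: le_trans H _; rewrite ler_wpM2r ?nrm_ge0// TM.
  by move: H; rewrite mulrAC ler_pM2r.
have tP y : t y \in square_summable.
  by apply: (l2norm_le _ (tb y)).1; rewrite mulr_ge0 ?nrm_ge0// ltW.
pose S y : E := Ell2 (tP y).
have SM y : nrm (S y) <= M * nrm y.
  rewrite nrmE; apply: (l2norm_le _ (tb y)).2.
  by rewrite mulr_ge0 ?nrm_ge0// ltW.
have SE y g : S y g = (inner (T (delta g)) y)^* by [].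
exists S; split => //.
  apply/bounded_opP; split; last by exists M.
  move=> a y z; apply: ell2_ext => g; rewrite ell2DE ell2ZE !SE.
  by rewrite innerDr innerZr rmorphD rmorphM /= conjCK.
move=> x y; apply/eqP; rewrite -subr_eq0; apply/eqP.
apply: (@functional_eq0 (fun x => inner (T x) y - inner x (S y)) (M * nrm y + M * nrm y)).
- by rewrite addr_ge0// mulr_ge0 ?nrm_ge0// ltW.
- by move=> a u v; rewrite Tl !innerDl !innerZl; ring.
- move=> u; apply: le_trans (normcB_le _ _) _; rewrite mulrDl; apply: lerD.
    apply: le_trans (cauchy_schwarz _ _) _; rewrite mulrAC.
    by rewrite ler_wpM2r ?nrm_ge0// TM.
  apply: le_trans (cauchy_schwarz _ _) _; rewrite mulrC.
  by rewrite ler_wpM2r ?nrm_ge0// SM.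
- by move=> g _; rewrite inner_deltal SE conjCK subrr.
Qed.

(** Moving T across as an adjoint turns the matrix expansion into the definition of [inner], so
    convergence comes for free. *)
Lemma op_coef_csum T x h : bounded_op T ->
  T x h = csum (fun g => x g * T (delta g) h).
Proof.
move=> /bounded_opP[Tl [M M0 TM]]; have [S [_ TS _]] := adjoint_exists Tl M0 TM.
rewrite -inner_deltar TS inner_csumE; congr csum; apply/funext => g.
by rewrite -[(S _ _)^*]inner_deltal -TS inner_deltar.
Qed.

End density.

(** * Twisted right shifts and the commutant *)

Section right_shift.
Context {R : realType} {G : zmodType} (nu : cocycle R G).
Local Notation E := (ell2 R G).
Local Notation L := (twisted_vN nu).
Local Notation A := (range (twisted_shift nu)).
Implicit Types (x y : E) (S T : E -> E).

Fact right_shift_subproof (h : G) x : (fun g => nu (g - h) h * x (g - h)) \in square_summable.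
Proof.
apply: (weighted_perm_l2 x (fun g => cocycle_norm nu (g - h) h) _).1.
by exists (+%R^~ h) => g; rewrite (addrK, subrK).
Qed.
(** The right regular representation with the same cocycle: its commutation with [twisted_shift] is
    exactly the cocycle identity. *)
Definition right_shift h x : E := Ell2 (right_shift_subproof h x).

Lemma right_shiftE h x g : right_shift h x g = nu (g - h) h * x (g - h).
Proof. by []. Qed.

Lemma twisted_shiftE h x g : twisted_shift nu h x g = nu h (g - h) * x (g - h).
Proof. by []. Qed.

Lemma right_shift_delta h g : right_shift h (delta g) = nu g h *: delta (g + h).
Proof.
apply: ell2_ext => k; rewrite right_shiftE ell2ZE !delta_coefE subr_eq.
by have [->|_] := eqVneq k (g + h); rewrite ?mulr0// addrK.
Qed.

Lemma right_shift_delta0 h : right_shift h (delta 0) = delta h.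
Proof. by rewrite right_shift_delta cocycle0g scale1r add0r. Qed.

Lemma right_shift_linear h : linear (right_shift h).
Proof. by move=> a x y; apply: ell2_ext => g; rewrite /= [LHS]mulrDr mulrCA. Qed.

Lemma right_shift_nrm h x : nrm (right_shift h x) = nrm x.
Proof.
rewrite !nrmE.
apply: (weighted_perm_l2 x (fun g => cocycle_norm nu (g - h) h) _).2.
by exists (+%R^~ h) => g; rewrite (addrK, subrK).
Qed.

Lemma right_shift_bounded h : bounded_op (right_shift h).
Proof.
apply/bounded_opP; split; first exact: right_shift_linear.
by exists 1 => // x; rewrite mul1r right_shift_nrm.
Qed.

Lemma right_shift_inner h x y : inner (right_shift h x) (right_shift h y) = inner x y.
Proof.
apply: (@inner_reindex _ _ (fun g => g - h) (fun g => nu (g - h) h)) => [|g|//|//].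
  by exists (+%R^~ h) => g; rewrite (addrK, subrK).
exact: cocycle_norm.
Qed.

(** Stands in for an inverse: with [right_shift_inner] it lets commutation pass to adjoints. *)
Lemma right_shift_surj h y : exists x, y = right_shift h x.
Proof.
have n0 g : nu g h != 0 by rewrite -normr_eq0 cocycle_norm oner_eq0.
have yP : (fun g => (nu g h)^-1 * y (g + h)) \in square_summable.
  apply: (weighted_perm_l2 y (fun g => _) _).1.
    by move=> g; rewrite normfV cocycle_norm invr1.
  by exists (+%R^~ (- h)) => g; rewrite (addrK, subrK).
exists (Ell2 yP); apply: ell2_ext => g; rewrite right_shiftE.
by rewrite -[Ell2 yP _]/(_ * y (g - h + h)) subrK mulVKf.
Qed.

Lemma twisted_right_shiftC h k :
  twisted_shift nu h \o right_shift k = right_shift k \o twisted_shift nu h.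
Proof.
apply/funext => x; apply: ell2_ext => g.
rewrite /= twisted_shiftE !right_shiftE twisted_shiftE !mulrA.
rewrite (addrAC g (- k)); congr (_ * _).
have := cocycleP nu h (g - h - k) k; rewrite subrK.
have -> : h + (g - h - k) = g - k by rewrite addrA subrKC.
by rewrite mulrC => ->; rewrite mulrC.
Qed.

Lemma right_shift_adjointC T S h : is_adjoint T S ->
  T \o right_shift h = right_shift h \o T -> S \o right_shift h = right_shift h \o S.
Proof.
move=> TS Th; apply/funext => y; apply: ell2_ext => g; apply: (can_inj conjCK).
rewrite -!inner_deltal; have [d ->] := right_shift_surj h (delta g).
rewrite /= -TS -[T _]/((T \o right_shift h) d) Th /= !right_shift_inner.
exact: TS.
Qed.

Lemma right_shift_commutant h : commutant (A `|` adjoints A) (right_shift h).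
Proof.
split=> [|S [[l _ <-]|[_ [_ [l _ <-] lS]]]]; first exact: right_shift_bounded.
  by rewrite twisted_right_shiftC.
by rewrite (right_shift_adjointC lS) ?twisted_right_shiftC.
Qed.

Lemma vN_right_shiftC (x : L) h : x \o right_shift h = right_shift h \o x.
Proof.
by have /asboolP[_] := valP x; apply; exact: right_shift_commutant.
Qed.

Lemma vN_bounded (x : L) : bounded_op x.
Proof. by have /asboolP[] := valP x. Qed.

Lemma op_delta0 T h g : T \o right_shift h = right_shift h \o T ->
  T (delta h) g = nu (g - h) h * T (delta 0) (g - h).
Proof.
move=> Th; rewrite -{1}(right_shift_delta0 h) -[T _]/((T \o right_shift h) (delta 0)) Th.
by rewrite /= right_shiftE.
Qed.

(* The double commutant theorem for the left and the right regular
   representations: the matrix coefficients of T S and S T agree after the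
   reindexing k |-> g + h - k. *)
Lemma vN_generatedP T : bounded_op T ->
  (forall h, T \o right_shift h = right_shift h \o T) -> vN_generated A T.
Proof.
move=> Tb Th; split=> // S [Sb SA].
have Su h : S \o twisted_shift nu h = twisted_shift nu h \o S.
  by apply: SA; left; exists h.
apply: bounded_op_ext => [||h]; [exact: bounded_op_comp | exact: bounded_op_comp |].
apply: ell2_ext => g /=.
rewrite (op_coef_csum _ _ Tb) (op_coef_csum _ _ Sb).
have rb : bijective (fun k => g + h - k).
  by exists (fun k => g + h - k) => k; rewrite subKr.
rewrite -[RHS](csum_reindex _ rb); congr csum; apply/funext => k /=.
have Sdelta a b : S (delta a) b = nu a (b - a) * S (delta 0) (b - a).
  have -> : S (delta a) = twisted_shift nu a (S (delta 0)).
    rewrite -[RHS]/((twisted_shift nu a \o S) (delta 0)) -Su /=.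
    by rewrite twisted_shift_delta cocycleg0 scale1r addr0.
  by rewrite twisted_shiftE.
rewrite (op_delta0 g (Th k)) [T (delta h) _]op_delta0//
  [S (delta h) _]Sdelta [S (delta (g + h - k)) g]Sdelta.
have -> : g + h - k - h = g - k by rewrite addrAC addrK.
have -> : g - (g + h - k) = k - h by rewrite -addrA opprD addrA subrr add0r opprB.
have := cocycleP nu (g - k) h (k - h).
have -> : h + (k - h) = k by rewrite addrCA subrr addr0.
rewrite (addrAC g (- k) h) => E1.
transitivity (nu h (k - h) * nu (g - k) k * S (delta 0) (k - h) * T (delta 0) (g - k)).
  ring.
rewrite -E1; ring.
Qed.

Definition vN_of T (Tb : bounded_op T)
  (Th : forall h, T \o right_shift h = right_shift h \o T) : L :=
  Sub T (introT (asboolP _) (vN_generatedP Tb Th)).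

Lemma vN_ofE T Tb Th : vN_op (@vN_of T Tb Th) = T. Proof. by []. Qed.

Lemma vN_opP (x y : L) : vN_op x = vN_op y -> x = y.
Proof. exact: val_inj. Qed.

(** Commutation with the right shifts makes each column a twisted translate of the column at 0, so
    [delta 0] is separating. *)
Lemma vN_delta0_inj (x y : L) : x (delta 0) = y (delta 0) -> x = y.
Proof.
move=> xy; apply: vN_opP; apply: bounded_op_ext => [||h]; try exact: vN_bounded.
apply: ell2_ext => g; rewrite (op_delta0 g (vN_right_shiftC x h)).
by rewrite (op_delta0 g (vN_right_shiftC y h)) xy.
Qed.

(** Row g of T is, after k |-> g - k and up to unimodular factors, the column at 0. So the 2-norm of
    T alone controls the coefficients of T x, whatever its operator norm. *)
Lemma vN_coef_le T x g : bounded_op T ->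
  (forall h, T \o right_shift h = right_shift h \o T) ->
  normc (T x g) <= nrm (T (delta 0)) * nrm x.
Proof.
move=> Tb Th; have /bounded_opP[Tl [M M0 TM]] := Tb.
have [S [_ TS _]] := adjoint_exists Tl M0 TM.
rewrite -(inner_deltar (T x)) TS mulrC; apply: le_trans (cauchy_schwarz _ _) _.
rewrite ler_wpM2l ?nrm_ge0// !nrmE /l2norm.
rewrite [X in Num.sqrt (fine X) <= _](_ : _ = sqnorm (\val (T (delta 0)))) //.
have rb : bijective (fun k => g - k) by exists (fun k => g - k) => k; rewrite subKr.
rewrite /sqnorm [RHS](@reindex_esum _ _ _ setT setT (fun k => g - k)); last first.
  by rewrite setTT_bijective.
apply: eq_esum => k _; rewrite -[\val (S _) k]conjCK normc_conj.
rewrite -[(\val (S _) k)^*]inner_deltal -TS inner_deltar (op_delta0 _ (Th _)).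
by rewrite normcM; have [->] := cocycle_norm nu (g - k) k; rewrite mul1r.
Qed.

Lemma vN_adjoint (x : L) : exists y : L, is_star x y.
Proof.
have /bounded_opP[xl [M M0 xM]] := vN_bounded x.
have [S [Sb xS _]] := adjoint_exists xl M0 xM.
have Sh h : S \o right_shift h = right_shift h \o S.
  by apply: right_shift_adjointC xS _; exact: vN_right_shiftC.
by exists (vN_of Sb Sh).
Qed.

End right_shift.

(** * Star automorphisms fixing the canonical unitaries *)

Section neumann.
Context {R : realType} {I : choiceType}.
Local Notation E := (ell2 R I).

Lemma expr_small (q C e : R) : 0 <= q -> q < 1 -> 0 < e ->
  exists N, forall n, (N <= n)%N -> q ^+ n * C < e.
Proof.
move=> q0 q1 e0; have C0 : 0 < `|C| + 1 by rewrite ltr_wpDl.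
have /cvg_expr qn : `|q| < 1 by rewrite ger0_norm.
have /(_ _ (e / (`|C| + 1))) := @cvgr_dist_lt _ _ _ _ _ _ _ qn.
rewrite divr_gt0// => /(_ isT)[N _ Nq]; exists N => n /Nq /=.
rewrite sub0r normrN ger0_norm ?exprn_ge0// ltr_pdivlMr// => qC.
apply: le_lt_trans qC; rewrite ler_wpM2l ?exprn_ge0//.
by apply: le_trans (ler_norm C) _; rewrite lerDl.
Qed.

Lemma neumann_solution (K : E -> E) (q : R) v : linear K -> 0 <= q -> q < 1 ->
  (forall x, nrm (K x) <= q * nrm x) -> exists w, w = v + K w.
Proof.
move=> Kl q0 q1 Kq.
pose w := fix w n := if n is n'.+1 then v + K (w n') else (0 : E).
(* The solution of C = |v| + q C, hence a bound for all iterates; each further step multiplies the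
   error by q. *)
pose C := nrm v / (1 - q).
have C0 : 0 <= C by rewrite divr_ge0 ?nrm_ge0//; lra.
have wC n : nrm (w n) <= C.
  elim: n => [|n IH] /=; first by rewrite nrm0.
  apply: le_trans (nrmD _ _) _; apply: le_trans (lerD (lexx _) (Kq _)) _.
  apply: (@le_trans _ _ (nrm v + q * C)); first by rewrite lerD2l ler_wpM2l.
  by rewrite /C le_eqVlt; apply/orP; left; apply/eqP; field; lra.
have wq n j : nrm (w (n + j)%N - w n) <= q ^+ n * C.
  elim: n => [|n IH]; first by rewrite add0n expr0 mul1r subr0.
  rewrite addSn /= opprD addrACA subrr add0r -(linear_limB _ _ Kl).
  by apply: le_trans (Kq _) _; rewrite exprS -mulrA ler_wpM2l.
have [l wl] : exists l, seq_lim w l.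
  apply: seq_cauchy_cvg => e e0; have e20 : 0 < e / 2 by rewrite divr_gt0.
  have [N Nq] := expr_small C q0 q1 e20; exists N => m n Nm Nn.
  have -> : w m - w n = (w (N + (m - N))%N - w N) - (w (N + (n - N))%N - w N).
    by rewrite !subnKC//; ell2_ring.
  apply: le_lt_trans (nrmB _ _) _; rewrite [e]splitr.
  by apply: ltrD; apply: le_lt_trans (wq _ _) _; exact: Nq.
exists l; apply/eqP; rewrite -subr_eq0; apply/eqP/nrm0_eq0/eqP.
rewrite eq_le nrm_ge0 andbT; apply/ler_addgt0Pr => e e0; rewrite add0r.
have e20 : 0 < e / 2 by rewrite divr_gt0.
have [N Nl] := wl _ e20.
have -> : l - (v + K l) = (l - w N.+1) + K (w N - l).
  by rewrite (linear_limB _ _ Kl) /=; ell2_ring.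
apply: le_trans (nrmD _ _) _; rewrite [e]splitr; apply: lerD.
  by rewrite nrm_distC ltW// Nl.
apply: le_trans (Kq _) _; apply: (@le_trans _ _ (1 * nrm (w N - l))).
  by rewrite ler_wpM2r ?nrm_ge0// ltW.
by rewrite mul1r ltW// Nl.
Qed.

End neumann.

(** * Contractivity and a noncommutative Egorov theorem *)

Section star_automorphisms.
Context {R : realType} {G : zmodType} (nu : cocycle R G).
Local Notation E := (ell2 R G).
Local Notation L := (twisted_vN nu).
Local Notation A := (range (twisted_shift nu)).
Local Notation u := (can_unitary nu).
Implicit Types (x y z : L) (v w : E).

Lemma vN_opM x y v : (x * y : L) v = x (y v). Proof. by []. Qed.
Lemma vN_op1 v : (1 : L) v = v. Proof. by []. Qed.
Lemma vN_opD x y v : (x + y : L) v = x v + y v. Proof. by []. Qed.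
Lemma vN_opB x y v : (x - y : L) v = x v - y v. Proof. by []. Qed.
Lemma vN_opZ (c : R[i]) x v : (c *: x : L) v = c *: x v. Proof. by []. Qed.
Lemma vN_opDr x v w : x (v + w) = x v + x w.
Proof. by apply: linear_limD; exact: vN_linear. Qed.
Lemma vN_opBr x v w : x (v - w) = x v - x w.
Proof. by apply: linear_limB; exact: vN_linear. Qed.
Lemma vN_opZr x (c : R[i]) v : x (c *: v) = c *: x v.
Proof. by apply: linear_limZ; exact: vN_linear. Qed.
Lemma vN_op_sum (J : Type) (s : seq J) (F : J -> L) v :
  (\sum_(j <- s) F j : L) v = \sum_(j <- s) F j v.
Proof. by elim: s => [|j s IH]; rewrite ?big_nil// !big_cons vN_opD IH. Qed.

Lemma vN_mulZr (c : R[i]) x y : x * (c *: y) = c *: (x * y).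
Proof. by apply: vN_opP; apply/funext => v; rewrite vN_opM vN_opZ vN_opZr. Qed.
Lemma vN_mulZl (c : R[i]) x y : (c *: x) * y = c *: (x * y).
Proof. exact: vN_opP. Qed.

Lemma vN_bound x : exists2 M : R, 0 < M & forall v, nrm (x v) <= M * nrm v.
Proof. by have /bounded_opP[] := vN_bounded x. Qed.

Lemma star_autP (a : star_aut A) : [/\ bijective a, linear a, monoid_morphism a &
       forall x y, is_star x y <-> is_star (a x) (a y)].
Proof. exact/asboolP/(valP a). Qed.

Lemma star_autM (a : star_aut A) x y : a (x * y) = a x * a y.
Proof. by have [_ _ [_ aM] _] := star_autP a; exact: aM. Qed.
Lemma star_aut1 (a : star_aut A) : a 1 = 1.
Proof. by have [_ _ [a1 _] _] := star_autP a. Qed.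
Lemma star_autL (a : star_aut A) c x y : a (c *: x + y) = c *: a x + a y.
Proof. by have [_ al _ _] := star_autP a; exact: al. Qed.
Lemma star_aut0 (a : star_aut A) : a 0 = 0.
Proof. by have := star_autL a (-1) 0 0; rewrite scaler0 addr0 scaleN1r addNr. Qed.
Lemma star_autZ (a : star_aut A) c x : a (c *: x) = c *: a x.
Proof. by rewrite -[c *: x]addr0 star_autL star_aut0 addr0. Qed.
Lemma star_autD (a : star_aut A) x y : a (x + y) = a x + a y.
Proof. by rewrite -[x]scale1r star_autL !scale1r. Qed.
Lemma star_autB (a : star_aut A) x y : a (x - y) = a x - a y.
Proof. by rewrite star_autD -scaleN1r star_autZ scaleN1r. Qed.
Lemma star_aut_sum (a : star_aut A) (J : Type) (s : seq J) (F : J -> L) :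
  a (\sum_(j <- s) F j) = \sum_(j <- s) a (F j).
Proof. by elim: s => [|j s IH]; rewrite ?big_nil ?star_aut0// !big_cons star_autD IH. Qed.

Lemma is_adjoint_bound (S T : E -> E) (r : R) : 0 <= r -> is_adjoint T S ->
  (forall v, nrm (T v) <= r * nrm v) -> forall v, nrm (S v) <= r * nrm v.
Proof.
move=> r0 TS Tr v; have [s0|s0] := eqVneq (nrm (S v)) 0.
  by rewrite s0 mulr_ge0 ?nrm_ge0.
have sp : 0 < nrm (S v) by rewrite lt0r s0 nrm_ge0.
have := cauchy_schwarz (T (S v)) v; rewrite TS inner_nrm.
rewrite [normc _](_ : _ = nrm (S v) ^+ 2); last first.
  by rewrite /= expr0n addr0 sqrtr_sqr ger0_norm ?sqr_ge0.
rewrite expr2 => H; rewrite -(ler_pM2l sp); apply: le_trans H _.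
by rewrite mulrCA mulrA ler_wpM2r ?nrm_ge0.
Qed.

(** Solutions of w = v + z w are unique, so the solution operator is linear and commutes with the
    right shifts; being bounded, it lies in the algebra. A left inverse suffices to bound 1 - z from
    below. *)
Lemma vN_neumann z (q : R) : 0 <= q -> q < 1 ->
  (forall v, nrm (z v) <= q * nrm v) -> exists y, y * (1 - z) = 1.
Proof.
move=> q0 q1 zq.
have /choice[B BP] v := neumann_solution v (vN_linear z) q0 q1 zq.
have uniq v w : w = v + z w -> w = B v.
  move=> ww; apply/eqP; rewrite -subr_eq0; apply/eqP/nrm0_eq0/eqP.
  have e : w - B v = z (w - B v).
    by rewrite vN_opBr {1}ww {1}(BP v); ell2_ring.
  have := zq (w - B v); rewrite -e.
  rewrite eq_le nrm_ge0 andbT; move: (nrm_ge0 (w - B v)); set n := nrm _.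
  by nra.
have Bl : linear B.
  move=> c v w; symmetry; apply: uniq.
  by rewrite vN_opDr vN_opZr {1}(BP v) {1}(BP w); ell2_ring.
have Bb : bounded_op B.
  apply/bounded_opP; split=> //; exists ((1 - q)^-1); first by rewrite invr_gt0; lra.
  move=> v; rewrite ler_pdivlMl; last by lra.
  have := nrmD v (z (B v)); rewrite -BP; have := zq (B v).
  by set a := nrm (B v); set b := nrm (z _); set c := nrm v; lra.
have Bc h : B \o right_shift nu h = right_shift nu h \o B.
  apply/funext => v /=; symmetry; apply: uniq.
  rewrite -[z (right_shift _ _ _)]/((z \o right_shift nu h) (B v)) vN_right_shiftC /=.
  by rewrite {1}(BP v) (linear_limD _ _ (right_shift_linear nu h)).
exists (vN_of Bb Bc); apply: vN_opP; apply/funext => v.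
rewrite vN_opM vN_opB vN_op1 vN_ofE; symmetry; apply: uniq.
by rewrite subrK.
Qed.

(** Let m be the norm of a z and suppose m > r. Then 1 - m^-2 z^* z is left invertible by Neumann
    series, hence so is its image, which is therefore bounded below by some 1 / C. This improves the
    bound on a z to m sqrt (1 - C^-2), against the minimality of m. *)
Lemma star_aut_contractive (a : star_aut A) z (r : R) : 0 <= r ->
  (forall v, nrm (z v) <= r * nrm v) -> forall v, nrm (a z v) <= r * nrm v.
Proof.
move=> r0 zr.
pose B := [set b : R | 0 <= b /\ forall v, nrm (a z v) <= b * nrm v].
have Binf : has_inf B.
  have [M M0 aM] := vN_bound (a z); split; first by exists M; split=> //; exact: ltW.
  by exists 0 => b [].
pose m := inf B.
have m0 : 0 <= m by apply: lb_le_inf; [exact: Binf.1 | move=> b []].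
have mB v : nrm (a z v) <= m * nrm v.
  apply/ler_addgt0Pr => e e0; have n0 := nrm_ge0 v.
  have d0 : 0 < e / (nrm v + 1) by rewrite divr_gt0//; lra.
  have [b [b0 bB] bm] := inf_adherent d0 Binf.
  apply: le_trans (bB v) _.
  have : b * nrm v <= (m + e / (nrm v + 1)) * nrm v by rewrite ler_wpM2r// ltW.
  move=> /le_trans; apply; rewrite mulrDl lerD2l mulrAC ler_pdivrMr; last by lra.
  by rewrite ler_wpM2l ?ltW//; lra.
have [mr|rm] := leP m r.
  by move=> v; apply: le_trans (mB v) _; rewrite ler_wpM2r ?nrm_ge0.
exfalso.
have mp : 0 < m by apply: le_lt_trans r0 rm.
have [y zy] := vN_adjoint z.
have azy : is_star (a z) (a y) by have [_ _ _ /(_ z y) [H _]] := star_autP a; exact: H.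
have yr := is_adjoint_bound r0 zy zr.
have aym := is_adjoint_bound m0 azy mB.
pose k : L := ((m ^+ 2)^-1)%:C%C *: (y * z).
have nc (t : R) : 0 <= t -> normc t%:C%C = t.
  by move=> t0; rewrite /= expr0n addr0 sqrtr_sqr ger0_norm.
have m2 : 0 < m ^+ 2 by rewrite exprn_gt0.
have m2V : 0 <= (m ^+ 2)^-1 by rewrite invr_ge0 ltW.
have kq v : nrm (k v) <= (r ^+ 2 / m ^+ 2) * nrm v.
  rewrite vN_opZ nrmZ nc// vN_opM mulrAC mulrC ler_wpM2r//.
  apply: le_trans (yr _) _; rewrite expr2 -mulrA ler_wpM2l//.
have [] := @vN_neumann k (r ^+ 2 / m ^+ 2) _ _ kq.
- by rewrite divr_ge0 ?sqr_ge0.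
- by rewrite ltr_pdivrMr// mul1r ltr_pXn2r// nnegrE.
move=> b bk.
have abk : a b * (1 - ((m ^+ 2)^-1)%:C%C *: (a y * a z)) = 1.
  by rewrite -star_autM -star_autZ -(star_aut1 a) -star_autB -star_autM bk.
have [C0 C0p abC0] := vN_bound (a b).
(* Enlarged so that C > 1 and 1 - C^-2 is positive. *)
pose C := C0 + 1.
have C1 : 1 < C by rewrite /C; lra.
have abC v : nrm (a b v) <= C * nrm v.
  by apply: le_trans (abC0 v) _; rewrite ler_wpM2r ?nrm_ge0// /C; lra.
have key v : nrm (a z v) ^+ 2 <= m ^+ 2 * (1 - (C ^+ 2)^-1) * nrm v ^+ 2.
  (* Since the adjoint of a z is also bounded by m, expanding gives |w|^2 <= |v|^2 - m^-2 |a z v|^2,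
     while v = a b w gives |v| <= C |w|. *)
  pose w := v - ((m ^+ 2)^-1)%:C%C *: a y (a z v).
  have vE : v = a b w by rewrite -[LHS]vN_op1 -abk.
  have w2 : nrm w ^+ 2 <= nrm v ^+ 2 - (m ^+ 2)^-1 * nrm (a z v) ^+ 2.
    rewrite nrm_sqrB nrmZ nc// innerZr.
    rewrite -(azy v (a z v)) inner_nrm.
    have -> : complex.Re ((((m ^+ 2)^-1)%:C%C)^* * (nrm (a z v) ^+ 2)%:C%C) =
       (m ^+ 2)^-1 * nrm (a z v) ^+ 2 by rewrite /=; ring.
    have := aym (a z v).
    have := nrm_ge0 (a y (a z v)); have := nrm_ge0 (a z v).
    set p := nrm (a z v); set s := nrm (a y _) => p0 s0 sp.
    have : ((m ^+ 2)^-1 * s) ^+ 2 <= (m ^+ 2)^-1 * p ^+ 2.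
      rewrite exprMn expr2 -mulrA ler_wpM2l// ler_pdivrMl// -exprMn.
      by rewrite ler_pXn2r// nnegrE mulr_ge0.
    lra.
  have C20 : 0 < C ^+ 2 by rewrite exprn_gt0//; lra.
  have vw : nrm v ^+ 2 <= C ^+ 2 * nrm w ^+ 2.
    have C0' : 0 <= C by lra.
    rewrite {1}vE -exprMn (@ler_pXn2r _ 2) ?nnegrE ?mulr_ge0 ?nrm_ge0//.
  have : (C ^+ 2)^-1 * nrm v ^+ 2 <= nrm v ^+ 2 - (m ^+ 2)^-1 * nrm (a z v) ^+ 2.
    by rewrite ler_pdivrMl//; apply: le_trans vw _; rewrite ler_wpM2l// ltW.
  move=> H; have {H} : (m ^+ 2)^-1 * nrm (a z v) ^+ 2 <= (1 - (C ^+ 2)^-1) * nrm v ^+ 2.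
    by lra.
  by rewrite ler_pdivrMl// mulrA.
have C2 : 0 < 1 - (C ^+ 2)^-1.
  by rewrite subr_gt0 invf_lt1 ?exprn_gt0// ?exprn_egt1//; lra.
have : m <= m * Num.sqrt (1 - (C ^+ 2)^-1).
  apply: ge_inf; first exact: Binf.2.
  split; first by rewrite mulr_ge0 ?sqrtr_ge0.
  move=> v; rewrite -(@ler_pXn2r _ 2) ?nnegrE ?mulr_ge0 ?nrm_ge0 ?sqrtr_ge0//.
  have -> : (m * Num.sqrt (1 - (C ^+ 2)^-1) * nrm v) ^+ 2 =
      m ^+ 2 * (1 - (C ^+ 2)^-1) * nrm v ^+ 2.
    by rewrite 2!exprMn sqr_sqrtr// ltW.
  exact: key.
rewrite -{1}[m]mulr1 ler_pM2l// leNgt => /negP; apply.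
rewrite -(@ltr_pXn2r _ 2) ?nnegrE ?sqrtr_ge0// sqr_sqrtr ?ltW// expr1n.
by rewrite ltrBlDr ltrDl invr_gt0 exprn_gt0//; lra.
Qed.

Lemma sum_uniq_le_nrm (I : choiceType) (x : ell2 R I) (s : seq I) : uniq s ->
  \sum_(i <- s) normc (x i) ^+ 2 <= nrm x ^+ 2.
Proof.
move=> us; rewrite (perm_big [fset i in s]%fset) /=; first exact: sum_sqr_le_nrm.
by apply: uniq_perm => // i; rewrite !inE.
Qed.

Local Notation F := (ell2 R (nat * G)%type).

(** ell2 over nat * G is the Hilbert sum of countably many copies of ell2 over G; it will hold the
    graph of a whole sequence of operators. *)
Fact component_subproof (n : nat) (f : F) : (fun g => f (n, g)) \in square_summable /\
  l2norm (fun g => f (n, g)) <= nrm f.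
Proof.
apply: l2norm_le; first exact: nrm_ge0.
move=> s; rewrite -(big_map (fun g => (n, g)) predT (fun p => normc (f p) ^+ 2)).
by apply: sum_uniq_le_nrm; rewrite map_inj_uniq// => g h [].
Qed.
Definition component n (f : F) : E := Ell2 (component_subproof n f).1.

Lemma component_nrm n f : nrm (component n f) <= nrm f.
Proof. by rewrite nrmE; exact: (component_subproof n f).2. Qed.

Lemma component_linear n : linear (component n).
Proof. by move=> c f g; apply: ell2_ext. Qed.

Lemma weighted_reindex (I : choiceType) (c : I -> R[i]) (s : I -> I) (x : ell2 R I) :
  (forall i, `|c i| = 1) -> bijective s ->
  (fun i => c i * x (s i)) \in square_summable.
Proof.
move=> c1 sb; apply/asboolP; have /asboolP := valP x; congr (_ < _)%E.
rewrite /sqnorm [LHS](@reindex_esum _ _ _ setT setT s) ?setTT_bijective//.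
by apply: eq_esum => i _; have [ci] := c1 i; rewrite normcM [normc (c i)]ci mul1r.
Qed.

Lemma normc_exp2 n : normc (2 ^+ n : R[i]) = 2 ^+ n.
Proof. by rewrite -natrX [LHS](normcMn 1) [normc 1]normc1 natrX. Qed.

Lemma sum_fibers_le (s : {fset (nat * G)}) (f : nat * G -> R) : (forall p, 0 <= f p) ->
  exists N, exists t : nat -> seq G, (forall n, uniq (t n)) /\
    \sum_(p <- s) f p = \sum_(n < N) \sum_(g <- t n) f (val n, g).
Proof.
move=> f0; exists (\max_(p <- s) p.1).+1%N.
exists (fun n => [seq p.2 | p <- s & p.1 == n]); split=> [n|].
  rewrite map_inj_in_uniq; first exact/filter_uniq/fset_uniq.
  move=> [a b] [c d]; rewrite !mem_filter /= => /andP[/eqP -> _] /andP[/eqP -> _].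
  by move=> ->.
under [RHS]eq_bigr => n _.
  rewrite big_map big_filter.
  over.
rewrite /= (exchange_big_dep xpredT)//= big_seq [RHS]big_seq; apply: eq_bigr => -[a b] abs /=.
have aN : (a < (\max_(p <- s) p.1).+1)%N.
  by rewrite ltnS (big_rem (a, b))//= leq_maxl.
by rewrite (big_pred1 (Ordinal aN))//= => i; rewrite -val_eqE /= eq_sym.
Qed.

Fact assemble_subproof (f : nat -> E) (M : R) : 0 <= M ->
  (forall N, \sum_(n < N) nrm (f n) ^+ 2 <= M ^+ 2) ->
  (fun p : nat * G => f p.1 p.2) \in square_summable /\
  l2norm (fun p : nat * G => f p.1 p.2) <= M.
Proof.
move=> M0 fM; apply: l2norm_le => // s.
have [N [t [tu ->]]] := @sum_fibers_le s (fun p => normc (f p.1 p.2) ^+ 2) (fun=> sqr_ge0 _).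
apply: le_trans (fM N); apply: ler_sum => n _; exact: (sum_uniq_le_nrm (f n)).
Qed.

(* The operator b is the corner of the projection onto the closed graph
   {(v, (2^n y_n v)_n)}; then |2^n y_n b v| <= |v| because both are components
   of the projection of (v, 0, 0, ...). *)
Lemma noncommutative_egorov (y : nat -> L) (e : R) : 0 < e ->
  (forall N, \sum_(n < N) (2 ^+ n * nrm (y n (delta 0))) ^+ 2 <= e ^+ 2) ->
  exists b : L, nrm (b (delta 0) - delta 0) <= e /\
    forall n v, nrm (y n (b v)) <= 2^-1 ^+ n * nrm v.
Proof.
move=> e0 ye.
(* The graph: v sits in slot 0 and 2^n y_n v in slot n + 1. *)
pose D (f : F) := forall n, component n.+1 f = 2 ^+ n *: y n (component 0 f).
have DG0 : D 0.
  by move=> n; rewrite !(linear_lim0 (component_linear _)) (linear_lim0 (vN_linear _)) scaler0.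
have DGL c f g : D f -> D g -> D (c *: f + g).
  by move=> Df Dg n; rewrite !component_linear Df Dg vN_opDr vN_opZr; ell2_ring.
have DGc (f : nat -> F) l : (forall n, D (f n)) -> seq_lim f l -> D l.
  move=> Df fl n; apply/eqP; rewrite -subr_eq0; apply/eqP/nrm0_eq0/eqP.
  rewrite eq_le nrm_ge0 andbT; apply/ler_addgt0Pr => d d0; rewrite add0r.
  have [M M0 yM] := vN_bound (y n).
  have n2 : 0 < (2 : R) ^+ n by rewrite exprn_gt0.
  have C0 : 0 < 1 + 2 ^+ n * M by have := mulr_gt0 n2 M0; lra.
  have dC : 0 < d / (1 + 2 ^+ n * M) by rewrite divr_gt0.
  have [N /(_ _ (leqnn N)) Nl] := fl _ dC.
  have -> : component n.+1 l - 2 ^+ n *: y n (component 0 l) =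
     2 ^+ n *: y n (component 0 (f N - l)) - component n.+1 (f N - l).
    by rewrite !(linear_limB _ _ (component_linear _)) Df vN_opBr; ell2_ring.
  apply: le_trans (nrmB _ _) _; rewrite nrmZ.
  rewrite normc_exp2.
  move: Nl; rewrite ltr_pdivlMr//.
  have := component_nrm 0 (f N - l); have := component_nrm n.+1 (f N - l).
  have := yM (component 0 (f N - l)).
  have := nrm_ge0 (y n (component 0 (f N - l))).
  set p := nrm (f N - l); set q := nrm (y n _); set q' := nrm (component 0 _).
  set q2 := nrm (component n.+1 _) => q0 qq q2p q'p pd.
  have h1 : 2 ^+ n * q <= 2 ^+ n * (M * p).
    rewrite ler_wpM2l ?(ltW n2)//; apply: le_trans qq _; rewrite ler_wpM2l// ltW//.
  lra.
have [P [[PD Po Pl] [Pm Pu]]] := closed_projection DG0 DGL DGc.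
pose i0 (v : E) n : E := if n is n'.+1 then 0 else v.
have i0P v : forall N, \sum_(n < N) nrm (i0 v n) ^+ 2 <= nrm v ^+ 2.
  case=> [|N]; first by rewrite big_ord0 sqr_ge0.
  by rewrite big_ord_recl /= big1 ?addr0// => n _; rewrite nrm0 expr0n.
pose i v : F := Ell2 (assemble_subproof (nrm_ge0 v) (i0P v)).1.
have inrm v : nrm (i v) <= nrm v.
  by rewrite nrmE; exact: (assemble_subproof (nrm_ge0 v) (i0P v)).2.
have iE v n g : i v (n, g) = if n is n'.+1 then 0 else v g.
  by rewrite -[LHS]/(i0 v n g); case: n.
have il : linear i.
  move=> c v w; apply: ell2_ext => -[n g]; rewrite ell2DE ell2ZE !iE.
  by case: n => [//|n]; rewrite mulr0 addr0.
have Pnrm f : nrm (P f) <= nrm f.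
  rewrite -(@ler_pXn2r _ 2) ?nnegrE ?nrm_ge0//.
  have := nrm_sqrD (f - P f) (P f); rewrite subrK Po// => ->.
  by rewrite mulr0 addr0 lerDr sqr_ge0.
pose B v := component 0 (P (i v)).
have Bl : linear B by move=> c v w; rewrite /B il Pl component_linear.
have Bb : bounded_op B.
  apply/bounded_opP; split=> //; exists 1 => // v; rewrite mul1r.
  exact: le_trans (component_nrm _ _) (le_trans (Pnrm _) (inrm _)).
(* The diagonal right shift r preserves the graph in both directions and commutes with the embedding
   i, so P commutes with r by uniqueness of the projection. *)
have Bc h : B \o right_shift nu h = right_shift nu h \o B.
  have sb : bijective (fun p : nat * G => (p.1, p.2 - h)).
    by exists (fun p => (p.1, p.2 + h)) => -[a b] /=; rewrite (addrK, subrK).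
  have nu1 (p : nat * G) : `|nu (p.2 - h) h| = 1 by exact: cocycle_norm.
  have nuV (p : nat * G) : `|(nu p.2 h)^-1| = 1 by rewrite normfV cocycle_norm invr1.
  have sbV : bijective (fun p : nat * G => (p.1, p.2 + h)).
    by exists (fun p => (p.1, p.2 - h)) => -[a b] /=; rewrite (addrK, subrK).
  pose r (f : F) : F := Ell2 (weighted_reindex f nu1 sb).
  pose r' (f : F) : F := Ell2 (weighted_reindex f nuV sbV).
  have rc n (f : F) : component n (r f) = right_shift nu h (component n f).
    exact: ell2_ext.
  have rE (f : F) n g : r f (n, g) = nu (g - h) h * f (n, g - h) by [].
  have r'E (f : F) n g : r' f (n, g) = (nu g h)^-1 * f (n, g + h) by [].
  have rK (f : F) : r (r' f) = f.
    apply: ell2_ext => -[n g]; rewrite rE r'E subrK mulVKf//.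
    by rewrite -normr_eq0 cocycle_norm oner_eq0.
  have rl : linear r.
    move=> c f g; apply: ell2_ext => -[n k]; rewrite ell2DE ell2ZE !rE ell2DE ell2ZE.
    ring.
  have ri (f g : F) : inner (r f) (r g) = inner f g.
    exact: (@inner_reindex _ _ _ (fun p => nu (p.2 - h) h) _ _ _ _ sb).
  have yr n v : y n (right_shift nu h v) = right_shift nu h (y n v).
    exact: (congr1 (fun f => f v) (vN_right_shiftC (y n) h)).
  have rD (f : F) : D f -> D (r f).
    move=> Df n; rewrite !rc Df yr.
    by rewrite (linear_limZ _ _ (right_shift_linear nu h)).
  have r'D (f : F) : D f -> D (r' f).
    move=> Df n; apply/eqP; rewrite -subr_eq0; apply/eqP/nrm0_eq0.
    rewrite -(right_shift_nrm nu h) (linear_limB _ _ (right_shift_linear nu h)).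
    rewrite -rc rK Df (linear_limZ _ _ (right_shift_linear nu h)) -yr -rc rK.
    by rewrite subrr nrm0.
  have Pr (f : F) : P (r f) = r (P f).
    symmetry; apply: Pu => [|g Dg]; first exact/rD/PD.
    by rewrite -(linear_limB _ _ rl) -(rK g) ri Po//; exact: r'D.
  have ir v : i (right_shift nu h v) = r (i v).
    by apply: ell2_ext => -[n g]; rewrite rE !iE; case: n => [|n]//; rewrite mulr0.
  by apply/funext => v; rewrite /= /B ir Pr rc.
exists (vN_of Bb Bc); split.
  (* Adding g1, of norm at most e, to (delta 0, 0, 0, ...) lands in the graph, so projecting moves
     that vector by at most e. *)
  pose f1 n : E := if n is n'.+1 then 2 ^+ n' *: y n' (delta 0) else 0.
  have f1P N : \sum_(n < N) nrm (f1 n) ^+ 2 <= e ^+ 2.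
    case: N => [|N]; first by rewrite big_ord0 sqr_ge0.
    rewrite big_ord_recl /= nrm0 expr0n add0r.
    by apply: le_trans (ye N); apply: ler_sum => n _; rewrite nrmZ normc_exp2.
  pose g1 : F := Ell2 (assemble_subproof (ltW e0) f1P).1.
  have g1e : nrm g1 <= e by rewrite nrmE; exact: (assemble_subproof (ltW e0) f1P).2.
  have g1c n : component n g1 = f1 n by apply: ell2_ext.
  have ic n v : component n (i v) = i0 v n by apply: ell2_ext.
  have Dg : D (i (delta 0) + g1).
    move=> n; rewrite !(linear_limD _ _ (component_linear _)) !g1c !ic /=.
    by rewrite add0r addr0.
  rewrite vN_ofE -[delta 0 in X in _ - X]/(i0 (delta 0) 0%N) -ic.
  rewrite -(linear_limB _ _ (component_linear _)).
  apply: le_trans (component_nrm _ _) _; rewrite nrm_distC.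
  apply: le_trans (Pm _ _ Dg) _; apply: le_trans g1e.
  by rewrite opprD addrA subrr add0r nrmN.
move=> n v; rewrite vN_ofE.
have n2 : 0 < (2 : R) ^+ n by rewrite exprn_gt0.
rewrite exprVn ler_pdivlMl// -normc_exp2 -nrmZ -PD.
exact: le_trans (component_nrm _ _) (le_trans (Pnrm _) (inrm _)).
Qed.

Lemma can_unitary_delta0 h : u h (delta 0) = delta h.
Proof.
by rewrite -[LHS]/(twisted_shift nu h (delta 0)) twisted_shift_delta cocycleg0
  scale1r addr0.
Qed.

Lemma can_unitary0 : u 0 = 1.
Proof. by apply: vN_delta0_inj; rewrite can_unitary_delta0. Qed.

Lemma vN_approx x (e : R) : 0 < e -> exists s : {fset G},
  nrm ((x - \sum_(g <- s) x (delta 0) g *: u g : L) (delta 0)) < e.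
Proof.
move=> e0; have [s xs] := cutoff_approx (x (delta 0)) e0; exists s.
rewrite vN_opB vN_op_sum; under eq_bigr do rewrite vN_opZ can_unitary_delta0.
by rewrite -cutoff_delta.
Qed.

(* A star automorphism is not assumed to be normal. With x - a_n small in
   2-norm for a_n in the span of the unitaries, the operator b of
   noncommutative_egorov makes (x - a_n) b small in norm, hence also its image
   (a x - a_n) (a b); thus a x and x agree on the range of a b. *)
Lemma star_aut_id (a : star_aut A) : (forall h, a (u h) = u h) -> forall x, a x = x.
Proof.
move=> au x.
have [[a' aK a'K] _ _ _] := star_autP a.
(* The inverse is used because b, unlike a b, is known to be close to 1 at [delta 0]: pulling the
   identity (a x) (a b) = x (a b) back gives x b = a'(x) b. *)
suff xx : x = a' x by rewrite {1}xx a'K.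
apply: vN_delta0_inj; apply/eqP; rewrite -subr_eq0 -vN_opB; apply/eqP/nrm0_eq0/eqP.
rewrite eq_le nrm_ge0 andbT; apply/ler_addgt0Pr => d d0; rewrite add0r.
have [C C0 xC] := vN_bound (x - a' x).
have [e e0 eC] : exists2 e, 0 < e & C * e = d.
  by exists (d / C); [rewrite divr_gt0 | rewrite mulrC divfK// gt_eqF].
(* 4^-(n+1) beats the weight 2^n in the graph: the terms become at most e 2^-(n+1), and their
   squares sum to at most e^2. *)
have /choice[s sP] : forall n : nat, exists s : {fset G},
    nrm ((x - \sum_(g <- s) x (delta 0) g *: u g : L) (delta 0)) < e * 4^-1 ^+ n.+1.
  by move=> n; apply: vN_approx; rewrite mulr_gt0 ?exprn_gt0 ?invr_gt0.
pose an n : L := \sum_(g <- s n) x (delta 0) g *: u g.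
have aan n : a (an n) = an n.
  by rewrite star_aut_sum; apply: eq_bigr => g _; rewrite star_autZ au.
have [|b [be bn]] := @noncommutative_egorov (fun n => x - an n) e e0.
  move=> N; apply: (@le_trans _ _ (\sum_(n < N) e ^+ 2 * 2^-1 ^+ n.+1)).
    apply: ler_sum => n _.
    have q0 : 0 <= (2 : R)^-1 ^+ n.+1 by rewrite exprn_ge0// invr_ge0.
    have q1 : (2 : R)^-1 ^+ n.+1 <= 1 by rewrite exprn_ile1//; lra.
    have q4 : 2 ^+ n * (4 : R)^-1 ^+ n.+1 = 2^-1 * 2^-1 ^+ n.+1.
      rewrite (_ : 4 = 2 * 2 :> R); last by ring.
      rewrite invfM exprMn mulrA; congr (_ * _).
      by rewrite exprS mulrCA -exprMn mulfV// expr1n mulr1.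
    apply: (@le_trans _ _ ((e * 2^-1 ^+ n.+1) ^+ 2)).
      rewrite (@ler_pXn2r _ 2) ?nnegrE ?mulr_ge0 ?nrm_ge0 ?exprn_ge0 ?(ltW e0)//.
      apply: (@le_trans _ _ (2 ^+ n * (e * 4^-1 ^+ n.+1))).
        by rewrite ler_wpM2l ?exprn_ge0//; exact: ltW (sP n).
      rewrite mulrCA q4; move: q0 e0; set q := _ ^+ n.+1; clear; nra.
    move: q0 q1; rewrite exprMn; set q := _ ^+ n.+1; move=> q0 q1.
    by rewrite ler_wpM2l ?sqr_ge0// expr2 ler_piMr.
  rewrite -mulr_sumr ger_pMr ?exprn_gt0//.
  suff -> : \sum_(n < N) (2 : R)^-1 ^+ n.+1 = 1 - 2^-1 ^+ N.
    by rewrite gerBl exprn_ge0 ?invr_ge0.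
  elim: N => [|N IH]; first by rewrite big_ord0 expr0 subrr.
  by rewrite big_ord_recr /= IH exprS; field.
have key : a x * a b = x * a b.
  apply: vN_opP; apply/funext => v; apply: ell2_ext => g; rewrite !vN_opM.
  apply/eqP; rewrite -subr_eq0; apply/eqP/eq0_normc/eqP.
  rewrite eq_le normc_ge0 andbT; apply/ler_addgt0Pr => t t0; rewrite add0r.
  have t20 : 0 < t / 2 by rewrite divr_gt0.
  have h0 : 0 <= (2 : R)^-1 by rewrite invr_ge0.
  have h1 : (2 : R)^-1 < 1 by lra.
  have f0 : 0 <= (4 : R)^-1 by rewrite invr_ge0.
  have f1 : (4 : R)^-1 < 1 by lra.
  have [N1 N1P] := expr_small (nrm v) h0 h1 t20.
  have [N2 N2P] := expr_small (e * nrm (a b v)) f0 f1 t20.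
  pose n := maxn N1 N2.
  (* As a fixes [an n], the difference splits into the image of (x - an n) b, small in operator norm
     by contractivity, and (x - an n) (a b), whose coefficients [vN_coef_le] bounds through the
     2-norm of x - an n. *)
  have -> : (a x (a b v)) g - (x (a b v)) g =
      (a ((x - an n) * b) v) g - ((x - an n : L) (a b v)) g.
    by rewrite star_autM star_autB aan vN_opM !vN_opB !ell2DE !ell2NE; ring.
  apply: le_trans (normcB_le _ _) _; rewrite [t]splitr; apply: lerD.
    apply: le_trans (normc_le_nrm _ _) _.
    have bn' w : nrm (((x - an n) * b : L) w) <= 2^-1 ^+ n * nrm w by exact: bn.
    have := star_aut_contractive a (exprn_ge0 n h0) bn' v.
    by move=> /le_trans; apply; apply/ltW/N1P/leq_maxl.
  apply: le_trans (vN_coef_le _ _ (vN_bounded _) (vN_right_shiftC _)) _.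
  have n0 := nrm_ge0 (a b v).
  apply: (@le_trans _ _ (e * 4^-1 ^+ n.+1 * nrm (a b v))).
    by rewrite ler_wpM2r//; exact: ltW (sP n).
  rewrite mulrAC mulrC; apply/ltW/N2P.
  by rewrite (leq_trans (leq_maxr N1 N2))// leqW.
have xb : x * b = a' x * b.
  by rewrite -[LHS]aK star_autM key -[X in X * _]a'K -star_autM aK.
have -> : (x - a' x : L) (delta 0) = (x - a' x : L) (delta 0 - b (delta 0)).
  by rewrite vN_opBr -(vN_opM (x - a' x) b) mulrBl xb subrr subr0.
by apply: le_trans (xC _) _; rewrite nrm_distC -eC ler_pM2l.
Qed.

Lemma star_aut_ext (a b : star_aut A) : (forall h, a (u h) = b (u h)) -> a = b.
Proof.
move=> ab; pose b' : star_aut A := (b^-1)%g.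
have bK x : b' (b x) = x.
  by rewrite -[LHS]/((b' * b : star_aut A)%g x) mulVg.
have bVK x : b (b' x) = x by rewrite -[LHS]/((b * b' : star_aut A)%g x) mulgV.
apply: val_inj; apply/funext => x.
have b'a : b' (a x) = x.
  by apply: (@star_aut_id (b' * a)%g) => h; rewrite -[LHS]/(b' (a (u h))) ab bK.
by rewrite -[LHS]/(a x) -[RHS]/(b x) -{2}b'a bVK.
Qed.

Lemma can_unitaryM g h : u g * u h = nu g h *: u (g + h).
Proof.
apply: vN_delta0_inj; rewrite vN_opM vN_opZ !can_unitary_delta0.
by rewrite -[LHS]/(twisted_shift nu g (delta h)) twisted_shift_delta.
Qed.

Lemma can_unitary_inj (c d : R[i]) g h : c != 0 -> c *: u g = d *: u h -> g = h /\ c = d.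
Proof.
move=> c0 ud.
have : (c *: u g : L) (delta 0) g = (d *: u h : L) (delta 0) g by rewrite ud.
rewrite !vN_opZ !can_unitary_delta0 !ell2ZE !delta_coefE eqxx mulr1.
by have [->|_] := eqVneq g h; rewrite ?mulr1 ?mulr0// => /eqP; rewrite (negPf c0).
Qed.

(** Stands in for trace preservation: a(u h)^* a(u h) = a(1) = 1 fixes the 2-norm. *)
Lemma star_aut_unit_norm (a : star_aut A) h : nrm (a (u h) (delta 0)) = 1.
Proof.
have [y uy] := vN_adjoint (u h).
have auy : is_star (a (u h)) (a y) by have [_ _ _ /(_ (u h) y) [H _]] := star_autP a; exact: H.
have yu : y * u h = 1.
  apply: vN_delta0_inj; rewrite vN_op1 vN_opM can_unitary_delta0.
  apply: ell2_ext => g; apply: (can_inj conjCK); rewrite -!inner_deltal -uy.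
  rewrite -[u h (delta g)]/(twisted_shift nu h (delta g)) twisted_shift_delta.
  rewrite innerZl !inner_deltal !delta_coefE.
  rewrite (_ : (h + g == h) = (g == 0)); last by rewrite -subr_eq0 addrAC subrr add0r.
  by have [->|_] := eqVneq g 0; rewrite ?cocycleg0 ?mul1r// conjC0 mulr0.
have := inner_nrm (a (u h) (delta 0)); rewrite auy -vN_opM -star_autM yu star_aut1.
rewrite vN_op1 inner_deltal delta_coefE eqxx conjC1 => -[n2].
by apply/eqP; rewrite -(@eqrXn2 _ 2) ?nrm_ge0// expr1n -n2.
Qed.

End star_automorphisms.

(** * Automorphisms commuting with the twisted Bernoulli action *)

Section plane.
Implicit Types (k m v : Z2).

Definition vec2 (a b : int) : Z2 := \col_(i < 2) (if i == 0 then a else b).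
Lemma vec2E0 a b : vec2 a b 0 0 = a. Proof. by rewrite mxE. Qed.
Lemma vec2E1 a b : vec2 a b 1 0 = b. Proof. by rewrite mxE. Qed.

Lemma I2P (i : 'I_2) : i = 0 \/ i = 1.
Proof. by case: i => -[|[|//]] ?; [left | right]; exact: val_inj. Qed.

Lemma Z2P k m : k 0 0 = m 0 0 -> k 1 0 = m 1 0 -> k = m.
Proof.
by move=> k0 k1; apply/matrixP => i j; rewrite [j]ord1; case: (I2P i) => ->.
Qed.

Lemma vec2_eta k : k = vec2 (k 0 0) (k 1 0).
Proof. by apply: Z2P; rewrite ?vec2E0 ?vec2E1. Qed.

Lemma mx2E (M : 'M[int]_2) v i : (M *m v) i 0 = M i 0 * v 0 0 + M i 1 * v 1 0.
Proof.
rewrite mxE !big_ord_recl big_ord0 addr0; congr (_ + M i _ * v _ _); exact: val_inj.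
Qed.

Lemma det_mx2 (M : 'M[int]_2) : \det M = M 0 0 * M 1 1 - M 0 1 * M 1 0.
Proof.
rewrite (expand_det_row _ 0) !big_ord_recl big_ord0 addr0.
rewrite /cofactor !det_mx11 !mxE /= expr0 mul1r /bump /= expr1 mulN1r mulrN.
have -> : lift ord0 ord0 = 1 :> 'I_2 by apply: val_inj.
by have -> : lift 1 0 = 0 :> 'I_2 by apply: val_inj.
Qed.

Definition mx2 (a b c d : int) : 'M[int]_2 := \matrix_(i < 2, j < 2)
  (if i == 0 then if j == 0 then a else b else if j == 0 then c else d).

Fact SL2_of_subproof a b c d : a * d - b * c = 1 -> \det (mx2 a b c d) == 1.
Proof. by move=> h; rewrite det_mx2 !mxE /= h. Qed.
Definition SL2_of a b c d h : SL2 := Sub (mx2 a b c d) (@SL2_of_subproof a b c d h).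

Lemma SL2_of_vec2 a b c d h p q :
  val (@SL2_of a b c d h) *m vec2 p q = vec2 (a * p + b * q) (c * p + d * q).
Proof. by apply: Z2P; rewrite mx2E !mxE. Qed.

Definition e1 := vec2 1 0.
Definition e2 := vec2 0 1.
Definition e12 := vec2 1 1.

Fact rot_subproof : (0 : int) * 0 - (-1) * 1 = 1. Proof. by []. Qed.
Fact rot3_subproof : (0 : int) * 0 - 1 * (-1) = 1. Proof. by []. Qed.
Fact half_subproof : (-1 : int) * (-1) - 0 * 0 = 1. Proof. by []. Qed.
Fact lower_subproof : (1 : int) * 1 - 0 * 1 = 1. Proof. by []. Qed.
Fact upper_subproof (n : int) : (1 : int) * 1 - n * 0 = 1. Proof. by rewrite mulr0 subr0. Qed.

Definition g_rot : SL2 := SL2_of rot_subproof.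
Definition g_low : SL2 := SL2_of lower_subproof.
Definition g_upp (n : int) : SL2 := SL2_of (upper_subproof n).

Lemma Z2SL2_act0 (g : SL2) v : Z2SL2_act (0, g) v = val g *m v.
Proof. by rewrite /Z2SL2_act add0r. Qed.
Lemma Z2SL2_actT k v : Z2SL2_act (k, 1%g) v = k + v.
Proof. by rewrite /Z2SL2_act mul1mx. Qed.
Lemma Z2SL2_actK (g : Z2SL2) : cancel (Z2SL2_act g) (Z2SL2_act g^-1%g).
Proof. by move=> v; rewrite -Z2SL2_actM mulVg Z2SL2_actT add0r. Qed.
Lemma Z2SL2_actVK (g : Z2SL2) : cancel (Z2SL2_act g^-1%g) (Z2SL2_act g).
Proof. by move=> v; rewrite -Z2SL2_actM mulgV Z2SL2_actT add0r. Qed.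
End plane.

(** * Dipoles generate Lambda(H) *)

Section dipoles.
Context {H : zmodType}.
Implicit Types (l : Lambda H) (h : H) (k m v : Z2).

Lemma Lambda_ext l l' : (forall m, l m = l' m) -> l = l'.
Proof. by move=> ll; apply: val_inj; apply/funext. Qed.
Lemma LambdaDE l l' m : (l + l' : Lambda H) m = l m + l' m. Proof. by []. Qed.
Lemma LambdaNE l m : (- l : Lambda H) m = - l m. Proof. by []. Qed.
Lemma Lambda0E m : (0 : Lambda H) m = 0. Proof. by []. Qed.
Lemma Lambda_sumE (J : Type) (s : seq J) (F : J -> Lambda H) m :
  (\sum_(j <- s) F j : Lambda H) m = \sum_(j <- s) F j m.
Proof. by elim: s => [|j s IH]; rewrite ?big_nil// !big_cons LambdaDE IH. Qed.
Lemma Lambda_actE g l m : Lambda_act g l m = l (Z2SL2_act g^-1%g m). Proof. by []. Qed.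

Lemma sum_single (s : {fset Z2}) k h : k \in s ->
  \sum_(m <- s) (if m == k then h else 0) = h.
Proof.
move=> ks; rewrite (big_fsetD1 k)//= eqxx big_seq big1 ?addr0// => m.
by rewrite !inE => /andP[/negPf -> _].
Qed.

Fact dipole_subproof h k k' :
  (fun m => (if m == k' then h else 0) - (if m == k then h else 0))
    \in @zero_sum_finsupp H.
Proof.
apply/zero_sumP; exists [fset k; k']%fset => [m|].
  by rewrite !inE negb_or => /andP[/negPf -> /negPf ->]; rewrite subrr.
by rewrite sumrB !sum_single ?subrr// !inE eqxx ?orbT.
Qed.
Definition dipole h k k' : Lambda H :=
  Sub (fun m => (if m == k' then h else 0) - (if m == k then h else 0))
    (dipole_subproof h k k').

Lemma dipoleE h k k' m :
  dipole h k k' m = (if m == k' then h else 0) - (if m == k then h else 0).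
Proof. by []. Qed.

Lemma dipole_act g h k k' :
  Lambda_act g (dipole h k k') = dipole h (Z2SL2_act g k) (Z2SL2_act g k').
Proof.
by apply: Lambda_ext => m; rewrite Lambda_actE !dipoleE !(can2_eq (Z2SL2_actVK g) (Z2SL2_actK g)).
Qed.

Lemma dipole_cat h k v m : dipole h k v + dipole h v m = dipole h k m.
Proof. by apply: Lambda_ext => p; rewrite LambdaDE !dipoleE addrC subrKA. Qed.

Lemma dipoleD h h' k m : dipole (h + h') k m = dipole h k m + dipole h' k m.
Proof.
apply: Lambda_ext => p; rewrite LambdaDE !dipoleE.
by rewrite addrACA -opprD; congr (_ - _); case: ifP; rewrite ?addr0.
Qed.

Lemma dipolekk h k : dipole h k k = 0.
Proof. by apply: Lambda_ext => p; rewrite dipoleE subrr. Qed.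

Lemma dipole_head h k m : k != m -> dipole h k m m = h.
Proof. by rewrite dipoleE eqxx eq_sym => /negPf ->; rewrite subr0. Qed.

Lemma dipole_tail h k m : k != m -> dipole h k m k = - h.
Proof. by rewrite dipoleE eqxx => /negPf ->; rewrite sub0r. Qed.

Lemma dipole_off h k m p : p != k -> p != m -> dipole h k m p = 0.
Proof. by rewrite dipoleE => /negPf -> /negPf ->; rewrite subr0. Qed.

(** The zero sum leaves no freedom at one point; this is how two supporting lines meeting in a
    single point force a difference to vanish. *)
Lemma Lambda_point l p : (forall m, m != p -> l m = 0) -> l = 0.
Proof.
move=> lp; have := Lambda_sum0 l; rewrite (fsbigTE [fset p]%fset); last first.
  by move=> m; rewrite inE => /lp.
rewrite big_seq_fset1 => l0; apply: Lambda_ext => m; rewrite Lambda0E.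
by have [->|/lp] := eqVneq m p.
Qed.

Lemma Lambda_two_points l p q : p != q ->
  (forall m, m != p -> m != q -> l m = 0) -> l = dipole (l q) p q.
Proof.
move=> pq lpq; apply/eqP; rewrite -subr_eq0; apply/eqP; apply: (@Lambda_point _ p) => m mp.
rewrite LambdaDE LambdaNE; have [->|mq] := eqVneq m q.
  by rewrite dipole_head// subrr.
by rewrite lpq// dipole_off// subr0.
Qed.

Lemma Lambda_dipole_sum l : exists s : {fset Z2}, l = \sum_(k <- s) dipole (l k) 0 k.
Proof.
have [s sl] := Lambda_fset l; exists s; apply: Lambda_ext => m.
rewrite Lambda_sumE; under eq_bigr do rewrite dipoleE.
(* All tails sit at 0, where they add up to the total sum of l, which is zero. *)
rewrite sumrB [X in _ - X](_ : _ = 0) ?subr0; last first.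
  case: eqP => _; last by rewrite big1.
  by rewrite -(fsbigTE s) ?Lambda_sum0.
have [ms|ms] := boolP (m \in s); last first.
  rewrite sl// big_seq big1// => k ks; case: eqP => // mk.
  by move: ms; rewrite mk ks.
rewrite -[LHS](@sum_single s m) //; apply: eq_bigr => k _.
by rewrite eq_sym; case: eqP => [->|].
Qed.

(** The induction principle for multiplicative and equivariant statements: the images of the edge
    from 0 to e1 under the action include all unit steps of the lattice, and paths of unit steps
    give every dipole. *)
Lemma Lambda_gen (P : Lambda H -> Prop) : P 0 ->
  (forall l l', P l -> P l' -> P (l + l')) ->
  (forall g l, P l -> P (Lambda_act g l)) ->
  (forall h, P (dipole h 0 e1)) -> forall l, P l.
Proof.
move=> P0 PD Pact Pe1.
have Pg (g : SL2) h : P (dipole h 0 (val g *m e1)).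
  by have := Pact (0, g) _ (Pe1 h); rewrite dipole_act !Z2SL2_act0 mulmx0.
have Pn e : (forall h, P (dipole h 0 e)) -> forall n k h, P (dipole h k (k + e *+ n)).
  move=> Pe; elim=> [|n IH] k h; first by rewrite mulr0n addr0 dipolekk.
  rewrite mulrSr addrA -(dipole_cat _ _ (k + e *+ n)); apply: PD; first exact: IH.
  by have := Pact (k + e *+ n, 1%g) _ (Pe h); rewrite dipole_act !Z2SL2_actT addr0.
have Pz (e e' : Z2) : (forall h, P (dipole h 0 e)) -> (forall h, P (dipole h 0 e')) ->
    e' = - e -> forall (z : int) k h, P (dipole h k (k + z *: e)).
  move=> Pe Pe' ee; subst e'; case=> n k h; first by rewrite -[Posz n]natz scaler_nat; exact: Pn.
  by rewrite NegzE scaleNr -natz scaler_nat -mulNrn; exact: Pn.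
have Pv1 := Pz e1 (vec2 (-1) 0); have Pv2 := Pz e2 (vec2 0 (-1)).
have Pdip h k v : P (dipole h k (k + v)).
  have -> : v = v 0 0 *: e1 + v 1 0 *: e2.
    by apply: Z2P; rewrite !mxE /= ?mulr0 ?mulr1 ?addr0 ?add0r.
  rewrite addrA -(dipole_cat _ _ (k + v 0 0 *: e1)); apply: PD.
    apply: Pv1 => [//|h'|]; last by apply: Z2P; rewrite !mxE.
    have := Pg (SL2_of half_subproof) h'.
    by rewrite SL2_of_vec2 !mulr0 !mul0r !addr0 mulr1.
  apply: Pv2 => [h'|h'|]; last by apply: Z2P; rewrite !mxE.
    by have := Pg g_rot h'; rewrite SL2_of_vec2 !mulr0 !mul0r !addr0 mulr1.
  have := Pg (SL2_of rot3_subproof) h'.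
  by rewrite SL2_of_vec2 !mulr0 !mul0r !addr0 mulr1.
move=> l; have [s ->] := Lambda_dipole_sum l.
elim: (s : seq Z2) => [|k t IH]; first by rewrite big_nil.
by rewrite big_cons; apply: PD => //; have := Pdip (l k) 0 k; rewrite add0r.
Qed.

End dipoles.

(** * Rigidity of equivariant automorphisms *)

Section equivariant_automorphisms.
Context {R : realType} {H : zmodType} (mu : cocycle R H) (chi : character R H).
Local Notation N := (twisted_vN (tilde mu)).
Local Notation A := (range (twisted_shift (tilde mu))).
Local Notation nu := (tilde mu).
Local Notation u := (can_unitary (tilde mu)).
Local Notation c := (bernoulli_coef chi).
Local Notation E := (ell2 R (Lambda H)).
Implicit Types (g : Z2SL2) (k : Z2) (l : Lambda H) (h : H) (x y z : N).

Lemma unit_neq0 (a : R[i]) : `|a| = 1 -> a != 0.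
Proof. by move=> a1; rewrite -normr_eq0 a1 oner_eq0. Qed.

Lemma tilde_neq0 l l' : nu l l' != 0. Proof. exact/unit_neq0/cocycle_norm. Qed.
Lemma mu_neq0 h h' : mu h h' != 0. Proof. exact/unit_neq0/cocycle_norm. Qed.
Lemma chi_neq0 h : chi h != 0. Proof. exact/unit_neq0/character_norm. Qed.
Lemma coef_neq0 k l : c k l != 0. Proof. exact/unit_neq0/bernoulli_coef_norm. Qed.

Lemma twisted_bernoulli_unitary beta g l : is_twisted_bernoulli chi beta ->
  beta g (u l) = c g.1 (Lambda_act g l) *: u (Lambda_act g l).
Proof.
move=> [bM _ bS bZ]; case: g => k a.
have ka : ((k, a) : Z2SL2) = (((k, 1%g) : Z2SL2) * ((0, a) : Z2SL2))%g.
  by rewrite -[RHS]/(Z2SL2_act (k, 1%g) 0, (1 * a)%g) Z2SL2_actT addr0 mul1g.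
have bE : beta (k, a) (u l) = beta (k, 1%g) (beta (0, a) (u l)).
  by rewrite ka bM.
have LM : Lambda_act (k, a) l = Lambda_act (k, 1%g) (Lambda_act (0, a) l).
  by rewrite ka Lambda_actM.
have cE : c (k, a).1 (Lambda_act (k, a) l) = c k (Lambda_act (0, a) l).
  by rewrite LM bernoulli_coef_act -[(_ ^-1)%g]/((1 : SL2)^-1)%g invg1 mul1mx.
by rewrite cE bE bS bZ LM.
Qed.

(** Allows the spatially implemented action [bernoulli] to replace an arbitrary beta everywhere. *)
Lemma twisted_bernoulli_uniq beta : is_twisted_bernoulli chi beta ->
  beta = bernoulli mu chi.
Proof.
move=> bP; apply/funext => g; apply: star_aut_ext => l.
rewrite (twisted_bernoulli_unitary _ _ bP).
by rewrite (twisted_bernoulli_unitary _ _ (bernoulliP mu chi)).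
Qed.

Lemma bernoulli_coef_fun g x l :
  bernoulli mu chi g x (delta 0) l = c g.1 l * x (delta 0) (Lambda_act g^-1%g l).
Proof.
have -> : bernoulli mu chi g x (delta 0) = bernoulli_unitary chi g (x (delta 0)).
  rewrite -[LHS]/(bernoulli_unitary chi g (x (bernoulli_unitary chi g^-1%g (delta 0)))).
  by rewrite bernoulli_unitary_delta0.
exact: bernoulli_unitaryE.
Qed.

Lemma ell2_level_finite (I : choiceType) (v : ell2 R I) (a : R[i]) : a != 0 ->
  finite_set [set i | v i = a].
Proof.
move=> a0; apply: contrapT => inf.
have n0 : 0 < normc a ^+ 2.
  rewrite exprn_gt0// lt0r normc_ge0 andbT; apply: contra_neq a0; exact: eq0_normc.
pose n := Num.bound (nrm v ^+ 2 / normc a ^+ 2).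
have [s sv ns] := infinite_set_fset n inf.
have := sum_sqr_le_nrm v s.
rewrite big_seq (eq_bigr (fun=> normc a ^+ 2)); last by move=> i /sv ->.
rewrite -big_seq big_const_seq count_predT iter_addr_0 -[leLHS]mulr_natl -ler_pdivlMr//.
rewrite leNgt => /negP; apply; apply: lt_le_trans (archi_boundP _) _.
  by rewrite divr_ge0 ?sqr_ge0.
by rewrite ler_nat.
Qed.

(** The coefficients of x are constant along the orbit of l under these unipotents, and a nonzero
    value is taken finitely often. A support point m off the axis would move through infinitely many
    points of a finite union of finite supports. *)
Lemma upper_fixed_support x l :
  (forall n : nat, bernoulli mu chi (0, g_upp n%:Z) x = x) ->
  x (delta 0) l != 0 -> forall m : Z2, m 1 0 != 0 -> l m = 0.
Proof.
move=> xfix xl m m1; apply/eqP/negP => /negP lm.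
pose ln (n : nat) := Lambda_act (0, g_upp n%:Z) l.
have xln n : x (delta 0) (ln n) = x (delta 0) l.
  rewrite -[x in LHS](xfix n) bernoulli_coef_fun Lambda_actK.
  have [s sl] := Lambda_fset (ln n).
  by rewrite (bernoulli_coefE _ _ sl) big1 ?mul1r// => p _; rewrite /det2 !mxE !mul0r subrr expr0z.
have fin := ell2_level_finite (x (delta 0)) xl.
pose T : set Z2 := \bigcup_(l' in [set l' | x (delta 0) l' = x (delta 0) l])
    [set k | (l' : Lambda H) k != 0].
have Tfin : finite_set T.
  by apply: bigcup_finite => // l' _; have /asboolP[] := valP l'.
pose f (n : nat) := val (g_upp n%:Z) *m m.
apply: infinite_nat; apply: (@sub_finite_set _ _ (f @^-1` T)) => [n _|].
  exists (ln n); first exact: xln.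
  by rewrite /= /f -Z2SL2_act0 /ln Lambda_actE Z2SL2_actK.
apply: (@finite_preimage _ _ _ f) Tfin => p q _ _.
rewrite /f (vec2_eta m) !SL2_of_vec2 => /(congr1 (fun v : Z2 => v 0 0)).
by rewrite !vec2E0 !mul1r => /addrI/(mulIf m1) [].
Qed.

Local Notation b0 := (fun h => dipole h 0 e1).
Local Notation g1 := ((e1, g_rot) : Z2SL2).
Local Notation g2 := ((0, g_low) : Z2SL2).

Lemma g_upp_e1 n : val (g_upp n) *m e1 = e1.
Proof. by rewrite SL2_of_vec2 !mulr0 !mulr1 !addr0. Qed.
Lemma g_rot_vec2 p q : val g_rot *m vec2 p q = vec2 (- q) p.
Proof. by rewrite SL2_of_vec2 !mul0r mulN1r mul1r add0r addr0. Qed.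
Lemma g_low_vec2 p q : val g_low *m vec2 p q = vec2 p (p + q).
Proof. by rewrite SL2_of_vec2 !mul0r !mul1r addr0. Qed.
Lemma g1_vec2 p q : Z2SL2_act g1 (vec2 p q) = vec2 (1 - q) p.
Proof.
by rewrite /Z2SL2_act /= g_rot_vec2; apply: Z2P; rewrite !mxE//= add0r.
Qed.
Lemma vec20 : vec2 0 0 = 0. Proof. by apply: Z2P; rewrite !mxE. Qed.

Lemma g1_dipole h : Lambda_act g1 (b0 h) = dipole h e1 e12.
Proof. by rewrite dipole_act -vec20 !g1_vec2 subr0. Qed.
Lemma g2_dipole h : Lambda_act g2 (b0 h) = dipole h 0 e12.
Proof. by rewrite dipole_act !Z2SL2_act0 mulmx0 g_low_vec2 addr0. Qed.

Lemma e1_neq0 : 0 != e1.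
Proof. by apply/eqP => /(congr1 (fun v : Z2 => v 0 0)); rewrite !mxE. Qed.
Lemma e12_neq0 : 0 != e12.
Proof. by apply/eqP => /(congr1 (fun v : Z2 => v 0 0)); rewrite !mxE. Qed.
Lemma e12_neq1 : e1 != e12.
Proof. by apply/eqP => /(congr1 (fun v : Z2 => v 1 0)); rewrite !mxE. Qed.

Lemma coef_twist_eq0 x l l' : x (delta 0) (l' - l) = 0 -> x (delta l) l' = 0.
Proof. by rewrite (op_delta0 _ (vN_right_shiftC x l)) => ->; rewrite mulr0. Qed.

Lemma coef_twist_neq0 x l l' : x (delta 0) (l' - l) != 0 -> x (delta l) l' != 0.
Proof.
rewrite (op_delta0 _ (vN_right_shiftC x l)) mulf_eq0 negb_or => ->.
by rewrite tilde_neq0.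
Qed.

(* With the supports of x, y, z in Lambda(Z e1), Lambda(e1 + Z e2) and
   Lambda(Z (e1 + e2)), there is no cancellation in the product x y. *)
Lemma dipole_rigidity x (s : R[i]) : nrm (x (delta 0)) = 1 ->
  (forall n : nat, bernoulli mu chi (0, g_upp n%:Z) x = x) ->
  x * bernoulli mu chi g1 x = s *: bernoulli mu chi g2 x ->
  exists h, exists2 a : R[i], `|a| = 1 & x = a *: u (b0 h).
Proof.
move=> x1 xfix; set y := bernoulli _ _ g1 x; set z := bernoulli _ _ g2 x => xyz.
have xsupp l : x (delta 0) l != 0 -> forall p q, q != 0 -> l (vec2 p q) = 0.
  by move=> xl p q q0; apply: (upper_fixed_support xfix xl); rewrite vec2E1.
have ysupp l : y (delta 0) l != 0 -> forall p q, p != 1 -> l (vec2 p q) = 0.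
  rewrite bernoulli_coef_fun mulf_eq0 negb_or => /andP[_ xl] p q p1.
  have := @xsupp _ xl q (1 - p); rewrite Lambda_actE invgK g1_vec2 subKr; apply.
  by rewrite subr_eq0 eq_sym.
have zsupp l : z (delta 0) l != 0 -> forall p q, p != q -> l (vec2 p q) = 0.
  rewrite bernoulli_coef_fun mulf_eq0 negb_or => /andP[_ xl] p q pq.
  have := @xsupp _ xl p (q - p); rewrite Lambda_actE invgK Z2SL2_act0 g_low_vec2 subrKC; apply.
  by rewrite subr_eq0 eq_sym.
have nz w : nrm (w : E) = 1 -> exists l, w l != 0.
  move=> w1; apply: contrapT => /forallNP w0.
  have : w = 0 by apply: ell2_ext => l; apply/eqP/negP => /negP; exact: w0.
  by move=> w00; move: w1; rewrite w00 nrm0 => /eqP; rewrite eq_sym oner_eq0.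
(* One element l2 of the support of y is fixed; it will determine every l in the support of x, which
   is therefore a single point. *)
have [l1 xl1] := nz _ x1.
have yl : y (delta 0) (Lambda_act g1 l1) != 0.
  by rewrite bernoulli_coef_fun Lambda_actK mulf_neq0// coef_neq0.
set l2 := Lambda_act g1 l1 in yl.
have xb l : x (delta 0) l != 0 -> l = b0 (- l2 e1).
  move=> xl.
  have zl : z (delta 0) (l + l2) != 0.
    have : (x * y : N) (delta 0) (l + l2) != 0.
      rewrite vN_opM (@op_coef_single _ _ _ _ _ l2 (vN_bounded x)).
        by rewrite mulf_neq0// coef_twist_neq0// addrK.
      (* If another k in the support of y contributed, l2 - k would live both on the axis and on the
         vertical line through e1, hence at e1 alone, and so be zero. *)
      move=> k kl2 yk; apply: coef_twist_eq0; apply/eqP/negP => /negP xk.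
      move/eqP: kl2; apply; apply/esym/eqP; rewrite -subr_eq0; apply/eqP.
      apply: (@Lambda_point _ _ e1) => m me1; rewrite (vec2_eta m).
      have [q0|q0] := eqVneq (m 1 0) 0; last first.
        have := xsupp _ xk (m 0 0) _ q0; rewrite !(LambdaDE, LambdaNE).
        by rewrite (xsupp _ xl)// add0r.
      have p1 : m 0 0 != 1.
        by apply: contra_neq me1 => p1; rewrite (vec2_eta m) p1 q0.
      by rewrite LambdaDE LambdaNE (ysupp _ yl)// (ysupp _ yk)// subrr.
    by rewrite xyz vN_opZ ell2ZE mulf_eq0 negb_or => /andP[].
  (* The point e1 is off the diagonal, which carries every element of the support of z. *)
  have le1 : l e1 = - l2 e1.
    apply/eqP; rewrite -addr_eq0 -LambdaDE; apply/eqP.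
    exact: (zsupp _ zl).
  rewrite -le1; apply: Lambda_two_points; first exact: e1_neq0.
  move=> m m0 me1; rewrite (vec2_eta m).
  have [q0|q0] := eqVneq (m 1 0) 0; last exact: xsupp.
  have p1 : m 0 0 != 1.
    by apply: contra_neq me1 => p1; rewrite (vec2_eta m) p1 q0.
  have p0 : m 0 0 != 0.
    by apply: contra_neq m0 => p0; rewrite (vec2_eta m) p0 q0 vec20.
  have := zsupp _ zl _ _ p0; rewrite LambdaDE (ysupp _ yl)// addr0 q0.
  exact.
exists (- l2 e1); set l0 := b0 (- l2 e1) in xb *.
have xE : x = x (delta 0) l0 *: u l0.
  apply: vN_delta0_inj; rewrite vN_opZ can_unitary_delta0; apply: ell2_ext => l.
  rewrite ell2ZE delta_coefE; have [->|ll0] := eqVneq l l0; first by rewrite mulr1.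
  by rewrite mulr0; apply/eqP/negP => /negP /xb; exact/eqP.
exists (x (delta 0) l0) => //.
have := x1; rewrite {1}xE vN_opZ can_unitary_delta0 nrmZ.
have := star_aut_unit_norm (1%g : star_aut A) l0.
rewrite -[(1%g : star_aut A) (u l0)]/(u l0) can_unitary_delta0 => ->.
by rewrite mulr1 normc_normE => ->.
Qed.

Lemma bernoulli_coef_dipole k h p q : p != q ->
  c k (dipole h p q) = chi h ^ det2 k q * (chi h ^ det2 k p)^-1.
Proof.
move=> pq; rewrite (@bernoulli_coefE _ _ _ _ _ [fset q; p]%fset); last first.
  by move=> m; rewrite !inE negb_or => /andP[mq mp]; rewrite dipole_off.
rewrite big_fsetU1/=; last by rewrite inE eq_sym.
rewrite big_seq_fset1 dipole_head// dipole_tail//; congr (_ * _).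
have -> : chi (- h) = (chi h)^-1.
  apply: (mulfI (chi_neq0 h)); rewrite -characterD subrr character0 mulfV//.
  exact: chi_neq0.
by rewrite exprz_inv invr_expz.
Qed.

(** Consecutive dipoles overlap in the middle point only, with values h and - h'; this is how mu
    enters the scalars. *)
Lemma tilde_dipole h h' p q v : p != q -> q != v -> p != v ->
  nu (dipole h p q) (dipole h' q v) = mu h (- h').
Proof.
move=> pq qv pv; rewrite /= (@cocycle_prodE _ _ _ _ _ [fset q]%fset).
  by rewrite big_seq_fset1 dipole_head// dipole_tail.
move=> m; rewrite inE => mq; have [->|mp] := eqVneq m p.
  by right; rewrite dipole_off.
by left; rewrite dipole_off.
Qed.

Lemma tilde_dipoleC h h' p q v : p != q -> q != v -> p != v ->
  nu (dipole h' q v) (dipole h p q) = mu (- h') h.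
Proof.
move=> pq qv pv; rewrite /= (@cocycle_prodE _ _ _ _ _ [fset q]%fset).
  by rewrite big_seq_fset1 dipole_head// dipole_tail.
move=> m; rewrite inE => mq; have [->|mp] := eqVneq m p.
  by left; rewrite dipole_off.
by right; rewrite dipole_off.
Qed.

Variable a : star_aut A.
Hypothesis aE : forall g x, a (bernoulli mu chi g x) = bernoulli mu chi g (a x).

Lemma bernoulli_u g l :
  bernoulli mu chi g (u l) = c g.1 (Lambda_act g l) *: u (Lambda_act g l).
Proof. exact: twisted_bernoulli_unitary (bernoulliP mu chi). Qed.

Lemma u_bernoulli g l :
  u (Lambda_act g l) = (c g.1 (Lambda_act g l))^-1 *: bernoulli mu chi g (u l).
Proof. by rewrite bernoulli_u scalerA mulVf ?coef_neq0// scale1r. Qed.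

(** g1 and g2 carry the edge from 0 to e1 to the other two sides of the triangle, so
    multiplicativity of u along the triangle becomes, after applying a, the hypothesis of
    [dipole_rigidity]. *)
Lemma aut_dipole h : exists h', exists2 z : R[i], `|z| = 1 & a (u (b0 h)) = z *: u (b0 h').
Proof.
set x := a (u (b0 h)).
pose s1 := c g1.1 (Lambda_act g1 (b0 h)); pose s2 := c g2.1 (Lambda_act g2 (b0 h)).
apply: (@dipole_rigidity x (s1 * (nu (b0 h) (dipole h e1 e12) * s2^-1))).
- exact: star_aut_unit_norm.
- move=> n; rewrite -aE bernoulli_u /= dipole_act !Z2SL2_act0 mulmx0 g_upp_e1.
  rewrite bernoulli_coef_dipole ?e1_neq0// /det2 !mxE !mul0r subrr expr0z.
  by rewrite invr1 mulr1 scale1r.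
rewrite -!aE -star_autM bernoulli_u -star_autZ; congr (a _).
rewrite -/s1 g1_dipole vN_mulZr can_unitaryM dipole_cat -g2_dipole u_bernoulli -/s2.
by rewrite !scalerA mulrA.
Qed.

Local Notation g3 := ((0, g_rot) : Z2SL2).
Local Notation g4 := ((e2, 1%g) : Z2SL2).

(** With [aut_add] it keeps exact scalars, which later match [fphi_act] and [fphiD] term by term. *)
Lemma aut_act g l l' (z : R[i]) : a (u l) = z *: u l' ->
  a (u (Lambda_act g l)) = (z * c g.1 (Lambda_act g l') / c g.1 (Lambda_act g l)) *:
    u (Lambda_act g l').
Proof.
move=> al; rewrite u_bernoulli star_autZ aE al star_autZ bernoulli_u !scalerA.
by congr (_ *: _); rewrite -mulrA mulrC.
Qed.

Lemma aut_add l m l' m' (z w : R[i]) : a (u l) = z *: u l' -> a (u m) = w *: u m' ->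
  a (u (l + m)) = (z * w * nu l' m' / nu l m) *: u (l' + m').
Proof.
move=> al am.
have -> : u (l + m) = (nu l m)^-1 *: (u l * u m).
  by rewrite can_unitaryM scalerA mulVf ?tilde_neq0// scale1r.
rewrite star_autZ star_autM al am vN_mulZl vN_mulZr can_unitaryM !scalerA.
by congr (_ *: _); ring.
Qed.

Lemma dipole_inj h h' p q : p != q -> dipole h p q = dipole h' p q -> h = h'.
Proof. by move=> pq hh; rewrite -(dipole_head h pq) hh dipole_head. Qed.

Section dipole_map.
Variables (phi : H -> H) (f : H -> R[i]).
Hypothesis f1 : forall h, `|f h| = 1.
Hypothesis aphi : forall h, a (u (b0 h)) = f h *: u (b0 (phi h)).

Lemma dipole_map_add h h' : phi (h + h') = phi h + phi h'.
Proof.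
have := aut_add (aphi h) (aphi h'); rewrite -!dipoleD aphi.
case/can_unitary_inj; first exact/unit_neq0/f1.
by move=> /(dipole_inj e1_neq0).
Qed.

Lemma dipole_map0 : phi 0 = 0.
Proof. by apply: (addIr (phi 0)); rewrite -dipole_map_add !add0r. Qed.

Lemma dipole_mapN h : phi (- h) = - phi h.
Proof. by apply: (addIr (phi h)); rewrite -dipole_map_add !addNr dipole_map0. Qed.

Lemma dipole_map_zmod : zmod_morphism phi.
Proof. by move=> h h'; rewrite dipole_map_add dipole_mapN. Qed.

Lemma g3_dipole h : Lambda_act g3 (b0 h) = dipole h 0 e2.
Proof. by rewrite dipole_act !Z2SL2_act0 mulmx0 g_rot_vec2 oppr0. Qed.
Lemma g4_dipole h : Lambda_act g4 (b0 h) = dipole h e2 e12.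
Proof.
rewrite dipole_act !Z2SL2_actT addr0; congr (dipole h _ _).
by apply: Z2P; rewrite !mxE.
Qed.
Lemma e2_neq0 : 0 != e2.
Proof. by apply/eqP => /(congr1 (fun v : Z2 => v 1 0)); rewrite !mxE. Qed.
Lemma e12_neq2 : e2 != e12.
Proof. by apply/eqP => /(congr1 (fun v : Z2 => v 0 0)); rewrite !mxE. Qed.
Lemma coef0 l : c 0 l = 1.
Proof.
have [s sl] := Lambda_fset l.
by rewrite (bernoulli_coefE _ _ sl) big1// => m _; rewrite /det2 !mxE !mul0r subrr expr0z.
Qed.
Lemma coef_g1 h : c e1 (dipole h e1 e12) = chi h.
Proof.
rewrite bernoulli_coef_dipole ?e12_neq1// /det2 !mxE /=.
by rewrite !mul0r !mulr0 !subr0 expr0z invr1 mulr1 mul1r expr1z.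
Qed.
Lemma coef_g4 h : c e2 (dipole h e2 e12) = (chi h)^-1.
Proof.
rewrite bernoulli_coef_dipole ?e12_neq2// /det2 !mxE /=.
rewrite (_ : 0 * 1 - 1 * 1 = -1 :> int)// (_ : 0 * 1 - 1 * 0 = 0 :> int)//.
by rewrite expr0z invr1 mulr1 exprN1.
Qed.

Lemma solve_coef (x p q m n : R[i]) : x != 0 -> p != 0 -> q != 0 -> m != 0 -> n != 0 ->
  x = x * (x * p / q) * m / n -> x = n * q / (m * p).
Proof.
move=> x0 p0 q0 m0 n0 E.
have : x * (n * q) = x * (x * (m * p)) by rewrite {1}E; field; rewrite ?q0 ?n0.
by move=> /(mulfI x0) ->; rewrite mulfK// mulf_neq0.
Qed.

Lemma solve_ratio (s m n p q : R[i]) : s != 0 -> n != 0 -> p != 0 ->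
  s * m / n = s * p / q -> p^-1 * m = q^-1 * n.
Proof.
move=> s0 n0 p0; rewrite -!mulrA => /(mulfI s0) E.
apply: (mulIf (invr_neq0 n0)).
by rewrite -mulrA E mulKf// mulfK.
Qed.

(* The two formulas come from the two shortest paths from 0 to e1 + e2,
   through e1 and through e2. *)
Lemma dipole_map_coef h :
  f h = mu h (- h) * chi h / (mu (phi h) (- phi h) * chi (phi h)) /\
  f h = mu h (- h) * chi (phi h) / (mu (phi h) (- phi h) * chi h).
Proof.
have fz := unit_neq0 (f1 h).
have n1 := chi_neq0 h; have n2 := chi_neq0 (phi h).
have m1 := mu_neq0 h (- h); have m2 := mu_neq0 (phi h) (- phi h).
(* g2 has no translation part, so no value of chi appears on the diagonal edge. *)
have E2 : a (u (dipole h 0 e12)) = f h *: u (dipole (phi h) 0 e12).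
  by have := aut_act g2 (aphi h); rewrite !g2_dipole !coef0 invr1 !mulr1.
split.
  have := aut_act g1 (aphi h); rewrite !g1_dipole !coef_g1 => E1.
  have := aut_add (aphi h) E1; rewrite !dipole_cat E2 !tilde_dipole ?e1_neq0 ?e12_neq0 ?e12_neq1//.
  by case/(can_unitary_inj fz) => _ /(solve_coef fz n2 n1 m2 m1).
(* Path through e2: det(e2, e1 + e2) = -1 while det(e1, e1 + e2) = 1, so chi appears inverted. *)
have := aut_act g3 (aphi h); rewrite !g3_dipole !coef0 invr1 !mulr1 => E3.
have := aut_act g4 (aphi h); rewrite !g4_dipole !coef_g4 => E4.
have := aut_add E3 E4; rewrite !dipole_cat E2 !tilde_dipole ?e2_neq0 ?e12_neq0 ?e12_neq2//.
case/(can_unitary_inj fz) => _.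
move=> /(solve_coef fz (invr_neq0 n2) (invr_neq0 n1) m2 m1) ->.
by field; rewrite ?n1 ?n2 ?m1 ?m2.
Qed.

Lemma dipole_map_chi h : chi (phi h) ^+ 2 = chi h ^+ 2.
Proof.
have [-> ] := dipole_map_coef h.
have n1 := chi_neq0 h; have n2 := chi_neq0 (phi h).
have m1 := mu_neq0 h (- h); have m2 := mu_neq0 (phi h) (- phi h).
move=> E; apply: (mulfI m1); apply: (mulIf (invr_neq0 (mulf_neq0 (mulf_neq0 m2 n1) n2))).
transitivity (mu h (- h) * chi (phi h) / (mu (phi h) (- phi h) * chi h)).
  by field; rewrite ?n1 ?n2 ?m1 ?m2.
by rewrite -E; field; rewrite ?n1 ?n2 ?m1 ?m2.
Qed.

Lemma mu_conj h h' : (mu h h')^* = (mu h h')^-1.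
Proof.
apply: (mulfI (mu_neq0 h h')); rewrite mulfV ?mu_neq0//.
by rewrite -normCK cocycle_norm expr1n.
Qed.

Lemma dipole_map_mustarmu h h' : mustarmu mu (phi h) (phi h') = mustarmu mu h h'.
Proof.
(* Dipoles meeting at e1 carry h and - h' there, so h' is exchanged with its opposite. *)
rewrite -[h']opprK dipole_mapN; move: (- h') => {}h'.
have := aut_act g1 (aphi h'); rewrite !g1_dipole => E1.
(* The image of the unitary at the sum of the two dipoles is computed in both orders; comparing the
   scalars gives the commutator. *)
have E := aut_add (aphi h) E1; have := aut_add E1 (aphi h).
set w := _ * _ / _ in E1 E *.
have w0 : w != 0.
  apply: mulf_neq0; last by apply: invr_neq0; exact: coef_neq0.
  by apply: mulf_neq0; [exact/unit_neq0/f1 | exact: coef_neq0].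
have f0 := unit_neq0 (f1 h).
rewrite addrC E !tilde_dipoleC ?e1_neq0 ?e12_neq1 ?e12_neq0//.
rewrite !tilde_dipole ?e1_neq0 ?e12_neq1 ?e12_neq0// => /can_unitary_inj[|_ F].
  by rewrite mulf_neq0 ?invr_neq0 ?mu_neq0// mulf_neq0 ?mu_neq0// mulf_neq0.
rewrite /mustarmu !mu_conj; move: F; rewrite (mulrC w).
by apply: solve_ratio; rewrite ?mu_neq0// mulf_neq0.
Qed.

Definition comp_map (l : Lambda H) : Lambda H :=
  Sub (phi \o l) (Lambda_comp_subproof dipole_map_zmod l).

Lemma comp_map_dipole h p q : comp_map (dipole h p q) = dipole (phi h) p q.
Proof.
apply: Lambda_ext => m; rewrite -[LHS]/(phi (dipole h p q m)) !dipoleE.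
by rewrite dipole_map_zmod; do 2 case: ifP => _; rewrite ?dipole_map0.
Qed.

Lemma aut_comp_map l : exists2 z : R[i], `|z| = 1 & a (u l) = z *: u (comp_map l).
Proof.
move: l; apply: (@Lambda_gen H) => [|l l' [z z1 al] [z' z'1 al']|g l [z z1 al]|h].
- exists 1; first exact: normr1.
  rewrite scale1r (_ : comp_map 0 = 0) ?can_unitary0 ?star_aut1//.
  by apply: Lambda_ext => m; rewrite -[LHS]/(phi 0) dipole_map0.
- have -> : comp_map (l + l') = comp_map l + comp_map l'.
    by apply: Lambda_ext => m; exact: dipole_map_add.
  rewrite (aut_add al al'); eexists; last by [].
  by rewrite !normrM normfV z1 z'1 !cocycle_norm invr1 !mulr1.
- have -> : comp_map (Lambda_act g l) = Lambda_act g (comp_map l) by exact: Lambda_ext.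
  rewrite (aut_act g al); eexists; last by [].
  by rewrite !normrM normfV z1 !bernoulli_coef_norm invr1 !mulr1.
- by rewrite comp_map_dipole aphi; exists (f h).
Qed.

End dipole_map.

End equivariant_automorphisms.

(** * Automorphisms of N induced by automorphisms of H *)

Section spatial_automorphism.
Context {R : realType} {G : zmodType} (nu : cocycle R G).
Local Notation E := (ell2 R G).
Local Notation L := (twisted_vN nu).
Local Notation A := (range (twisted_shift nu)).
Variables (U U' : E -> E) (s s' : G -> G) (k : G -> R[i]).
Hypotheses (Ub : bounded_op U) (Ub' : bounded_op U').
Hypotheses (UK : cancel U U') (UK' : cancel U' U).
Hypothesis Ui : forall v w, inner (U v) (U w) = inner v w.
Hypotheses (k0 : forall h, k h != 0) (sK : cancel s' s).
Hypothesis Us : forall h v, U (right_shift nu h v) = k h *: right_shift nu (s h) (U v).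

Lemma spatial_inv_shift h v :
  U' (right_shift nu (s h) v) = (k h)^-1 *: right_shift nu h (U' v).
Proof.
have [Ul' _] := Ub'; rewrite -[v in LHS]UK'.
have -> : right_shift nu (s h) (U (U' v)) = (k h)^-1 *: U (right_shift nu h (U' v)).
  by rewrite Us scalerA mulVf ?k0// scale1r.
by rewrite (linear_limZ _ _ Ul') UK.
Qed.

Lemma spatial_comp_bounded (x : L) : bounded_op (U \o x \o U').
Proof. by apply: bounded_op_comp => //; apply: bounded_op_comp => //; exact: vN_bounded. Qed.

Lemma spatial_inv_comp_bounded (x : L) : bounded_op (U' \o x \o U).
Proof. by apply: bounded_op_comp => //; apply: bounded_op_comp => //; exact: vN_bounded. Qed.

Lemma vN_right_shift (x : L) h v : x (right_shift nu h v) = right_shift nu h (x v).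
Proof. exact: (congr1 (fun f => f v) (vN_right_shiftC x h)). Qed.

(** It is enough that U permutes the right shifts up to scalars: conjugation cancels the scalars and
    the relabelling s. *)
Lemma spatial_comm (x : L) h :
  (U \o x \o U') \o right_shift nu h = right_shift nu h \o (U \o x \o U').
Proof.
have [Ul _] := Ub; apply/funext => v /=; rewrite -(sK h) spatial_inv_shift.
by rewrite vN_opZr (linear_limZ _ _ Ul) vN_right_shift Us scalerA mulVf ?k0// scale1r.
Qed.

Lemma spatial_inv_comm (x : L) h :
  (U' \o x \o U) \o right_shift nu h = right_shift nu h \o (U' \o x \o U).
Proof.
have [Ul _] := Ub'; apply/funext => v /=; rewrite Us vN_opZr (linear_limZ _ _ Ul).
by rewrite vN_right_shift spatial_inv_shift scalerA mulfV ?k0// scale1r.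
Qed.

Definition spatial_fun (x : L) : L := vN_of (spatial_comp_bounded x) (spatial_comm x).
Definition spatial_inv (x : L) : L :=
  vN_of (spatial_inv_comp_bounded x) (spatial_inv_comm x).

Lemma spatial_funE x v : spatial_fun x v = U (x (U' v)). Proof. by []. Qed.
Lemma spatial_invE x v : spatial_inv x v = U' (x (U v)). Proof. by []. Qed.

Fact spatial_subproof : spatial_fun \in @is_star_automorphism R G A.
Proof.
have [Ul _] := Ub; apply/asboolP; split.
- exists spatial_inv => x; apply: vN_opP; apply/funext => v.
    by rewrite spatial_invE spatial_funE !UK.
  by rewrite spatial_funE spatial_invE !UK'.
- move=> c x y; apply: vN_opP; apply/funext => v.
  by rewrite spatial_funE !vN_opD !vN_opZ !spatial_funE Ul.
- split=> [|x y]; apply: vN_opP; apply/funext => v.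
    by rewrite spatial_funE !vN_op1 UK'.
  by rewrite !(vN_opM, spatial_funE) UK.
- move=> x y; split=> xy v w.
    transitivity (inner (U (x (U' v))) (U (U' w))); first by rewrite UK'.
    rewrite Ui [LHS]xy -[LHS]Ui UK'; reflexivity.
  have := xy (U v) (U w); rewrite !spatial_funE !UK !Ui; exact.
Qed.
Definition spatial_aut : star_aut A := Sub spatial_fun spatial_subproof.

End spatial_automorphism.

(** * The commutative extension defined by a symmetric cocycle *)

Section twisted_monoid.
Context {R : realType} {H : zmodType} (kap : H -> H -> R[i]).
Hypothesis kapP : forall g h k, kap g h * kap (g + h) k = kap h k * kap g (h + k).
Hypothesis kapC : forall g h, kap g h = kap h g.
Hypothesis kap0 : forall h, kap 0 h = 1.

(** The extension of H by scalars with cocycle [kap]. Symmetry makes it commutative, so products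
    over finite sets of lattice points need no order; all of R[i] is allowed, whence a monoid. *)
Definition twmul (p q : H * R[i]) : H * R[i] := (p.1 + q.1, p.2 * q.2 * kap p.1 q.1).
Fact twmulA : associative twmul.
Proof.
move=> [a x] [b y] [c z]; congr (_, _); rewrite /= ?addrA//.
transitivity (x * y * z * (kap a b * kap (a + b) c)); last by ring.
by rewrite kapP; ring.
Qed.
Fact twmulC : commutative twmul.
Proof. by move=> [a x] [b y]; congr (_, _); [exact: addrC | rewrite /= kapC (mulrC x)]. Qed.
Fact twmul1p : left_id (0, 1) twmul.
Proof. by move=> [a x]; rewrite /twmul /= add0r mul1r kap0 mulr1. Qed.

Definition twlaw : Monoid.com_law ((0, 1) : H * R[i]) :=
  HB.pack twmul (Monoid.isComLaw.Build _ _ twmul twmulA twmulC twmul1p).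

Definition twprod (s : seq Z2) (w : Z2 -> H * R[i]) := \big[twlaw/(0, 1)]_(m <- s) w m.

Lemma twprod_fst s w : (twprod s w).1 = \sum_(m <- s) (w m).1.
Proof. by rewrite /twprod (big_morph fst (op1 := +%R) (id1 := 0)). Qed.

Lemma twprod_mul s (w w' : Z2 -> H * R[i]) :
  twmul (twprod s w) (twprod s w') = twprod s (fun m => twmul (w m) (w' m)).
Proof. by symmetry; exact: (@big_split _ _ twlaw). Qed.

Lemma twprod_scalar s (f : Z2 -> R[i]) :
  twprod s (fun m => (0, f m)) = (0, \prod_(m <- s) f m).
Proof.
elim: s => [|m s IH]; first by rewrite /twprod !big_nil.
rewrite /twprod !big_cons -/(twprod _ _) IH.
by rewrite -[LHS]/(0 + 0, _ * _ * kap 0 0) kap0 mulr1 addr0.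
Qed.

Lemma kapr0 h : kap h 0 = 1. Proof. by rewrite kapC kap0. Qed.

Lemma twmul_scalar (a : H) (x y : R[i]) : twmul (a, x) (0, y) = (a, x * y).
Proof. by rewrite /twmul /= addr0 kapr0 mulr1. Qed.

Lemma twprod_mulscalar s (w : Z2 -> H * R[i]) (f : Z2 -> R[i]) :
  twprod s (fun m => ((w m).1, (w m).2 * f m)) =
  ((twprod s w).1, (twprod s w).2 * \prod_(m <- s) f m).
Proof.
rewrite [RHS](_ : _ = twmul (twprod s w) (0, \prod_(m <- s) f m)).
  rewrite -twprod_scalar twprod_mul; apply: eq_bigr => m _.
  by case: (w m) => a x; rewrite twmul_scalar.
by case: (twprod s w) => a x; rewrite twmul_scalar.
Qed.

Lemma twprod_norm s (w : Z2 -> H * R[i]) : (forall g h, `|kap g h| = 1) ->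
  (forall m, `|(w m).2| = 1) -> `|(twprod s w).2| = 1.
Proof.
move=> k1 w1; elim: s => [|m s IH]; first by rewrite /twprod big_nil normr1.
rewrite /twprod big_cons -/(twprod _ _) -[X in `|X|]/(_ * _ * kap _ _).
by rewrite !normrM w1 IH k1 !mulr1.
Qed.

End twisted_monoid.

(** * A quadratic form modulo 2 *)

Section quadratic_form.
Implicit Types (k m v : Z2).

(* The Arf form of (Z/2)^2: invariant under SL(2,Z) modulo 2, with polarization
   det2 modulo 2. *)
Definition qform m : int := m 0 0 * m 0 0 + m 0 0 * m 1 0 + m 1 0 * m 1 0.

Lemma qform_e1 : qform e1 = 1. Proof. by rewrite /qform !mxE. Qed.
Lemma qform0 : qform 0 = 0. Proof. by rewrite /qform !mxE. Qed.

Lemma int_parity (x : int) : exists y, x = 2 * y \/ x = 2 * y + 1.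
Proof.
have h2 : (0 : int) < 2 by []. have h20 : (2 : int) != 0 by [].
exists (x %/ 2)%Z; have := divz_eq x 2; have := ltz_pmod x h2.
by have := modz_ge0 x h20; lia.
Qed.

Lemma qformD k v : exists t, qform (k + v) = qform k + qform v + det2 k v + 2 * t.
Proof.
exists (k 0 0 * v 0 0 + k 1 0 * v 1 0 + k 1 0 * v 0 0).
by rewrite /qform /det2 !mxE; ring.
Qed.

(** The entries a and c cannot both be even, and the form is odd at every vector that is nonzero
    modulo 2. *)
Lemma qform_col (a b c d : int) : a * d - b * c = 1 ->
  exists t, a * a + a * c + c * c = 1 + 2 * t.
Proof.
move=> det; have [a' aE] := int_parity a; have [c' cE] := int_parity c.
case: aE => Ea; case: cE => Ec; rewrite ?Ea ?Ec.
- have : 2 * (a' * d - b * c') = 1.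
    by transitivity (a * d - b * c); [rewrite Ea Ec; ring | exact: det].
  lia.
- by exists (2 * a' * a' + 2 * a' * c' + a' + 2 * c' * c' + 2 * c'); ring.
- by exists (2 * c' * c' + 2 * a' * c' + c' + 2 * a' * a' + 2 * a'); ring.
- by exists (2 * a' * a' + 2 * a' + 2 * a' * c' + a' + c' + 2 * c' * c' + 2 * c' + 1); ring.
Qed.

Lemma qform_SL2 (g : SL2) m : exists t, qform (val g *m m) = qform m + 2 * t.
Proof.
have det := eqP (valP g); rewrite det_mx2 in det.
set M := val g in det *; move: det.
set a := M 0 0; set b := M 0 1; set c := M 1 0; set d := M 1 1 => det.
have [t1 t1E] := qform_col det.
(* Exchanging the columns and negating the lower row keeps determinant 1; the sign changes the value
   of the form by 2 b d, which t2 absorbs. *)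
have det' : b * (- c) - a * (- d) = 1 by rewrite -det; ring.
have [t2 t2E] := @qform_col b a (- d) (- c) ltac:(rewrite -det; ring).
have {}t2E : b * b + b * d + d * d = 1 + 2 * (t2 + b * d) by rewrite mulrDr addrA -t2E; ring.
exists (t1 * (m 0 0 * m 0 0) + (a * b + c * d + b * c) * (m 0 0 * m 1 0) +
  (t2 + b * d) * (m 1 0 * m 1 0)).
rewrite /qform !mx2E -/a -/b -/c -/d.
transitivity ((a * a + a * c + c * c) * (m 0 0 * m 0 0) +
  (2 * a * b + (a * d - b * c) + 2 * b * c + 2 * c * d) * (m 0 0 * m 1 0) +
  (b * b + b * d + d * d) * (m 1 0 * m 1 0)); first by ring.
by rewrite t1E t2E det; ring.
Qed.

(** Read as exponents of rho: the det term is the coefficient of the action, the constant qform g.1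
    disappears because l has zero sum, and the even term because rho^2 = 1. *)
Lemma qform_act (g : Z2SL2) m : exists t,
  qform (Z2SL2_act g m) = qform g.1 + qform m + det2 g.1 (Z2SL2_act g m) + 2 * t.
Proof.
have [t1 E1] := qformD g.1 (val g.2 *m m); have [t2 E2] := qform_SL2 g.2 m.
exists (t1 + t2); rewrite /Z2SL2_act E1 E2.
have -> : det2 g.1 (g.1 + val g.2 *m m) = det2 g.1 (val g.2 *m m).
  by rewrite /det2 !mxE; ring.
by ring.
Qed.
End quadratic_form.
#[global] Opaque qform.

(** * The scalars attached to an automorphism of H *)

Section implementing_unitary.
Context {R : realType} {H : zmodType} {mu : cocycle R H} {chi : character R H}.
Local Notation nu := (tilde mu).
Local Notation c := (bernoulli_coef chi).
Local Notation E := (ell2 R (Lambda H)).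
Implicit Types (g : Z2SL2) (k : Z2) (l : Lambda H) (h : H).
Variable phi : autH mu chi.

Lemma autHB h h' : phi (h - h') = phi h - phi h'.
Proof. exact: autH_zmod_morphism. Qed.
Lemma autH0 : phi 0 = 0. Proof. by rewrite -{1}(subrr 0) autHB subrr. Qed.
Lemma autHN h : phi (- h) = - phi h. Proof. by rewrite -sub0r autHB autH0 sub0r. Qed.
Lemma autHD h h' : phi (h + h') = phi h + phi h'.
Proof. by rewrite -{1}(opprK h') autHB autHN opprK. Qed.

Definition kap (g h : H) : R[i] := mu g h / mu (phi g) (phi h).

Lemma kap_norm (g h : H) : `|kap g h| = 1.
Proof. by rewrite normrM normfV !cocycle_norm invr1 mulr1. Qed.

Lemma kapP (g h k : H) : kap g h * kap (g + h) k = kap h k * kap g (h + k).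
Proof.
rewrite /kap !autHD mulrACA -invfM cocycleP [mu (phi g) _ * _]cocycleP.
by rewrite invfM mulrACA.
Qed.

(** The quotient of mu g h by mu h g is [mustarmu mu g h], so its invariance under phi is exactly
    the symmetry of [kap]. *)
Lemma kapC (g h : H) : kap g h = kap h g.
Proof.
have /asboolP[_ _ /(_ g h) + _] := valP phi.
rewrite /mustarmu !mu_conj -/(autH_fun phi) => F; rewrite /kap.
have n1 := mu_neq0 mu g h; have n2 := mu_neq0 mu h g.
have n3 := mu_neq0 mu (phi g) (phi h); have n4 := mu_neq0 mu (phi h) (phi g).
apply: (mulIf n3); rewrite divfK// -[RHS]mulrA F mulrA.
by rewrite divff// mul1r.
Qed.

Lemma kap0l h : kap 0 h = 1.
Proof. by rewrite /kap autH0 !cocycle0g divff// oner_eq0. Qed.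

Fact rho_norm h : `|chi (phi h) / chi h| = 1.
Proof. by rewrite normrM normfV !character_norm invr1 mulr1. Qed.
Fact rhoD h h' :
  chi (phi (h + h')) / chi (h + h') = (chi (phi h) / chi h) * (chi (phi h') / chi h').
Proof. by rewrite autHD !characterD invfM mulrACA. Qed.
Definition rho : character R H := Character rho_norm rhoD.

Lemma rho2 h (t : int) : rho h ^ (2 * t) = 1.
Proof.
have /asboolP[_ _ _ /(_ h) E] := valP phi.
rewrite -exprz_exp -[rho h ^ 2]/(rho h ^+ 2) expr_div_n E divff ?exp1rz//.
by rewrite expf_neq0// chi_neq0.
Qed.

Definition wt l m : H * R[i] := (l m, rho (l m) ^ qform m).

Lemma rho_norm_exp h (t : int) : `|rho h ^ t| = 1.
Proof.
case: t => n; first by rewrite -exprnP normrX character_norm expr1n.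
by rewrite NegzE -exprnN normfV normrX character_norm expr1n invr1.
Qed.

Local Notation tw := (twlaw kapP kapC kap0l).
Local Notation twp := (twprod kapP kapC kap0l).

Definition fphi l : R[i] := (\big[tw/(0, 1)]_(m \in [set: Z2]) wt l m).2.

Lemma fphiE l (s : {fset Z2}) : (forall m, m \notin s -> l m = 0) ->
  fphi l = (twp s (wt l)).2.
Proof.
move=> sl; rewrite /fphi (fsbigTE s)// => m /sl lm.
by rewrite /wt lm character0 exp1rz.
Qed.

Lemma fphi0 : fphi 0 = 1.
Proof. by rewrite (@fphiE _ fset0) // /twprod big_seq_fset0. Qed.

Lemma fphi_norm l : `|fphi l| = 1.
Proof.
have [s sl] := Lambda_fset l; rewrite (fphiE sl).
by apply: twprod_norm => [|m]; [exact: kap_norm | exact: rho_norm_exp].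
Qed.

Lemma twp_wt_fst l (s : {fset Z2}) : (forall m, m \notin s -> l m = 0) ->
  (twp s (wt l)).1 = 0.
Proof. by move=> sl; rewrite twprod_fst -(fsbigTE s) ?Lambda_sum0. Qed.

(** Both products have first component 0, as l and l' have zero sum, so they multiply there without
    a twist. Multiplying pointwise instead produces the factors kap (l m) (l' m). *)
Lemma fphi_mul l l' :
  fphi l * fphi l' = fphi (l + l') * (nu l l' / nu (autH_comp phi l) (autH_comp phi l')).
Proof.
have [s sl] := Lambda_fset l; have [t tl] := Lambda_fset l'.
pose v := (s `|` t)%fset.
have lv m : m \notin v -> l m = 0 by rewrite inE negb_or => /andP[/sl].
have lv' m : m \notin v -> l' m = 0 by rewrite inE negb_or => /andP[_ /tl].
have lvD m : m \notin v -> (l + l' : Lambda H) m = 0.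
  by move=> mv; rewrite LambdaDE lv// lv'// addr0.
rewrite (fphiE lv) (fphiE lv') (fphiE lvD).
have -> : nu l l' / nu (autH_comp phi l) (autH_comp phi l') =
    \prod_(m <- v) kap (l m) (l' m).
  rewrite /= (@cocycle_prodE _ _ _ _ _ v); last by move=> m /lv; left.
  rewrite (@cocycle_prodE _ _ _ _ _ v); last first.
    by move=> m /lv lm; left; rewrite -[LHS]/(phi (l m)) lm autH0.
  by rewrite -prodf_div.
have E : (twp v (fun m => ((wt (l + l') m).1, (wt (l + l') m).2 * kap (l m) (l' m)))).2
    = (twp v (wt (l + l'))).2 * \prod_(m <- v) kap (l m) (l' m).
  by rewrite (twprod_mulscalar kapP kapC kap0l v (wt (l + l')) (fun m => kap (l m) (l' m))).
rewrite -E.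
transitivity (twmul kap (twp v (wt l)) (twp v (wt l'))).2.
  by rewrite /twmul /= !twp_wt_fst// kap0l mulr1.
rewrite twprod_mul; congr (_.2); apply: eq_bigr => m _.
rewrite -[LHS]/(l m + l' m, rho (l m) ^ qform m * rho (l' m) ^ qform m * kap (l m) (l' m)).
rewrite -[RHS]/(l m + l' m, rho (l m + l' m) ^ qform m * kap (l m) (l' m)).
by congr (_, _ * _); rewrite [rho (l m + l' m)](characterD rho) [RHS]expfzMl.
Qed.

Lemma bernoulli_coef_rho k l : bernoulli_coef rho k l = c k (autH_comp phi l) / c k l.
Proof.
have [s sl] := Lambda_fset l; rewrite !(bernoulli_coefE _ _ sl).
rewrite (@bernoulli_coefE _ _ _ _ _ s); last first.
  by move=> m /sl lm; rewrite -[LHS]/(phi (l m)) lm autH0.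
rewrite -prodf_div; apply: eq_bigr => m _.
by rewrite /rho /= expfzMl exprz_inv invr_expz.
Qed.

Lemma fphi_act g l : fphi (Lambda_act g l) =
  fphi l * (c g.1 (autH_comp phi (Lambda_act g l)) / c g.1 (Lambda_act g l)).
Proof.
rewrite -bernoulli_coef_rho.
have gb := Z2SL2_act_bij g; have [s sl] := Lambda_fset l.
have actK m : Lambda_act g l (Z2SL2_act g m) = l m.
  by rewrite Lambda_actE Z2SL2_actK.
rewrite {1}/fphi (reindex_fsbigT _ _ gb) (fsbigTE s); last first.
  by move=> m /sl lm; rewrite /wt actK lm character0 exp1rz.
rewrite (fphiE sl) /bernoulli_coef (reindex_fsbigT _ _ gb) (fsbigTE s); last first.
  by move=> m /sl lm; rewrite actK lm character0 exp1rz.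
set w := fun m => rho (l m) ^ det2 g.1 (Z2SL2_act g m).
have E : (twp s (fun m => ((wt l m).1, (wt l m).2 * (w m * rho (l m) ^ qform g.1)))).2
    = (twp s (wt l)).2 * \prod_(m <- s) (w m * rho (l m) ^ qform g.1).
  by rewrite (twprod_mulscalar kapP kapC kap0l s (wt l) (fun m => w m * rho (l m) ^ qform g.1)).
rewrite big_split (prod_char_const rho _ sl) [X in _ = _ * X]mulr1 in E.
under [X in _ = _ * X]eq_bigr do rewrite actK.
rewrite -E; congr (_.2); apply: eq_bigr => m _.
rewrite /wt actK; congr (_, _).
have [t ->] := qform_act g m; have r0 := chi_neq0 rho (l m).
rewrite -[RHS]/(rho (l m) ^ qform m *
  (rho (l m) ^ det2 g.1 (Z2SL2_act g m) * rho (l m) ^ qform g.1)).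
move: (qform g.1) (qform m) (det2 _ _) => a b d.
by rewrite !expfzDr// rho2 mulr1 mulrAC [LHS]mulrC [X in _ = _ * X]mulrC.
Qed.

(** The second formula of [dipole_map_coef]: the form being odd at e1 supplies the single factor rho
    h. *)
Lemma fphi_dipole h : fphi (dipole h 0 e1) = kap h (- h) * (chi (phi h) / chi h).
Proof.
rewrite (@fphiE _ [fset e1; 0]%fset); last first.
  by move=> m; rewrite !inE negb_or => /andP[me m0]; rewrite dipole_off.
rewrite /twprod (big_fsetD1 e1) ?inE ?eqxx//.
rewrite (_ : ([fset e1; 0] `\ e1)%fset = [fset (0 : Z2)]%fset); last first.
  apply/fsetP => m; rewrite !inE; have [->|] := eqVneq m e1; rewrite ?andbF//=.
  by rewrite eq_sym (negPf e1_neq0).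
rewrite big_seq_fset1 /wt dipole_head ?e1_neq0// dipole_tail ?e1_neq0//.
rewrite qform_e1 qform0.
by rewrite -[LHS]/(rho h ^ 1 * rho (- h) ^ 0 * kap h (- h)) expr1z expr0z mulr1 mulrC.
Qed.

End implementing_unitary.

(** * The implementing unitary and its automorphism *)

Section bernoulli_automorphism.
Context {R : realType} {H : zmodType} {mu : cocycle R H} {chi : character R H}.
Local Notation A := (range (twisted_shift (tilde mu))).
Local Notation nu := (tilde mu).
Local Notation u := (can_unitary (tilde mu)).
Local Notation c := (bernoulli_coef chi).
Local Notation E := (ell2 R (Lambda H)).
Implicit Types (l : Lambda H) (h : H) (v w : E).
Variable phi : autH mu chi.

Local Notation P := (autH_comp phi).
Local Notation P' := (autH_comp (phi^-1)%g).

Local Notation phi' := ((phi^-1)%g : autH mu chi).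

Lemma autHK h : phi (phi' h) = h.
Proof. by rewrite -[LHS]/((phi * phi' : autH mu chi)%g h) mulgV. Qed.
Lemma autHVK h : phi' (phi h) = h.
Proof. by rewrite -[LHS]/((phi' * phi : autH mu chi)%g h) mulVg. Qed.
Lemma autH_compK : cancel P' P.
Proof. by move=> l; apply: Lambda_ext => m; exact: autHK. Qed.
Lemma autH_compVK : cancel P P'.
Proof. by move=> l; apply: Lambda_ext => m; exact: autHVK. Qed.
Lemma autH_comp0 : P 0 = 0.
Proof. by apply: Lambda_ext => m; exact: autH0. Qed.
Lemma autH_compD l l' : P (l + l') = P l + P l'.
Proof. by apply: Lambda_ext => m; exact: autHD. Qed.
Lemma autH_compB l l' : P (l - l') = P l - P l'.
Proof. by apply: Lambda_ext => m; exact: autHB. Qed.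
Lemma autH_comp_act g l : P (Lambda_act g l) = Lambda_act g (P l).
Proof. exact: Lambda_ext. Qed.
Lemma autH_comp_dipole h p q : P (dipole h p q) = dipole (phi h) p q.
Proof.
apply: Lambda_ext => m; rewrite -[LHS]/(phi (dipole h p q m)) !dipoleE.
by rewrite autHB; do 2 case: ifP => _; rewrite ?autH0.
Qed.

Lemma fphi_neq0 l : fphi phi l != 0. Proof. exact/unit_neq0/fphi_norm. Qed.

Lemma fphiD l l' : fphi phi (l + l') = fphi phi l * fphi phi l' * nu (P l) (P l') / nu l l'.
Proof.
rewrite (fphi_mul phi l l').
have := tilde_neq0 mu (P l) (P l'); have := tilde_neq0 mu l l'.
by move: (nu _ _) (nu _ _) => x y x0 y0; field; rewrite x0 y0.
Qed.

Fact wP_subproof l : `|fphi phi (P' l)| = 1. Proof. exact: fphi_norm. Qed.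
Fact wPV_subproof l : `|(fphi phi l)^-1| = 1.
Proof. by rewrite normfV fphi_norm invr1. Qed.
Fact autH_comp_bij : bijective P.
Proof. by exists P'; [exact: autH_compVK | exact: autH_compK]. Qed.
Fact autH_compV_bij : bijective P'.
Proof. by exists P; [exact: autH_compK | exact: autH_compVK]. Qed.

Definition Wphi v : E := Ell2 (weighted_reindex v wP_subproof autH_compV_bij).
Definition WphiV v : E := Ell2 (weighted_reindex v wPV_subproof autH_comp_bij).

Lemma WphiE v l : Wphi v l = fphi phi (P' l) * v (P' l). Proof. by []. Qed.
Lemma WphiVE v l : WphiV v l = (fphi phi l)^-1 * v (P l). Proof. by []. Qed.

Lemma WphiK : cancel Wphi WphiV.
Proof.
by move=> v; apply: ell2_ext => l; rewrite WphiVE WphiE autH_compVK mulKf// fphi_neq0.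
Qed.
Lemma WphiVK : cancel WphiV Wphi.
Proof.
by move=> v; apply: ell2_ext => l; rewrite WphiE WphiVE autH_compK mulVKf// fphi_neq0.
Qed.

Lemma Wphi_linear : linear Wphi.
Proof. by move=> a v w; apply: ell2_ext => l; rewrite ell2DE ell2ZE !WphiE ell2DE ell2ZE; ring. Qed.
Lemma WphiV_linear : linear WphiV.
Proof.
move=> a v w; apply: ell2_ext => l.
by rewrite ell2DE ell2ZE !WphiVE ell2DE ell2ZE; ring.
Qed.

Lemma Wphi_inner v w : inner (Wphi v) (Wphi w) = inner v w.
Proof. exact: (inner_reindex autH_compV_bij wP_subproof). Qed.

Lemma Wphi_nrm v : nrm (Wphi v) = nrm v.
Proof.
have := inner_nrm (Wphi v); rewrite Wphi_inner inner_nrm => -[vv].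
by apply/eqP; rewrite -(@eqrXn2 _ 2) ?nrm_ge0// vv.
Qed.

Lemma WphiV_nrm v : nrm (WphiV v) = nrm v.
Proof. by rewrite -Wphi_nrm WphiVK. Qed.

Lemma Wphi_bounded : bounded_op Wphi.
Proof.
apply/bounded_opP; split; first exact: Wphi_linear.
by exists 1 => // v; rewrite mul1r Wphi_nrm.
Qed.
Lemma WphiV_bounded : bounded_op WphiV.
Proof.
apply/bounded_opP; split; first exact: WphiV_linear.
by exists 1 => // v; rewrite mul1r WphiV_nrm.
Qed.

(** Keeps conjugation by [Wphi] inside the algebra, while [Wphi_twisted_shift] evaluates it on the
    unitaries. Both are [fphiD] for m - l and l, in the two orders. *)
Lemma Wphi_right_shift l v :
  Wphi (right_shift nu l v) = fphi phi l *: right_shift nu (P l) (Wphi v).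
Proof.
apply: ell2_ext => m; rewrite ell2ZE WphiE !right_shiftE WphiE.
rewrite -[m]autH_compK; move: (P' m) => {}m; rewrite -autH_compB !autH_compVK.
have -> : fphi phi m = fphi phi (m - l) * fphi phi l * nu (P (m - l)) (P l) / nu (m - l) l.
  by rewrite -fphiD subrK.
have := tilde_neq0 mu (m - l) l.
move: (nu (m - l) l) (nu _ (P l)) (fphi _ _) (fphi _ _) (v _) => x y z t r x0.
by field.
Qed.

Lemma Wphi_twisted_shift l v :
  Wphi (twisted_shift nu l v) = fphi phi l *: twisted_shift nu (P l) (Wphi v).
Proof.
apply: ell2_ext => m; rewrite ell2ZE WphiE !twisted_shiftE WphiE.
rewrite -[m]autH_compK; move: (P' m) => {}m; rewrite -autH_compB !autH_compVK.
have -> : fphi phi m = fphi phi l * fphi phi (m - l) * nu (P l) (P (m - l)) / nu l (m - l).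
  by rewrite -fphiD subrKC.
have := tilde_neq0 mu l (m - l).
move: (nu l (m - l)) (nu (P l) _) (fphi _ _) (fphi _ _) (v _) => x y z t r x0.
by field.
Qed.

Definition aut_phi : star_aut A := spatial_aut Wphi_bounded WphiV_bounded WphiK WphiVK
  Wphi_inner fphi_neq0 autH_compK Wphi_right_shift.

Lemma aut_phiE x v : aut_phi x v = Wphi (x (WphiV v)). Proof. by []. Qed.

Lemma aut_phi_unitary l : aut_phi (u l) = fphi phi l *: u (P l).
Proof.
apply: vN_opP; apply/funext => v; rewrite aut_phiE.
by rewrite -[u l _]/(twisted_shift nu l (WphiV v)) Wphi_twisted_shift WphiVK.
Qed.

Lemma aut_phi_equivariant g :
  ((bernoulli mu chi g : star_aut A) * aut_phi = aut_phi * bernoulli mu chi g)%g.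
Proof.
apply: star_aut_ext => l.
rewrite -[LHS]/(bernoulli mu chi g (aut_phi (u l))).
rewrite -[RHS]/(aut_phi (bernoulli mu chi g (u l))).
rewrite aut_phi_unitary star_autZ bernoulli_u bernoulli_u star_autZ aut_phi_unitary.
rewrite fphi_act autH_comp_act !scalerA; congr (_ *: _).
have := coef_neq0 chi g.1 (Lambda_act g l).
move: (c g.1 (Lambda_act g l)) (c g.1 (Lambda_act g (P l))) => x y x0.
by field.
Qed.

End bernoulli_automorphism.

(** * The isomorphism of topological groups *)

Section topology.

Lemma continuous_ptws {X : topologicalType} {U : Type} {V : topologicalType}
    (f : X -> {ptws U -> V}) :
  (forall t, continuous (fun x => f x t)) -> continuous f.
Proof.
move=> fc x; apply/cvg_sup => t; move: x.
exact: (@continuous_comp_initial _ _ _ (fun g : U -> V => g t) f (fc t)).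
Qed.

Lemma ptws_eval_continuous {U : eqType} {V : topologicalType} (t : U) :
  continuous (fun f : {ptws U -> V} => f t).
Proof. exact: (@proj_continuous _ (fun=> V) t). Qed.

Context {R : realType} {H : zmodType} {mu : cocycle R H} {chi : character R H}.
Local Notation N := (twisted_vN (tilde mu)).
Local Notation A := (range (twisted_shift (tilde mu))).
Local Notation E := (ell2 R (Lambda H)).
Local Notation beta := (bernoulli mu chi).

Lemma autH_eval_near (phi0 : autH mu chi) h : \forall phi \near phi0,
  autH_fun phi h = autH_fun phi0 h.
Proof.
have ec : continuous (fun phi : autH mu chi => autH_ptws phi h).
  move=> phi; apply: (@continuous_comp _ _ _ (@autH_ptws _ _ mu chi)
    (fun f : {ptws H -> discrete_topology H} => f h)).
    exact: initial_continuous.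
  exact: ptws_eval_continuous.
exact: (ec phi0 _ (discrete_set1 (autH_ptws phi0 h : discrete_topology H))).
Qed.

Lemma autN_eval_continuous (x : N) (v : E) :
  continuous (fun a : autN beta => (a x) v : E).
Proof.
move=> a; apply: (@continuous_comp _ _ _ (\val : autN beta -> star_aut A)
  (fun a : star_aut A => (a x) v : E)).
  exact: initial_continuous.
apply: (@continuous_comp _ _ _ (@star_aut_eval _ _ A)
  (fun f : {ptws (vN A * E)%type -> E} => f (x, v))).
  exact: initial_continuous.
exact: ptws_eval_continuous.
Qed.

(** Only finitely many values of phi enter, and H is discrete, so both are locally constant. They
    are treated together because the scalar of a sum involves the images of the summands. *)
Lemma fphi_near (phi0 : autH mu chi) l : \forall phi \near phi0,
  fphi phi l = fphi phi0 l /\ autH_comp phi l = autH_comp phi0 l.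
Proof.
move: l; apply: (@Lambda_gen H) => [|l l' Pl Pl'|g l Pl|h].
- by near=> phi; rewrite !autH_comp0 !fphi0.
- near=> phi; have [fl Pl1] : fphi phi l = fphi phi0 l /\ autH_comp phi l = autH_comp phi0 l.
    by near: phi.
  have [fl' Pl1'] : fphi phi l' = fphi phi0 l' /\ autH_comp phi l' = autH_comp phi0 l'.
    by near: phi.
  by rewrite !fphiD !autH_compD fl fl' Pl1 Pl1'.
- near=> phi; have [fl Pl1] : fphi phi l = fphi phi0 l /\ autH_comp phi l = autH_comp phi0 l.
    by near: phi.
  by rewrite !fphi_act !autH_comp_act fl Pl1.
- near=> phi; have ph : phi h = phi0 h by near: phi; exact: autH_eval_near.
  by rewrite !fphi_dipole !autH_comp_dipole /kap !autHN ph.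
Unshelve. all: by end_near. Qed.

Lemma Wphi_delta (phi : autH mu chi) l :
  Wphi phi (delta l) = fphi phi l *: delta (autH_comp phi l).
Proof.
apply: ell2_ext => m; rewrite WphiE ell2ZE !delta_coefE.
rewrite (can2_eq (autH_compK phi) (autH_compVK phi)).
case: (m =P autH_comp phi l) => [->|_].
  by rewrite autH_compVK.
by rewrite !mulr0.
Qed.

(** On finite truncations [Wphi] is locally constant in phi; the tails are controlled because every
    [Wphi] is isometric. *)
Lemma Wphi_near (phi0 : autH mu chi) (v : E) (e : R) : 0 < e ->
  \forall phi \near phi0, nrm (Wphi phi v - Wphi phi0 v) < e.
Proof.
move=> e0; have e20 : 0 < e / 2 by rewrite divr_gt0.
have [s vs] := cutoff_approx v e20.
have sn : \forall phi \near phi0, Wphi phi (cutoff s v) = Wphi phi0 (cutoff s v).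
  rewrite cutoff_delta; elim: (s : seq _) => [|l t IH].
    near=> phi; rewrite big_nil.
    by rewrite !(linear_lim0 (Wphi_linear _)).
  near=> phi; rewrite big_cons !(linear_limD _ _ (Wphi_linear _)).
  rewrite !(linear_limZ _ _ (Wphi_linear _)) !Wphi_delta.
  have [-> ->] : fphi phi l = fphi phi0 l /\ autH_comp phi l = autH_comp phi0 l.
    by near: phi; exact: fphi_near.
  by congr (_ + _); near: phi.
near=> phi.
have -> : Wphi phi v - Wphi phi0 v =
    Wphi phi (v - cutoff s v) - Wphi phi0 (v - cutoff s v).
  rewrite !(linear_limB _ _ (Wphi_linear _)).
  have -> : Wphi phi (cutoff s v) = Wphi phi0 (cutoff s v) by near: phi.
  by ell2_ring.
apply: le_lt_trans (nrmB _ _) _; rewrite !Wphi_nrm [ltRHS]splitr.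
exact: (ltrD vs vs).
Unshelve. all: by end_near. Qed.

Lemma aut_phi_eval_continuous (x : N) (v : E) :
  continuous (fun phi : autH mu chi => aut_phi phi x v : E).
Proof.
move=> phi0; apply/(@cvgrPdist_lt _ _ _ (nbhs phi0)) => e e0.
have eE : e = (complex.Re e)%:C%C by apply: lecR_realE; exact: gtr0_real.
have re0 : 0 < complex.Re e by move: e0; rewrite ltcE /= => /andP[].
move: (complex.Re e) re0 eE => r r0 ->.
have [M M0 xM] := vN_bound x.
have r20 : 0 < r / 2 by rewrite divr_gt0.
have rM : 0 < r / 2 / M by rewrite divr_gt0.
have n1 := Wphi_near phi0 (WphiV phi0 v) rM.
have n2 := Wphi_near phi0 (x (WphiV phi0 v)) r20.
near=> phi; rewrite normE ltcR.
rewrite !aut_phiE.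
have -> : Wphi phi0 (x (WphiV phi0 v)) - Wphi phi (x (WphiV phi v)) =
  Wphi phi (x (WphiV phi0 v - WphiV phi v)) -
  (Wphi phi (x (WphiV phi0 v)) - Wphi phi0 (x (WphiV phi0 v))).
  by rewrite vN_opBr (linear_limB _ _ (Wphi_linear _)); ell2_ring.
apply: le_lt_trans (nrmB _ _) _; rewrite [r]splitr.
apply: ltrD; last by near: phi; exact: n2.
rewrite Wphi_nrm; apply: le_lt_trans (xM _) _; rewrite mulrC -ltr_pdivlMr//.
(* Applying the isometry [Wphi phi] to the difference of inverses reduces it to [Wphi_near] at the
   vector WphiV phi0 v. *)
rewrite -(Wphi_nrm phi) (linear_limB _ _ (Wphi_linear _)) WphiVK.
rewrite -{2}(WphiVK phi0 v).
by near: phi; exact: n1.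
Unshelve. all: by end_near. Qed.

End topology.

(** * Bijection and homeomorphism *)

Section isomorphism.
Context {R : realType} {H : zmodType} {mu : cocycle R H} {chi : character R H}.
Local Notation A := (range (twisted_shift (tilde mu))).
Local Notation u := (can_unitary (tilde mu)).
Local Notation E := (ell2 R (Lambda H)).
Local Notation beta := (bernoulli mu chi).
Local Notation b0 := (fun h => dipole h 0 e1).

Lemma autN_equivariant (pi : autN beta) g x : pi (beta g x) = beta g (pi x).
Proof.
have /asboolP/(_ g) E := valP pi.
rewrite -[LHS]/((\val pi * beta g : star_aut A)%g x).
by rewrite -E.
Qed.

Lemma implements_dipole (pi : autN beta) (phi : autH mu chi) : implements pi phi ->
  exists f : H -> R[i], (forall h, `|f h| = 1) /\
    forall h, pi (u (b0 h)) = f h *: u (b0 (phi h)).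
Proof.
move=> ip; have /choice[f fP] : forall h, exists z : R[i], `|z| = 1 /\
    pi (u (b0 h)) = z *: u (b0 (phi h)).
  by move=> h; have [z z1] := ip (b0 h); rewrite autH_comp_dipole; exists z.
by exists f; split=> h; have [] := fP h.
Qed.

Lemma implements_uniq (pi : autN beta) (phi psi : autH mu chi) :
  implements pi phi -> implements pi psi -> phi = psi.
Proof.
move=> /implements_dipole[f [f1 fP]] /implements_dipole[k [k1 kP]].
apply: val_inj; apply/funext => h; have := fP h; rewrite kP.
case/can_unitary_inj; first exact: unit_neq0.
by move=> /(dipole_inj e1_neq0) E _; symmetry; exact: E.
Qed.

Lemma autN_K (pi : autN beta) x : pi ((pi^-1%g : autN beta) x) = x.
Proof. by rewrite -[LHS]/((pi * pi^-1 : autN beta)%g x) mulgV. Qed.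
Lemma autN_VK (pi : autN beta) x : (pi^-1%g : autN beta) (pi x) = x.
Proof. by rewrite -[LHS]/((pi^-1 * pi : autN beta)%g x) mulVg. Qed.

Lemma dipole_map_cancel (a b : autN beta) (phi psi : H -> H) (f k : H -> R[i]) :
  (forall x, b (a x) = x) -> (forall h, `|f h| = 1) -> (forall h, `|k h| = 1) ->
  (forall h, a (u (b0 h)) = f h *: u (b0 (phi h))) ->
  (forall h, b (u (b0 h)) = k h *: u (b0 (psi h))) -> cancel phi psi.
Proof.
move=> ba f1 k1 fP kP h; have := ba (u (b0 h)); rewrite fP.
rewrite [X in X = _](star_autZ (\val b) (f h)) -/(autN_fun b _) kP scalerA -[RHS]scale1r.
case/can_unitary_inj; last by move=> /(dipole_inj e1_neq0).
by rewrite mulf_neq0//; exact: unit_neq0.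
Qed.

(** Bijectivity of phi comes from the map psi attached in the same way to the inverse of pi. *)
Lemma implements_exists (pi : autN beta) : exists phi : autH mu chi, implements pi phi.
Proof.
have dip (a : autN beta) : exists phi : H -> H, exists f : H -> R[i],
    (forall h, `|f h| = 1) /\ forall h, a (u (b0 h)) = f h *: u (b0 (phi h)).
  have /choice[p pP] h := aut_dipole (autN_equivariant a) h.
  have /choice[f fP] : forall h, exists z : R[i], `|z| = 1 /\ a (u (b0 h)) = z *: u (b0 (p h)).
    by move=> h; have [z z1 aE] := pP h; exists z.
  by exists p, f; split=> h; have [] := fP h.
have [phi [f [f1 fP]]] := dip pi; have [psi [k [k1 kP]]] := dip (pi^-1)%g.
have phiK := dipole_map_cancel (autN_VK pi) f1 k1 fP kP.
have psiK := dipole_map_cancel (autN_K pi) k1 f1 kP fP.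
have phiP : phi \in is_aut_mustarmu_chi2 mu chi.
  apply/asboolP; split.
  - by exists psi.
  - exact: (dipole_map_zmod f1 fP).
  - exact: (dipole_map_mustarmu (autN_equivariant pi) f1 fP).
  - exact: (dipole_map_chi (autN_equivariant pi) f1 fP).
exists (Sub phi phiP) => l.
have [z z1 zE] := aut_comp_map (autN_equivariant pi) f1 fP l; exists z => //.
rewrite [LHS]zE.
by congr (_ *: u _); exact: Lambda_ext.
Qed.

Definition autN_of (phi : autH mu chi) : autN beta :=
  Sub (aut_phi phi) (introT (asboolP _) (aut_phi_equivariant phi)).

Lemma autN_ofE phi x : autN_of phi x = aut_phi phi x. Proof. by []. Qed.

Lemma implements_autN_of phi : implements (autN_of phi) phi.
Proof.
by move=> l; exists (fphi phi l); [exact: fphi_norm | rewrite autN_ofE aut_phi_unitary].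
Qed.

(** No scalar freedom remains: equivariance determines the scalars on the generating dipoles, and
    hence everywhere by [Lambda_gen]. *)
Lemma autN_of_implements (pi : autN beta) phi : implements pi phi -> autN_of phi = pi.
Proof.
move=> ip; have [f [f1 fP]] := implements_dipole ip.
apply: val_inj; apply: star_aut_ext => l; rewrite -[LHS]/(aut_phi phi (u l)).
rewrite aut_phi_unitary; symmetry; move: l.
apply: (@Lambda_gen H) => [|l l' Pl Pl'|g l Pl|h].
- by rewrite autH_comp0 fphi0 scale1r can_unitary0; exact: star_aut1.
- rewrite (aut_add Pl Pl') -autH_compD; congr (_ *: _).
  by rewrite fphiD.
- rewrite (aut_act (autN_equivariant pi) g Pl) fphi_act autH_comp_act.
  by rewrite mulrA.
- rewrite autH_comp_dipole fphi_dipole; apply: etrans (fP h) _; congr (_ *: _).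
  have [_ ->] := dipole_map_coef (autN_equivariant pi) f1 fP h.
  rewrite /kap autHN invfM.
  by rewrite mulrACA.
Qed.

Lemma autN_iso : exists Phi : autN beta -> autH mu chi,
  (forall pi : autN beta, unique (implements pi) (Phi pi)) /\ topological_group_iso Phi.
Proof.
have /choice[Phi PhiP] := @implements_exists.
have PhiE pi phi : implements pi phi -> Phi pi = phi.
  by move=> ip; exact: implements_uniq (PhiP pi) ip.
exists Phi; split=> [pi|]; first by split=> // phi; exact: PhiE.
split.
- move=> a b; apply: PhiE => l; have [z z1 bl] := PhiP b l.
  have [w w1 al] := PhiP a (autH_comp (Phi b) l).
  exists (z * w); first by rewrite normrM z1 w1 mulr1.
  rewrite -[LHS]/((a : autN beta) ((b : autN beta) (u l))) bl
    [LHS](star_autZ (\val a) z) -/(autN_fun a _) al scalerA.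
  by congr (_ *: u _); exact: Lambda_ext.
- apply: (@continuous_comp_initial _ _ _ (@autH_ptws _ _ mu chi) Phi).
  apply: continuous_ptws => h pi0.
  suff S : \forall pi \near pi0, autH_fun (Phi pi0) h == autH_fun (Phi pi) h.
    move=> U /principal_filterP Ux; apply: (filterS _ S) => pi /eqP E.
    by rewrite /preimage /= /autH_ptws -E.
  have [f [f1 fP]] := implements_dipole (PhiP pi0).
  (* If phi changed at h, the two images of [delta 0] would be unimodular multiples of distinct
     basis vectors, at distance at least 1. *)
  have := @autN_eval_continuous R H mu chi (u (b0 h)) (delta 0) pi0.
  move=> /(@cvgrPdist_lt _ _ _ (nbhs pi0))/(_ 1 ltr01) near1.
  near=> pi; have : `|autN_fun pi0 (u (b0 h)) (delta 0) - autN_fun pi (u (b0 h)) (delta 0)| < 1.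
    by near: pi; exact: near1.
  have [k [k1 kP]] := implements_dipole (PhiP pi).
  rewrite fP kP !vN_opZ !can_unitary_delta0 normE -[1]/(1%:C%C) ltcR => lt1.
  apply: contraT => ne.
  have := le_lt_trans (normc_le_nrm _ (b0 (Phi pi0 h))) lt1.
  rewrite ell2DE ell2NE !ell2ZE !delta_coefE eqxx mulr1.
  have -> : (b0 (Phi pi0 h) == b0 (Phi pi h)) = false.
    apply/eqP => /(dipole_inj e1_neq0) ee; by move: ne; rewrite ee eqxx.
  rewrite mulr0 subr0; have := f1 h; rewrite normc_normE => -[->].
  by rewrite ltxx.
- exists autN_of; split=> [pi|phi|].
  + exact: autN_of_implements (PhiP pi).
  + exact: PhiE (implements_autN_of phi).
  apply: (@continuous_comp_initial _ _ _ (\val : autN beta -> star_aut A) autN_of).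
  apply: (@continuous_comp_initial _ _ _ (@star_aut_eval _ _ A) (\val \o autN_of)).
  by apply: continuous_ptws => -[x v]; exact: aut_phi_eval_continuous.
Unshelve. all: by end_near. Qed.

End isomorphism.

Theorem theorem4p4 (R : realType) (H : zmodType)
    (mu : cocycle R H) (chi : character R H)
    (beta : Z2SL2 -> star_aut (range (twisted_shift (tilde mu)))) :
  countable [set: H] -> (exists h : H, h != 0) ->
  is_twisted_bernoulli chi beta ->
  exists Phi : autN beta -> autH mu chi,
    (forall pi : autN beta, unique (implements pi) (Phi pi)) /\
    topological_group_iso Phi.
Proof. by move=> _ _ /twisted_bernoulli_uniq ->; exact: autN_iso. Qed.
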